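(* Let $d\ge2$, $1\le k\le d-1$, let $M\ge2$ be an integer and $p\in(M^{-(d-k)},1)$, and let $K_p^\omega\subset\mathbb R^d$ be the Mandelbrot percolation set with parameters $M,p$. Then for every $\epsilon>0$, almost surely conditional on $K_p^\omega\ne\emptyset$, for all $k$-dimensional linear subspaces $V$ of $\mathbb R^d$, $$\mathcal L^k\big\{x\in V:\ \dim_H\big(K_p^\omega\cap\pi_V^{-1}(x)\big)\ge\dim_H K_p^\omega-k-\epsilon\big\}>0.$$
   Context: Mandelbrot percolation: starting from the unit cube $K^0=[0,1]^d$, divide it into $M^d$ closed subcubes of side $1/M$ and retain each independently with probability $p$; $K^1$ is the union of retained cubes. Inductively, each retained cube of side $M^{-n}$ in $K^n$ is divided into $M^d$ subcubes of side $M^{-n-1}$, each retained independently (of everything else) with probability $p$, and $K^{n+1}$ is the union of retained cubes. $K_p^\omega=\bigcap_{n\ge0}K^n$. (It is known that for $p>M^{-d}$, conditional on $K_p^\omega\ne\emptyset$, $\dim_H K_p^\omega=d+\log p/\log M$ almost surely.) $\pi_V$ is orthogonal projection onto $V$, $\mathcal L^k$ is $k$-dimensional Lebesgue measure on $V$, $\dim_H\emptyset=-\infty$. *)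

(* Defs.v *)
From HB Require Import structures.
From mathcomp Require Import all_boot all_order all_algebra.
From mathcomp Require Import all_classical all_reals all_analysis.
Set Implicit Arguments.
Unset Strict Implicit.
Unset Printing Implicit Defensive.
Import Order.TTheory GRing.Theory Num.Theory.
Local Open Scope classical_set_scope.
Local Open Scope ring_scope.

Section Geometry.
Variable R : realType.

Definition eucl (n : nat) (x : 'rV[R]_n) : R :=
  Num.sqrt (\sum_(i < n) x ord0 i ^+ 2).

(** Diameter (Euclidean); diam set0 = -oo. *)
Definition diam (n : nat) (U : set 'rV[R]_n) : \bar R :=
  ereal_sup [set (eucl (x - y))%:E | x in U & y in U].

Definition diam_pow (n : nat) (s : R) (U : set 'rV[R]_n) : \bar R :=
  if pselect (U = set0) then 0%E else ((fine (diam U)) `^ s)%:E.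

Definition hausdorff_content (n : nat) (s delta : R) (A : set 'rV[R]_n)
  : \bar R :=
  ereal_inf [set (\sum_(0 <= i <oo) diam_pow s (U i))%E |
     U in [set U : nat -> set 'rV[R]_n |
       A `<=` \bigcup_i U i /\ forall i, (diam (U i) <= delta%:E)%E]].

Definition hausdorff_measure (n : nat) (s : R) (A : set 'rV[R]_n) : \bar R :=
  ereal_sup [set hausdorff_content s delta A | delta in [set e : R | 0 < e]].

Definition dimH (n : nat) (A : set 'rV[R]_n) : \bar R :=
  if pselect (A = set0) then -oo%E
  else ereal_inf [set s%:E | s in [set s : R | 0 <= s /\
                                   hausdorff_measure s A = 0%E]].

Definition box (k : nat) (a b : 'rV[R]_k) : set 'rV[R]_k :=
  [set x | forall i, a ord0 i <= x ord0 i <= b ord0 i].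

Definition lebesgue_outer (k : nat) (A : set 'rV[R]_k) : \bar R :=
  ereal_inf [set z : \bar R | exists (a b : nat -> 'rV[R]_k),
     [/\ forall n i, a n ord0 i <= b n ord0 i,
         A `<=` \bigcup_n box (a n) (b n) &
         z = (\sum_(0 <= n <oo) (\prod_(i < k) (b n ord0 i - a n ord0 i))%:E)%E]].

(** A k-dimensional linear subspace V of R^d is given by an orthonormal basis
    B (its k rows), i.e. B *m B^T = 1.  V = {t *m B | t in R^k}. *)
Definition orthonormal_frame (k d : nat) (B : 'M[R]_(k, d)) : Prop :=
  B *m B^T = 1%:M.

Definition projV (k d : nat) (B : 'M[R]_(k, d)) (y : 'rV[R]_d) : 'rV[R]_d :=
  y *m B^T *m B.

(** k-dimensional Lebesgue (outer) measure on V, transported through the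
    isometric parametrisation t |-> t *m B of V by R^k. *)
Definition lebesgueV (k d : nat) (B : 'M[R]_(k, d)) (A : set 'rV[R]_d) : \bar R :=
  lebesgue_outer [set t : 'rV[R]_k | A (t *m B)].

End Geometry.

Section Mandelbrot.
Variables (R : realType) (d M : nat).

(** A digit selects one of the M^d subcubes: a vector in {0,..,M-1}^d. *)
Definition digit := {ffun 'I_d -> 'I_M}.

(** A cube of level n is addressed by [:: a_1; ...; a_n]; its lower corner
    is sum_j a_j M^{-j} and its side is M^{-n}. *)
Definition cube (s : seq digit) : set 'rV[R]_d :=
  [set x | forall i : 'I_d,
     let c := \sum_(j < size s) (tnth (in_tuple s) j i : nat)%:R
                                 * (M%:R ^- j.+1) in
     c <= x ord0 i <= c + M%:R ^- (size s)].

(** The cube with address s is retained iff every non-empty prefix of s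
    was retained by its own coin flip. *)
Definition retained (X : seq digit -> bool) (s : seq digit) : bool :=
  all (fun j => X (take j s)) (iota 1 (size s)).

Definition Kn (X : seq digit -> bool) (n : nat) : set 'rV[R]_d :=
  \bigcup_(s in [set s : seq digit | size s = n /\ retained X s]) cube s.

Definition mandelbrot (X : seq digit -> bool) : set 'rV[R]_d :=
  \bigcap_n Kn X n.

End Mandelbrot.

(* Main.v *)
Require Import Defs.
From HB Require Import structures.
From mathcomp Require Import all_boot all_order all_algebra.
From mathcomp Require Import all_classical all_reals all_analysis.
From mathcomp Require Import ring lra zify.
Set Implicit Arguments.
Unset Strict Implicit.
Unset Printing Implicit Defensive.
Import Order.TTheory GRing.Theory Num.Theory.
Import numFieldNormedType.Exports.
Local Open Scope classical_set_scope.
Local Open Scope ring_scope.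

(* Idea. Let D = d - k, q = p M^D, Lam = p M^d. A fibre of the projection, written
   with k pivot coordinates as functions of the D others, gives each cube a
   weight (its share of the fibre), and p^-n times the weight of the retained
   cubes of level n is a martingale in n. An exponential moment bound and
   Borel-Cantelli over nets of fibres of exponential size show that almost surely,
   uniformly in the plane and from some level on, the part of this mass inside a
   cube of level j grows by at most summable amounts, so it stays
   below C (r/q)^j with r > 1 as close to 1 as needed. Only fibres coming close to
   the walls of the cubes escape the comparison between successive nets, and those
   carry arbitrarily small total mass.
   On survival the total mass is bounded below infinitely often. If the parameters
   whose fibre has dimension at least s0 = log(q/r)/log M formed a null set T, then
   by compactness the fibres would be of three kinds: irregular, close to a small
   cover of T, or with retained cubes covered by words Q with small sum (r/q)^|Q|.
   The three kinds carry too little mass, a contradiction. Boundedness of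
   p^-n M^-(nd) times the population gives dim K <= log Lam / log M. *)

(** * Words and cubes *)

(** All planes can be treated at once because of the quality of the tail bound: for one weight and
    one cube, a step fails with probability at most [exp(-r^n)], against nets of size only [a b^n].
    Rounding to a net cannot be harmless for every fibre, since membership in a half-open cube is
    not stable under perturbation. It is harmless on average over parallel fibres: few parameters
    come within a multiple of [M^-(L n)] of one of the roughly [M^n] walls of level [n], and with
    [L = 4 d + 2] this average loss beats every other exponential factor in play. The lower bound
    uses the same averaging: summed over all parallel fibres, the mass is at least the normalised
    population, whatever the plane. The bound [C (r/q)^j] is a Frostman condition: a fibre covered
    by words with small sum of [(r/q)^|Q|] can carry only little mass. The condition [r^3 <= q]
    serves the exponential moment, and [r^2 <= M^eps] pays for the loss in dimension. *)

Section Words.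
Variables d M : nat.
Local Notation word := (seq (digit d M)).

Fixpoint words n : seq word :=
  if n is n'.+1 then [seq rcons s a | s <- words n', a <- enum {: digit d M}]
  else [:: [::]].

Lemma mem_words n (s : word) : (s \in words n) = (size s == n).
Proof.
elim: n s => [|n IH] s /=; first by rewrite inE size_eq0.
apply/allpairsP/idP => [[[t a] /= [tn _ ->]]|].
  by rewrite size_rcons eqSS -IH.
case/lastP: s => // t a; rewrite size_rcons eqSS -IH => tn.
by exists (t, a); rewrite tn mem_enum.
Qed.

Lemma words_uniq n : uniq (words n).
Proof.
elim: n => //= n IH; apply: allpairs_uniq => //; first exact: enum_uniq.
by move=> [s a] [t b] _ _ /= /rcons_inj [-> ->].
Qed.

Lemma size_in_words n (s : word) : s \in words n -> size s = n.
Proof. by rewrite mem_words => /eqP. Qed.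

Lemma big_words_rcons (V : nmodType) n (F : word -> V) :
  \sum_(s <- words n.+1) F s = \sum_(s <- words n) \sum_a F (rcons s a).
Proof.
rewrite /= big_allpairs_dep; apply: eq_bigr => s _.
by rewrite big_enum.
Qed.

Lemma card_digit : #|{: digit d M}| = (M ^ d)%N.
Proof. by rewrite card_ffun !card_ord. Qed.

Lemma size_words n : size (words n) = (M ^ (n * d))%N.
Proof.
elim: n => //= n IH.
by rewrite size_allpairs IH -cardE card_digit -expnD mulSn addnC.
Qed.

(** Each word of length [n] has [M^(m d)] extensions by [m] digits. This trades averages over fine
    words for averages over coarse ones. *)
Lemma sum_words_take (V : nmodType) n m (F : word -> V) :
  \sum_(s <- words (n + m)) F (take n s) =
  (\sum_(s <- words n) F s) *+ (M ^ (m * d)).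
Proof.
elim: m => [|m IH].
  rewrite addn0 mulr1n big_seq [RHS]big_seq; apply: eq_bigr => s.
  by rewrite mem_words => /eqP sn; rewrite take_oversize ?sn.
rewrite addnS big_words_rcons mulSn expnD mulnC mulrnA -IH -sumrMnl big_seq [RHS]big_seq.
apply: eq_bigr => s /size_in_words sn.
under eq_bigr do rewrite -cats1 takel_cat ?sn ?leq_addr //.
by rewrite sumr_const card_digit.
Qed.

Lemma sum_pred1_uniq (V : nmodType) (I : eqType) (r : seq I) (s : I) (F : I -> V) :
  uniq r -> s \in r -> \sum_(c <- r) (if c == s then F c else 0) = F s.
Proof.
move=> ur sr; rewrite (bigD1_seq s) //= eqxx big1 ?addr0 // => i /negPf -> //.
Qed.

Lemma retained_rcons (x : word -> bool) s a :
  retained x (rcons s a) = retained x s && x (rcons s a).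
Proof.
rewrite /retained size_rcons -(addn1 (size s)) iotaD all_cat /= add1n andbT.
congr (_ && _); last by rewrite take_oversize // size_rcons.
apply: eq_in_all => j; rewrite mem_iota add1n ltnS => /andP[_ js].
by rewrite -cats1 takel_cat.
Qed.

Lemma retained_take (x : word -> bool) n s : retained x s -> retained x (take n s).
Proof.
elim/last_ind: s => // s a IH.
rewrite retained_rcons => /andP[rs xs]; case: (leqP n (size s)) => ns.
  by rewrite -cats1 takel_cat // IH.
by rewrite take_oversize ?size_rcons // retained_rcons rs.
Qed.

(** Horner form of the address: coordinate [i] of the lower corner is [idx s i / M^(size s)]. With
    integer coordinates, membership becomes truncation and taking a prefix becomes division by a
    power of [M]. *)
Definition idx (s : word) (i : 'I_d) : nat := foldl (fun v (a : digit d M) => M * v + a i)%N 0 s.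

Lemma idx_rcons s a i : idx (rcons s a) i = (M * idx s i + a i)%N.
Proof. by rewrite /idx foldl_rcons. Qed.

Lemma idx_lt s i : (idx s i < M ^ size s)%N.
Proof.
elim/last_ind: s => // s a IH; rewrite idx_rcons size_rcons expnS.
have := ltn_ord (a i); nia.
Qed.

Lemma cubeE (R : realType) (s : word) : (0 < M)%N ->
  @cube R d M s = [set x : 'rV[R]_d | forall i,
    (idx s i)%:R / M%:R ^+ size s <= x ord0 i <= (idx s i).+1%:R / M%:R ^+ size s].
Proof.
move=> M0; apply: eq_set => x; apply: eq_forall => i /=.
have Mn : (M%:R : R) != 0 by rewrite pnatr_eq0 -lt0n.
have -> : \sum_(j < size s) ((tnth (in_tuple s) j i : nat)%:R : R) / M%:R ^+ j.+1 =
   (idx s i)%:R / M%:R ^+ size s.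
  case: (s) => [|a0 s0]; first by rewrite big_ord0 mul0r.
  move: (a0 :: s0) => t.
  rewrite (eq_bigr (fun j : 'I_(size t) => (nth a0 t j i)%:R / M%:R ^+ j.+1)); last first.
    by move=> j _; rewrite (tnth_nth a0).
  elim/last_ind: t => [|t a IH]; first by rewrite big_ord0 mul0r.
  rewrite size_rcons big_ord_recr /= nth_rcons ltnn eqxx idx_rcons natrD natrM.
  rewrite (eq_bigr (fun j : 'I_(size t) => (nth a0 t j i)%:R / M%:R ^+ j.+1)); last first.
    by move=> j _; rewrite nth_rcons ltn_ord.
  rewrite IH exprS; field.
  by rewrite Mn expf_neq0.
by rewrite -natr1 mulrDl mul1r.
Qed.

End Words.

Arguments words : simpl never.

(** * Independent coins *)

Section Coins.
Variables (R : realType) (I : eqType) (p : R).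
Hypotheses (p0 : 0 <= p) (p1 : p <= 1).
Implicit Types (x y : I -> bool) (F : seq I) (G : (I -> bool) -> R).

Definition upd x (s : I) (b : bool) : I -> bool := fun t => if t == s then b else x t.

(* Expectation of G when the coins in F are tossed afresh and x is kept elsewhere. *)
Fixpoint Ex F G x : R :=
  if F is s :: F' then p * Ex F' G (upd x s true) + (1 - p) * Ex F' G (upd x s false)
  else G x.

Definition agree_off F x y := forall t, t \notin F -> y t = x t.

Lemma agree_off_upd s F x y b : agree_off F (upd x s b) y -> agree_off (s :: F) x y.
Proof.
move=> h t; rewrite inE negb_or => /andP[ts tF].
by rewrite h // /upd (negPf ts).
Qed.

Lemma Ex_le F G G' x : (forall y, agree_off F x y -> G y <= G' y) -> Ex F G x <= Ex F G' x.
Proof.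
elim: F x => [|s F IH] x h /=; first exact: h.
have p1' : 0 <= 1 - p by rewrite subr_ge0.
apply: lerD; (apply: ler_wpM2l => //; apply: IH => y hy; apply: h; exact: agree_off_upd hy).
Qed.

Lemma Ex_eq F G G' x : (forall y, agree_off F x y -> G y = G' y) -> Ex F G x = Ex F G' x.
Proof.
move=> h; apply/eqP; rewrite eq_le; apply/andP.
by split; apply: Ex_le => y hy; rewrite h.
Qed.

Lemma Ex_cst F c x : Ex F (fun=> c) x = c.
Proof. by elim: F x => //= s F IH x; rewrite !IH; ring. Qed.

Lemma Ex_scale F G c x : Ex F (fun y => c * G y) x = c * Ex F G x.
Proof. by elim: F x => //= s F IH x; rewrite !IH; ring. Qed.

Lemma Ex_add F G G' x : Ex F (fun y => G y + G' y) x = Ex F G x + Ex F G' x.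
Proof. by elim: F x => //= s F IH x; rewrite !IH; ring. Qed.

Lemma Ex_cat F F' G x : Ex (F ++ F') G x = Ex F (Ex F' G) x.
Proof. by elim: F x => //= s F IH x; rewrite !IH. Qed.

Lemma Ex_prod F G (g : I -> bool -> R) x : uniq F ->
  (forall y, agree_off F x y -> G y = \prod_(s <- F) g s (y s)) ->
  Ex F G x = \prod_(s <- F) (p * g s true + (1 - p) * g s false).
Proof.
elim: F G x => [|s F IH] G x /=.
  by move=> _ h; rewrite big_nil h ?big_nil.
move=> /andP[sF uF] h.
have key b : Ex F G (upd x s b) =
    g s b * \prod_(t <- F) (p * g t true + (1 - p) * g t false).
  rewrite -(IH (fun y => \prod_(t <- F) g t (y t)) (upd x s b) uF) // -Ex_scale.
  apply: Ex_eq => y hy; rewrite h; last exact: agree_off_upd hy.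
  by rewrite big_cons hy // /upd eqxx.
by rewrite !key big_cons; ring.
Qed.

Definition depends_on F (T : Type) (G : (I -> bool) -> T) :=
  forall x y, (forall s, s \in F -> x s = y s) -> G x = G y.

Lemma Ex_upd F G x s b : s \notin F ->
  Ex F G (upd x s b) = Ex F (fun y => G (upd y s b)) x.
Proof.
elim: F x => //= t F IH x; rewrite inE negb_or => /andP[st sF].
have uC c : upd (upd x s b) t c = upd (upd x t c) s b.
  apply/funext => u; rewrite /upd; case: eqVneq => // ->.
  by rewrite eq_sym (negPf st).
by rewrite !uC !IH.
Qed.

End Coins.

Section Law.
Variables (R : realType) (I : eqType) (p : R) (dO : measure_display).
Variables (Omega : measurableType dO) (P : probability Omega R) (X : Omega -> I -> bool).
Variable (ok : pred I).
Hypothesis mX : forall s, measurable [set w | X w s].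
Hypothesis indX : forall F : seq I, uniq F -> all ok F ->
     P (\big[setI/setT]_(s <- F) [set w | X w s]) = (p ^+ size F)%:E.

Lemma measurable_depends_on F (G : (I -> bool) -> bool) :
  depends_on F G -> measurable [set w | G (X w)].
Proof.
elim: F G => [|s F IH] G h.
  have [Gt|Gf] := boolP (G (fun=> false)).
    rewrite (_ : [set w | _] = setT); first exact: measurableT.
    by apply/seteqP; split => w //= _; rewrite (h _ (fun=> false)).
  rewrite (_ : [set w | _] = set0); first exact: measurable0.
  by apply/seteqP; split => w //=; rewrite (h _ (fun=> false)) // (negPf Gf).
have m b : measurable [set w | G (upd (X w) s b)].
  apply: (IH (fun y => G (upd y s b))) => u v uv; apply: h => t; rewrite inE /upd.
  by case: (eqVneq t s) => //= _; exact: uv.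
rewrite (_ : [set w | _] = ([set w | X w s] `&` [set w | G (upd (X w) s true)]) `|`
   (~` [set w | X w s] `&` [set w | G (upd (X w) s false)])).
  apply: measurableU; first exact: measurableI.
  by apply: measurableI => //; apply: measurableC.
have E w : G (X w) = G (upd (X w) s (X w s)).
  by congr G; apply/funext => t; rewrite /upd; case: eqP => // ->.
apply/seteqP; split => w /=.
  by rewrite E; case: (X w s) => h'; [left|right].
by rewrite E; case: (X w s) => /=; case=> -[].
Qed.

(** The hypothesis only gives the probability that all listed coins succeed. Failures are reached by
    subtraction, coin by coin: the part where coin [s] fails is the whole minus the part where it
    succeeds. The list [F'] carries the coins already set to success, which the induction on [F]
    needs. *)
Lemma law_Ex_aux F F' (G : (I -> bool) -> bool) x :
  uniq (F' ++ F) -> all ok (F' ++ F) -> depends_on F G ->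
  P ((\big[setI/setT]_(s <- F') [set w | X w s]) `&` [set w | G (X w)]) =
  (p ^+ size F' * Ex p F (fun y => (G y)%:R) x)%:E.
Proof.
have mB (F0 : seq I) : measurable (\big[setI/setT]_(s <- F0) [set w | X w s]).
  by apply: bigsetI_measurable.
elim: F F' G x => [|s F IH] F' G x.
  rewrite cats0 => uF aF h /=.
  case Gx : (G x); last first.
    rewrite (_ : [set w | _] = set0) ?setI0 ?measure0 ?mulr0 //.
    by apply/seteqP; split => w //=; rewrite (h _ x) // Gx.
  rewrite (_ : [set w | _] = setT) ?setIT ?mulr1; first exact: indX.
  by apply/seteqP; split => w //=; rewrite (h _ x) // Gx.
move=> uF aF h.
have uF2 : uniq ((s :: F') ++ F).
  have pe : perm_eq (F' ++ [:: s] ++ F) ([:: s] ++ F' ++ F) by rewrite perm_catCA.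
  by rewrite -(perm_uniq pe).
have aF2 : all ok ((s :: F') ++ F).
  by move: aF; rewrite !all_cat /= => /and3P[-> -> ->].
have [uF1 aF1] : uniq (F' ++ F) /\ all ok (F' ++ F).
  by move: uF2 aF2 => /= /andP[_ ->] /andP[_ ->].
have sF : s \notin F by move: uF; rewrite cat_uniq => /and3P[_ _ /= /andP[]].
pose Gb b y := G (upd y s b).
have dG b : depends_on F (Gb b).
  move=> u v uv; apply: h => t; rewrite inE /upd.
  by case: eqP => //= _; exact: uv.
have E w : G (X w) = Gb (X w s) (X w).
  by congr G; apply/funext => t; rewrite /upd; case: eqP => // ->.
have mG b : measurable [set w | Gb b (X w)] by exact: measurable_depends_on (dG b).
set A := \big[setI/setT]_(s <- F') _.
have H1 := IH (s :: F') (Gb true) x uF2 aF2 (dG true).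
have H2 := IH (s :: F') (Gb false) x uF2 aF2 (dG false).
have H3 := IH F' (Gb false) x uF1 aF1 (dG false).
rewrite big_cons in H1 H2; rewrite -/A in H1 H2 H3.
have mA : measurable A by exact: mB.
have split : A `&` [set w | G (X w)] =
   ([set w | X w s] `&` A `&` [set w | Gb true (X w)]) `|`
   ((A `&` [set w | Gb false (X w)]) `\` ([set w | X w s] `&` A `&` [set w | Gb false (X w)])).
  apply/seteqP; split => w /=; rewrite E; case: (X w s) => /=.
  - by move=> [? ?]; left.
  - by move=> [? ?]; right; split=> // -[[]].
  - by case=> [[[_ ?] ?]|[[? ?] []]].
  - by case=> [[[]]|[[? ?] _]].
have mS : measurable [set w | X w s] by [].
have mXA : measurable ([set w | X w s] `&` A) by apply: measurableI.
rewrite split measureU; first last.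
- by apply/seteqP; split => w //= -[[[h1 h2] h3] [[h4 h5] h6]]; apply: h6.
- by apply: measurableD; apply: measurableI.
- by apply: measurableI.
rewrite measureD; first last.
- by rewrite [ltLHS]H3 ltry.
- by apply: measurableI.
- by apply: measurableI.
rewrite (_ : _ `&` ([set w | X w s] `&` A `&` _) = [set w | X w s] `&` A `&` [set w | Gb false (X w)]); last first.
  by apply/seteqP; split => w /=; tauto.
transitivity ((p ^+ size (s :: F') * Ex p F (fun y => (Gb true y)%:R) x)%:E +
  ((p ^+ size F' * Ex p F (fun y => (Gb false y)%:R) x)%:E -
   (p ^+ size (s :: F') * Ex p F (fun y => (Gb false y)%:R) x)%:E))%E.
  by congr (_ + (_ - _))%E; [exact: H1 | exact: H3 | exact: H2].
rewrite -EFinB -EFinD; congr EFin.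
by rewrite /= !Ex_upd // /Gb exprS; ring.
Qed.

Lemma law_Ex F (G : (I -> bool) -> bool) x :
  uniq F -> all ok F -> depends_on F G ->
  P [set w | G (X w)] = (Ex p F (fun y => (G y)%:R) x)%:E.
Proof.
move=> uF aF h; have := @law_Ex_aux F [::] G x uF aF h.
by rewrite big_nil setTI expr0 mul1r.
Qed.

End Law.

(** * Masses carried by weights *)

(** From [exp(-v) >= 1 - v] follows [exp v <= 1 / (1 - v)], and [(1 + v + 2 v^2)(1 - v) = 1 + v^2 (1
    - 2 v) >= 1] for [v <= 1/2]. *)
Lemma expR_le_quad (R : realType) (v : R) : 0 <= v -> 2 * v <= 1 -> expR v <= 1 + v + 2 * v ^+ 2.
Proof.
move=> v0 v1.
have h := expR_ge1Dx (- v).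
have e0 := expR_gt0 v.
have hm : expR v * expR (- v) = 1 by rewrite -expRD subrr expR0.
have h1 : expR v * (1 - v) <= 1 by rewrite -[leRHS]hm ler_pM2l.
have h2 : 1 <= (1 + v + 2 * v ^+ 2) * (1 - v).
  have -> : (1 + v + 2 * v ^+ 2) * (1 - v) = 1 + v ^+ 2 * (1 - 2 * v) by ring.
  by rewrite lerDl mulr_ge0 ?sqr_ge0 // subr_ge0.
have v2 : 0 < 1 - v by lra.
by rewrite -(ler_pM2r v2); apply: le_trans h2.
Qed.

Section WordCoins.
Variables (d M : nat).
Local Notation word := (seq (digit d M)).
Implicit Types (x y : word -> bool) (Q c s : word).

(** The root carries no coin. Generations are appended in order, so that [Ex_cat] conditions
    generation [n + 1] on the earlier ones. *)
Fixpoint coins n : seq word := if n is n'.+1 then coins n' ++ words d M n else [::].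

Arguments coins : simpl never.

Lemma coinsS n : coins n.+1 = coins n ++ words d M n.+1.
Proof. by []. Qed.

Lemma mem_coins n s : (s \in coins n) = (0 < size s <= n)%N.
Proof.
elim: n => [|n IH]; first by case: s.
by rewrite coinsS mem_cat IH mem_words; lia.
Qed.

Lemma coins_uniq n : uniq (coins n).
Proof.
elim: n => // n IH; rewrite coinsS cat_uniq IH words_uniq andbT.
apply/hasPn => s; rewrite mem_words mem_coins => /eqP ->.
by rewrite ltnn andbF.
Qed.

Lemma coins_pos n : all (fun s => 0 < size s)%N (coins n).
Proof. by apply/allP => s; rewrite mem_coins => /andP[]. Qed.

Lemma retained_eq x y s : (forall t, (0 < size t <= size s)%N -> x t = y t) ->
  retained x s = retained y s.
Proof.
move=> h; apply: eq_in_all => j; rewrite mem_iota add1n ltnS => /andP[j0 js].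
by apply: h; rewrite size_takel // j0.
Qed.

End WordCoins.

Arguments coins : simpl never.

Section Flow.
Variables (R : realType) (d M : nat) (p : R).
Hypotheses (p0 : 0 < p) (p1 : p <= 1).
Local Notation word := (seq (digit d M)).
Implicit Types (x y : word -> bool) (Q c s : word) (w : word -> R).

(** The normalised retained mass inside [Q]. The weight is an argument because it changes with the
    level: the nets of fibres become finer as [n] grows. *)
Definition flow w x Q n : R :=
  p ^- n * \sum_(c <- words d M n | take (size Q) c == Q) w c * (retained x c)%:R.

Lemma flow_depends_on w Q n : depends_on (coins d M n) (flow w ^~ Q ^~ n).
Proof.
move=> x y h; rewrite /flow; congr (_ * _).
rewrite big_seq_cond [RHS]big_seq_cond; apply: eq_bigr => c /andP[+ _].
rewrite mem_words => /eqP cn; rewrite (@retained_eq _ _ x y) // => t; rewrite cn => ht.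
by apply: h; rewrite mem_coins.
Qed.

Lemma flow_ge0 w x Q n : (forall c, 0 <= w c) -> 0 <= flow w x Q n.
Proof.
move=> w0; apply: mulr_ge0; first by rewrite invr_ge0 exprn_ge0 // ltW.
by apply: sumr_ge0 => c _; apply: mulr_ge0.
Qed.

(** Given generation [n], each new coin contributes a factor [p exp v + 1 - p] with [0 <= v <= t],
    where [t = z p^-(n+1) K]. As [exp v <= 1 + v + 2 v^2 <= 1 + (1 + 2 t) v], this factor is at most
    [exp((1 + 2 t) p v)], and by additivity of [w] the terms [p v] sum to [z] times the flow at
    level [n]. The factor [1 + 2 t] is the price of the second-order term. *)
Lemma Ex_exp_step w Q n (K z : R) x :
  (size Q <= n)%N -> (forall c, 0 <= w c) ->
  (forall c, size c = n -> w c = \sum_a w (rcons c a)) ->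
  (forall c, size c = n.+1 -> w c <= K) ->
  0 <= z -> 2 * (z * p ^- n.+1 * K) <= 1 ->
  Ex p (coins d M n.+1) (fun y => expR (z * (flow w y Q n.+1 -
     (1 + 2 * (z * p ^- n.+1 * K)) * flow w y Q n))) x <= 1.
Proof.
move=> Qn w0 wS wK z0; set l := z * p ^- n.+1; set t := l * K => t1.
have l0 : 0 <= l by rewrite mulr_ge0 // invr_ge0 exprn_ge0 // ltW.
have lE : z * p ^- n.+1 = l by [].
clearbody l.
have p0' : 0 <= p by exact: ltW.
rewrite coinsS Ex_cat.
rewrite -[leRHS](Ex_cst p (coins d M n) 1 x); apply: Ex_le => // y _.
(* Contribution of [s] to [z] times the flow if its own coin succeeds; the retention of its parent
   is already decided by [y]. *)
pose v s := l * w s * (take (size Q) s == Q)%:R * (retained y (take n s))%:R.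
have E (u : word -> bool) : agree_off (words d M n.+1) y u ->
    expR (z * (flow w u Q n.+1 - (1 + 2 * t) * flow w y Q n)) =
    expR (- (1 + 2 * t) * (z * flow w y Q n)) *
    \prod_(s <- words d M n.+1) expR (v s * (u s)%:R).
  move=> hu; rewrite -expR_sum -expRD; congr expR.
  rewrite mulrBr addrC mulNr mulrCA; congr (_ + _).
  rewrite /flow mulrA lE big_distrr /= big_mkcond [LHS]big_seq [RHS]big_seq.
  apply: eq_bigr => s; rewrite mem_words => /eqP sn.
  rewrite /v; case: eqP => _; rewrite ?mulr1 ?mulr0 ?mul0r // -!mulrA; congr (_ * (_ * _)).
  case/lastP: s sn => // s a; rewrite size_rcons => -[sn].
  rewrite -cats1 takel_cat ?sn // take_oversize ?sn // cats1 retained_rcons -natrM mulnb.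
  congr (nat_of_bool (_ && _))%:R; apply: retained_eq => t'; rewrite sn => ht.
  by apply: hu; rewrite mem_words; lia.
have v0 s : 0 <= v s by rewrite /v; do ?apply: mulr_ge0 => //; exact: ler0n.
have vt s : size s = n.+1 -> v s <= t.
  move=> sn; rewrite /v /t -!mulrA ler_wpM2l //.
  have := wK _ sn; have := w0 s; case: (take _ s == Q); case: (retained _ _) => /= w1 w2; rewrite ?mulr1n ?mulr0n ?mulr1 ?mulr0 ?mul0r; lra.
have Yn : \sum_(s <- words d M n.+1) v s = z * p^-1 * flow w y Q n.
  rewrite big_words_rcons /flow mulrA big_distrr /= [RHS]big_mkcond /=.
  rewrite [LHS]big_seq [RHS]big_seq; apply: eq_bigr => c /size_in_words cn.
  have -> : z * p^-1 * p ^- n = l by rewrite -lE exprS invfM mulrA.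
  under eq_bigr => a _ do rewrite /v -cats1 !takel_cat ?cn // [take n c]take_oversize ?cn // cats1.
  rewrite -big_distrl -big_distrl -big_distrr /= -wS //.
  by case: eqP => _; rewrite ?mulr1 ?mulr0 ?mul0r // mulrA.
rewrite (Ex_eq (G' := fun u => expR (- (1 + 2 * t) * (z * flow w y Q n)) *
    \prod_(s <- words d M n.+1) expR (v s * (u s)%:R)) p0' p1); last first.
  move=> u hu; rewrite -E //; congr expR; congr (_ * (_ - _ * _)).
  apply: flow_depends_on => s; rewrite mem_coins => /andP[s0 sn].
  by apply: hu; rewrite mem_words; lia.
rewrite Ex_scale (Ex_prod p0' p1 (g := fun s b => expR (v s * b%:R))) ?words_uniq //.
have -> : \prod_(s <- words d M n.+1) (p * expR (v s * true%:R) + (1 - p) * expR (v s * false%:R)) =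
  \prod_(s <- words d M n.+1) (p * expR (v s) + (1 - p)).
  by apply: eq_bigr => s _; rewrite mulr1 mulr0 expR0 mulr1.
apply: (@le_trans _ _ (expR (- (1 + 2 * t) * (z * flow w y Q n)) *
   \prod_(s <- words d M n.+1) expR ((1 + 2 * t) * p * v s))).
  rewrite ler_pM2l ?expR_gt0 // big_seq [leRHS]big_seq; apply: ler_prod => s.
  move/size_in_words => /vt; have := v0 s; have p1' := p1; have := p0.
  move: (v s) => u pp up ult; have e0 := expR_gt0 u.
  apply/andP; split; first by nra.
  apply: le_trans (expR_ge1Dx _).
  have h : expR u <= 1 + u + 2 * u ^+ 2 by apply: expR_le_quad => //; lra.
  suff : p * expR u <= p * (1 + u + 2 * u * t) by nra.
  rewrite ler_pM2l // (le_trans h) // lerD2l expr2 -mulrA ler_pM2l // ler_wpM2l //.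
have S : \sum_(s <- words d M n.+1) (1 + 2 * t) * p * v s = (1 + 2 * t) * (z * flow w y Q n).
  by rewrite -big_distrr /= Yn; field; rewrite gt_eqF.
by rewrite -expR_sum -expRD S mulNr addNr expR0.
Qed.

(** Chernoff bound: Markov's inequality for the exponential moment of [Ex_exp_step]. *)
Lemma Ex_flow_step w Q n (K z s : R) x :
  (size Q <= n)%N -> (forall c, 0 <= w c) ->
  (forall c, size c = n -> w c = \sum_a w (rcons c a)) ->
  (forall c, size c = n.+1 -> w c <= K) ->
  0 <= z -> 2 * (z * p ^- n.+1 * K) <= 1 ->
  Ex p (coins d M n.+1) (fun y => ((1 + 2 * (z * p ^- n.+1 * K)) * flow w y Q n + s <
     flow w y Q n.+1)%R%:R) x <= expR (- (z * s)).
Proof.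
move=> Qn w0 wS wK z0 t1; have := Ex_exp_step x Qn w0 wS wK z0 t1.
set t := 2 * _; rewrite -(ler_pM2l (expR_gt0 (- (z * s)))) mulr1 => h.
apply: le_trans h; rewrite -Ex_scale; apply: Ex_le => [||y _]; [exact: ltW|by []|].
rewrite -expRD; case: ltP => [h|_] /=; last exact: expR_ge0.
rewrite -[leLHS]expR0 ler_expR -(mulrN z s) -mulrDr mulr_ge0 //.
by rewrite addrC subr_ge0 lerBrDl ltW.
Qed.

End Flow.

Lemma bernoulli (R : realType) (r : R) n : 0 <= r -> 1 + n%:R * r <= (1 + r) ^+ n.
Proof.
move=> r0; elim: n => [|n IH]; first by rewrite mul0r addr0 expr0.
have n0 : 0 <= n%:R :> R by [].
rewrite exprS -natr1; nra.
Qed.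

Lemma expr_unbounded (R : realType) (r b : R) : 1 < r -> exists n, b <= r ^+ n.
Proof.
move=> r1; pose n := (Num.truncn (`|b| / (r - 1))).+1.
have r10 : 0 < r - 1 by lra.
have h : `|b| / (r - 1) < n%:R by apply: truncnS_gt.
exists n; have := @bernoulli _ (r - 1) n (ltW r10).
have -> : 1 + (r - 1) = r by ring.
apply: le_trans; rewrite (le_trans (ler_norm b)) //.
by move: h; rewrite ltr_pdivrMr //; lra.
Qed.

Lemma sum_geometric_le (R : realType) (a : R) m n : 0 <= a < 1 ->
  \sum_(m <= i < n) a ^+ i <= a ^+ m / (1 - a).
Proof.
move=> /andP[a0 a1]; have [nm|mn] := leqP n m.
  by rewrite big_geq // divr_ge0 ?exprn_ge0 // subr_ge0 ltW.
rewrite ler_pdivlMr ?subr_gt0 //.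
suff -> : (\sum_(m <= i < n) a ^+ i) * (1 - a) = a ^+ m - a ^+ n.
  by rewrite gerBl exprn_ge0.
rewrite big_distrl /= (@telescope_sumr_eq _ m n (fun i => - a ^+ i)) ?(ltnW mn) //; first by ring.
by move=> i _; rewrite exprS; ring.
Qed.

Lemma sum_half_le2 (R : realType) n : \sum_(0 <= i < n) (2^-1 : R) ^+ i <= 2.
Proof.
have h : 0 <= (2^-1 : R) < 1 by apply/andP; split; lra.
by apply: le_trans (sum_geometric_le 0 n h) _; rewrite expr0 ler_pdivrMr; lra.
Qed.

Lemma expR_ge_pow (R : realType) (y : R) m : 0 <= y -> (y / m.+1%:R) ^+ m.+1 <= expR y.
Proof.
move=> y0; have -> : expR y = expR (y / m.+1%:R) ^+ m.+1.
  by rewrite -expRM_natl mulrC mulfVK // pnatr_eq0.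
rewrite lerXn2r ?nnegrE ?divr_ge0 ?expR_ge0 //.
by apply: le_trans (expR_ge1Dx _); rewrite lerDr.
Qed.

(** With [m] such that [2 b <= r^(m+1)], the bound [exp y >= (y / (m+1))^(m+1)] at [y = r^n] gives
    [exp(r^n) >= (2 b)^n / (m+1)^(m+1)]. *)
Lemma expR_decay (R : realType) (r b : R) : 1 < r -> 0 <= b ->
  exists c, forall n, b ^+ n * expR (- r ^+ n) <= c / 2 ^+ n.
Proof.
move=> r1 b0; have [m hm] := expr_unbounded (2 * b) r1.
have hm1 : 2 * b <= r ^+ m.+1.
  by apply: le_trans hm _; rewrite exprS ler_peMl ?exprn_ge0 //; lra.
exists (m.+1%:R ^+ m.+1) => n.
have rn : 0 < r ^+ n by rewrite exprn_gt0 //; lra.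
have := @expR_ge_pow _ (r ^+ n) m (ltW rn).
rewrite expRN expr_div_n -exprM mulnC exprM => h.
have m0 : 0 < (m.+1%:R : R) ^+ m.+1 by rewrite exprn_gt0.
rewrite ler_pdivrMr in h => //.
rewrite ler_pdivlMr ?exprn_gt0 // mulrAC -exprMn ler_pdivrMr ?expR_gt0 //.
rewrite [leRHS]mulrC; apply: le_trans h; rewrite lerXn2r ?nnegrE //; last by rewrite mulrC.
  by rewrite mulr_ge0.
by rewrite exprn_ge0 //; lra.
Qed.

Lemma negligible_limsup (R : realType) (dO : measure_display) (Omega : measurableType dO)
  (P : probability Omega R) (A : nat -> set Omega) (c : R) :
  (forall n, measurable (A n)) -> (forall n, (P (A n) <= (c / 2 ^+ n)%:E)%E) ->
  P.-negligible [set w | forall N, exists2 n, (N <= n)%N & A n w].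
Proof.
move=> mA hA; exists (lim_sup_set A); split.
- by apply: bigcapT_measurable => n; apply: bigcup_measurable.
- apply: lim_sup_set_cvg0 => //; apply: (@le_lt_trans _ _ (2 * c)%:E); last exact: ltry.
  apply: lime_le; first exact: is_cvg_nneseries.
  apply: nearW => n; apply: (@le_trans _ _ (\sum_(0 <= i < n) (c / 2 ^+ i)%:E)%E).
    by apply: lee_sum => i _; exact: hA.
  rewrite sumEFin lee_fin -big_distrr /=.
  have c0 : 0 <= c by have := le_trans (measure_ge0 P _) (hA 0%N); rewrite lee_fin expr0 divr1.
  rewrite mulrC ler_wpM2r //; under eq_bigr do rewrite -exprVn.
  exact: sum_half_le2.
- by move=> w /= h N _; have [n Nn An] := h N; exists n.
Qed.

(** * One-step growth of the mass, almost surely and uniformly over finite families of weights *)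

Section AeFlow.
Variables (R : realType) (d M D : nat) (p r : R).
Hypotheses (M0 : (0 < M)%N) (p0 : 0 < p) (p1 : p <= 1) (r1 : 1 < r).
Hypothesis rq : r ^+ 3 <= p * M%:R ^+ D.
Local Notation word := (seq (digit d M)).
Local Notation q := (p * M%:R ^+ D).

Definition upto n : seq word := [::] :: coins d M n.

Lemma mem_upto n (s : word) : (s \in upto n) = (size s <= n)%N.
Proof. by rewrite inE mem_coins; case: s. Qed.

Lemma size_upto n : (size (upto n) <= (2 * M ^ d) ^ n)%N.
Proof.
elim: n => // n IH; rewrite /upto coinsS /= size_cat size_words -addSn.
have Md : (0 < M ^ d)%N by rewrite expn_gt0 M0.
have h : (M ^ (n.+1 * d) <= (2 * M ^ d) ^ n * M ^ d)%N.
  by rewrite mulSn expnD mulnC leq_mul // mulnC expnM expnMn leq_pmull // expn_gt0.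
rewrite (leq_trans (leq_add IH h)) // expnSr.
have : (0 < (2 * M ^ d) ^ n)%N by rewrite expn_gt0 muln_gt0 /= Md.
move: h; nia.
Qed.

(** With [j = size Q], the relative errors [r^-(n-j)] are summable over [n >= j], and the additive
    ones add up to a constant times [r^j / q^j]: this is the final bound on the mass of [Q]. *)
Definition flow_steps (w : word -> R) (x : word -> bool) n :=
  forall Q, (size Q <= n)%N ->
  flow p w x Q n.+1 <= (1 + r ^- (n - size Q)) * flow p w x Q n +
    2 * r ^+ (2 * size Q) / (r ^+ n * q ^+ size Q).

(** Additivity is asked at level [n] and the upper bound at level [n + 1] only, because a net of
    level [n] serves just the step from [n] to [n + 1]. The bound is the volume that [D] free
    coordinates sweep in a cube of level [n + 1]. *)
Definition is_net (w : word -> R) n := [/\ forall c, 0 <= w c,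
  forall c, size c = n -> w c = \sum_a w (rcons c a) &
  forall c, size c = n.+1 -> w c <= M%:R ^- (D * n.+1)].

(* The exponential moment is taken at z = q^(n+1) / (2 r^(n-j)), j = size Q: the
   relative growth allowed is then r^-(n-j) and z times the additive one is at
   least r^n, which beats the exponential size of the nets. *)
Lemma Ex_flow_steps (w : word -> R) n Q x : is_net w n -> (size Q <= n)%N ->
  Ex p (coins d M n.+1) (fun y => ((1 + r ^- (n - size Q)) * flow p w y Q n +
    2 * r ^+ (2 * size Q) / (r ^+ n * q ^+ size Q) < flow p w y Q n.+1)%R%:R) x
  <= expR (- r ^+ n).
Proof.
move=> [w0 wS wK] Qn; have Mn : (M%:R : R) != 0 by rewrite pnatr_eq0 -lt0n.
have rp : 0 < r := lt_trans ltr01 r1.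
have r0 : r != 0 by rewrite gt_eqF.
have pn0 : p != 0 by rewrite gt_eqF.
have q0 : 0 < q by rewrite mulr_gt0 // exprn_gt0 // ltr0n.
pose z := q ^+ n.+1 / (2 * r ^+ (n - size Q)).
have rn m : 0 < r ^+ m by rewrite exprn_gt0.
have z0 : 0 <= z by rewrite divr_ge0 ?mulr_ge0 ?exprn_ge0 // ltW.
have zt : 2 * (z * p ^- n.+1 * M%:R ^- (D * n.+1)) = r ^- (n - size Q).
  rewrite /z exprMn -exprM; field.
  by rewrite !expf_neq0.
have t1 : 2 * (z * p ^- n.+1 * M%:R ^- (D * n.+1)) <= 1.
  by rewrite zt invf_le1 ?exprn_ege1 // ltW.
have h := Ex_flow_step p0 p1 (2 * r ^+ (2 * size Q) / (r ^+ n * q ^+ size Q)) x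
  Qn w0 wS wK z0 t1.
rewrite zt in h; apply: le_trans h _; rewrite ler_expR lerN2 /z.
set j := size Q; set m := (n - j)%N; have nE : n = (m + j)%N by rewrite subnK.
have -> : q ^+ n.+1 / (2 * r ^+ m) * (2 * r ^+ (2 * j) / (r ^+ n * q ^+ j)) =
   q ^+ m.+1 * r ^+ j / r ^+ (m + m).
  have qj : q ^+ j != 0 by rewrite expf_neq0 // gt_eqF.
  rewrite nE -addSn exprD mul2n -addnn !exprD.
  move: (q ^+ m.+1) (q ^+ j) qj => u v v0; field.
  by rewrite v0 !expf_neq0.
rewrite ler_pdivlMr // nE !exprD.
(* The place where [r^3 <= q] is used: the exponent is [q^(m+1) r^j / r^(2 m)] and has to reach
   [r^n = r^(m+j)]. *)
have h : r ^+ m * r ^+ m * r ^+ m <= q ^+ m.+1.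
  have -> : r ^+ m * r ^+ m * r ^+ m = (r ^+ 3) ^+ m by rewrite -exprM -!exprD !mulSn mul0n addn0 addnA.
  have r3 : 1 <= r ^+ 3 by rewrite exprn_ege1 // ltW.
  have rq' := rq.
  rewrite [leRHS]exprS -[leLHS]mul1r; apply: ler_pM => //.
  - by rewrite exprn_ge0 // exprn_ge0 // ltW.
  - exact: le_trans rq'.
  - by rewrite lerXn2r ?nnegrE ?exprn_ge0 // ltW.
have := rn m; have := rn j; move: h; move: (r ^+ m) (r ^+ j) (q ^+ m.+1) => a b c h b0 a0.
have -> : a * b * (a * a) = (a * a * a) * b by ring.
by rewrite ler_pM2r.
Qed.

Variables (dO : measure_display) (Omega : measurableType dO) (P : probability Omega R).
Variable (X : Omega -> word -> bool).
Hypothesis mX : forall s, measurable [set w | X w s].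
Hypothesis indX : forall F : seq word, uniq F -> all (fun s => (0 < size s)%N) F ->
     P (\big[setI/setT]_(s <- F) [set w | X w s]) = (p ^+ size F)%:E.

Lemma Ex_sum (J : Type) (l : seq J) (F : seq word) (G : J -> (word -> bool) -> R) x :
  Ex p F (fun y => \sum_(i <- l) G i y) x = \sum_(i <- l) Ex p F (G i) x.
Proof.
elim: l => [|i l IH].
  by rewrite big_nil -[RHS](Ex_cst p F 0 x); apply: Ex_eq => // [|y _]; rewrite ?big_nil // ltW.
rewrite big_cons -IH -Ex_add; apply: Ex_eq => // [|y _]; rewrite ?big_cons //; exact: ltW.
Qed.

(** Union bound over the family and over all [Q] of length at most [n]: at most [a (2 b M^d)^n]
    failures, each of probability at most [exp(-r^n)], so Borel-Cantelli applies. *)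
Lemma ae_flow_steps (I : nat -> finType) (W : forall n, I n -> word -> R) (a b : nat) :
  (forall n, #|I n| <= a * b ^ n)%N -> (forall n i, is_net (W n i) n) ->
  P.-negligible [set w | ~ exists N, forall n, (N <= n)%N ->
    forall i, flow_steps (W n i) (X w) n].
Proof.
move=> cI nW.
pose fails n i Q (x : word -> bool) := ((1 + r ^- (n - size Q)) * flow p (W n i) x Q n +
    2 * r ^+ (2 * size Q) / (r ^+ n * q ^+ size Q) < flow p (W n i) x Q n.+1)%R.
pose G n (x : word -> bool) := has (fun i => has (fun Q => fails n i Q x) (upto n)) (enum (I n)).
have dG n : depends_on (coins d M n.+1) (G n).
  move=> x y h; apply: eq_in_has => i _; apply: eq_in_has => Q _; rewrite /fails.
  rewrite (flow_depends_on _ _ _ h) (flow_depends_on (n := n) p (W n i) Q (y := y)) // => s.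
  by rewrite mem_coins => hs; apply: h; rewrite mem_coins; lia.
have mG n : measurable [set w | G n (X w)] by exact: measurable_depends_on (dG n).
have [c hc] := @expR_decay R r (b * (2 * M ^ d))%:R r1 (ler0n _ _).
have PG n : (P [set w | G n (X w)] <= ((a%:R * c) / 2 ^+ n)%:E)%E.
  rewrite (@law_Ex _ _ p _ _ P X (fun s => (0 < size s)%N) mX indX _ (G n) (fun=> false)
    (coins_uniq _ _ _) (coins_pos _ _ _) (dG n)).
  rewrite lee_fin.
  apply: (@le_trans _ _ (\sum_(i <- enum (I n)) \sum_(Q <- upto n) expR (- r ^+ n))).
    apply: (@le_trans _ _ (Ex p (coins d M n.+1) (fun y => \sum_(i <- enum (I n))
        \sum_(Q <- upto n) (fails n i Q y)%:R) (fun=> false))).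
      apply: Ex_le => // [|y _]; first exact: ltW.
      have [/hasP[i iI /hasP[Q QU fQ]]|] := boolP (G n y); last first.
        by move=> _; apply: sumr_ge0 => i _; apply: sumr_ge0.
      rewrite (big_rem i) //= (big_rem Q) //= fQ -addrA lerDl addr_ge0 //.
        by apply: sumr_ge0.
      by apply: sumr_ge0 => i' _; apply: sumr_ge0.
    rewrite Ex_sum; apply: ler_sum => i _; rewrite Ex_sum big_seq [leRHS]big_seq.
    by apply: ler_sum => Q; rewrite mem_upto => Qn; apply: Ex_flow_steps.
  rewrite !big_const_seq !count_predT !iter_addr_0 -cardE -mulrnA.
  apply: (@le_trans _ _ (a%:R * ((b * (2 * M ^ d))%:R ^+ n * expR (- r ^+ n)))).
    rewrite -[leLHS]mulr_natl mulrA ler_wpM2r ?expR_ge0 // -natrX -natrM ler_nat expnMn mulnA mulnC.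
    by apply: leq_mul; [exact: cI|exact: size_upto].
  by rewrite -mulrA ler_wpM2l.
apply: negligibleS (negligible_limsup mG PG) => w /= h N.
apply: contrapT => hN; apply: h; exists N => n Nn i Q Qn.
rewrite leNgt; apply/negP => f; apply: hN; exists n => //.
apply/hasP; exists i; first by rewrite mem_enum.
by apply/hasP; exists Q; rewrite ?mem_upto.
Qed.

End AeFlow.

(** * Growth of the population *)

Section Population.
Variables (R : realType) (d M : nat) (p : R).
Hypotheses (M0 : (0 < M)%N) (p0 : 0 < p) (p1 : p < 1).
Local Notation word := (seq (digit d M)).
Local Notation Lam := (p * M%:R ^+ d).
Hypothesis L1 : 1 < Lam.
Implicit Types (x y : word -> bool).

Definition pop x n : nat := count (retained x) (words d M n).

Lemma popE x n : (pop x n)%:R = \sum_(c <- words d M n) (retained x c)%:R :> R.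
Proof. by rewrite /pop -sum1_count natr_sum big_mkcond; apply: eq_bigr => c _; case: retained. Qed.

Lemma pop_depends_on n : depends_on (coins d M n) (pop ^~ n).
Proof.
move=> x y h; rewrite /pop; apply: eq_in_count => c; rewrite mem_words => /eqP cn.
by apply: retained_eq => t; rewrite cn => ht; apply: h; rewrite mem_coins.
Qed.

Lemma pop0S x n : pop x n = 0%N -> pop x n.+1 = 0%N.
Proof.
move=> h; apply/eqP; rewrite -leqn0 leqNgt -has_count; apply/negP => /hasP[c].
rewrite mem_words => /eqP cn rc; have : has (retained x) (words d M n).
  apply/hasP; exists (take n c); last exact: retained_take.
  by rewrite mem_words size_takel ?cn.
by rewrite has_count -/(pop x n) h.
Qed.

Lemma Ex_coins_widen (G : (word -> bool) -> R) n m x :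
  depends_on (coins d M n) G -> Ex p (coins d M (n + m)) G x = Ex p (coins d M n) G x.
Proof.
move=> h; elim: m => [|m IH]; first by rewrite addn0.
rewrite -IH addnS coinsS Ex_cat; apply: Ex_eq => [||y _]; [exact: ltW|exact: ltW|].
rewrite -[RHS](Ex_cst p (words d M (n + m).+1) (G y) y).
apply: Ex_eq => [||z hz]; [exact: ltW|exact: ltW|].
apply: h => s; rewrite mem_coins => /andP[_ sn]; apply: hz; rewrite mem_words; lia.
Qed.

(* Conditionally on generation n, the sons of a retained cube are independent coins. *)
Lemma Ex_generation n (g : bool -> R) y : g false = 1 ->
  Ex p (words d M n.+1) (fun u => \prod_(c <- words d M n.+1) g (retained u c)) y =
  (p * g true + (1 - p)) ^+ (M ^ d * pop y n).
Proof.
move=> g1.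
rewrite (Ex_prod (ltW p0) (ltW p1) (g := fun s b => g (retained y (take n s) && b))) ?words_uniq //.
  under eq_bigr do rewrite andbF andbT g1 mulr1.
  rewrite /= /words -/words big_allpairs_dep /=.
  rewrite exprM /pop -sum1_count expr_sum [RHS]big_mkcond /= big_seq [RHS]big_seq.
  apply: eq_bigr => c; rewrite mem_words => /eqP cn.
  under eq_bigr do rewrite -cats1 takel_cat ?cn // take_oversize ?cn //.
  rewrite big_const_seq count_predT -cardE card_digit; case: retained => /=.
    by rewrite iter_mulr_1 expr1.
  by rewrite g1 mulr1 addrC subrK iter_mulr_1 expr1n.
move=> u hu; apply: eq_big_seq => s; rewrite mem_words => /eqP.
case/lastP: s => // s a; rewrite size_rcons => -[sn].
rewrite -cats1 takel_cat ?sn // take_oversize ?sn // cats1 retained_rcons.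
congr (g (_ && _)); apply: retained_eq => t ht.
by apply: hu; rewrite mem_words; lia.
Qed.

(** The Laplace transform of one coin is [p exp(-z) + 1 - p <= exp(-p (1 - exp(-z)))], and
    [1 - exp(-z) >= z / (1 + z)]. This rational lower bound is chosen because its iterates are
    explicit. *)
Lemma Ex_pop_step n (G : (word -> bool) -> bool) (z : R) x :
  depends_on (coins d M n) G -> 0 <= z ->
  Ex p (coins d M n.+1) (fun y => (G y)%:R * expR (- (z * (pop y n.+1)%:R))) x <=
  Ex p (coins d M n) (fun y => (G y)%:R * expR (- (Lam * z / (1 + z) * (pop y n)%:R))) x.
Proof.
move=> dG z0; rewrite coinsS Ex_cat; apply: Ex_le => [||y _]; [exact: ltW|exact: ltW|].
pose g (b : bool) := expR (- (z * b%:R)).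
rewrite (Ex_eq (G' := fun u => (G y)%:R * \prod_(c <- words d M n.+1) g (retained u c)) (ltW p0) (ltW p1)); last first.
  move=> u hu; congr (_ * _).
    congr (nat_of_bool _)%:R; apply: dG => s; rewrite mem_coins => /andP[_ sn].
    by apply: hu; rewrite mem_words; lia.
  by rewrite -expR_sum popE; congr expR; rewrite big_distrr /= -sumrN.
rewrite Ex_scale Ex_generation /g ?mulr0 ?oppr0 ?expR0 // ler_wpM2l // mulr1.
set e := expR (- z).
have e0 : 0 < e by exact: expR_gt0.
have e1 : e <= (1 + z)^-1.
  by rewrite /e expRN lef_pV2 ?posrE ?expR_gt0 ?expR_ge1Dx //; lra.
have hz : z / (1 + z) <= 1 - e.
  have -> : z / (1 + z) = 1 - (1 + z)^-1 by field; lra.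
  by rewrite lerD2l lerN2.
have pe : 0 <= p * e + (1 - p) by rewrite addr_ge0 ?mulr_ge0 ?subr_ge0 // ltW.
apply: (@le_trans _ _ (expR (- (p * (1 - e))) ^+ (M ^ d * pop y n))).
  rewrite lerXn2r ?nnegrE ?expR_ge0 //; apply: le_trans (expR_ge1Dx _).
  by rewrite le_eqVlt; apply/orP; left; apply/eqP; ring.
rewrite -expRM_natl ler_expR natrM natrX mulrN lerN2.
have -> : Lam * z / (1 + z) * (pop y n)%:R = (M%:R ^+ d * (pop y n)%:R * p) * (z / (1 + z)) by ring.
by rewrite [leRHS]mulrA ler_wpM2l // !mulr_ge0 ?exprn_ge0 // ltW.
Qed.

(* The Moebius maps z |-> Lam z / (1 + z) are iterated in closed form. *)
Lemma Ex_pop_steps n j (G : (word -> bool) -> bool) (z : R) x :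
  depends_on (coins d M n) G -> 0 <= z ->
  Ex p (coins d M (n + j)) (fun y => (G y)%:R * expR (- (z * (pop y (n + j))%:R))) x <=
  Ex p (coins d M n) (fun y => (G y)%:R *
     expR (- (Lam ^+ j * z / (1 + (\sum_(0 <= i < j) Lam ^+ i) * z) * (pop y n)%:R))) x.
Proof.
move=> dG; have L0 : 0 < Lam := lt_trans ltr01 L1.
elim: j z => [|j IH] z z0.
  by rewrite addn0 expr0 mul1r big_geq // mul0r addr0 divr1.
rewrite addnS; apply: le_trans (Ex_pop_step _ _ z0) _.
  by move=> u v uv; apply: dG => s sn; apply: uv; move: sn; rewrite !mem_coins; lia.
have z1 : 0 < 1 + z by lra.
have z0' : 0 <= Lam * z / (1 + z) by rewrite divr_ge0 ?mulr_ge0 // ltW.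
apply: le_trans (IH _ z0') _.
suff -> : Lam ^+ j * (Lam * z / (1 + z)) / (1 + (\sum_(0 <= i < j) Lam ^+ i) * (Lam * z / (1 + z))) =
  Lam ^+ j.+1 * z / (1 + (\sum_(0 <= i < j.+1) Lam ^+ i) * z) by exact: lexx.
have S0 : 0 <= \sum_(0 <= i < j) Lam ^+ i by apply: sumr_ge0 => i _; exact: exprn_ge0 (ltW L0).
have -> : \sum_(0 <= i < j.+1) Lam ^+ i = 1 + Lam * \sum_(0 <= i < j) Lam ^+ i.
  rewrite big_nat_recl // expr0 big_distrr /=; congr (_ + _).
  by apply: eq_bigr => i _; rewrite exprS.
rewrite exprS; move: (Lam) (\sum_(0 <= i < j) Lam ^+ i) (Lam ^+ j) L0 S0 => L S Lj L0 S0.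
have SLz : 0 <= S * (L * z) by rewrite !mulr_ge0 // ltW.
by field; rewrite !gt_eqF //; lra.
Qed.

(** Markov's inequality with [z = Lam^-j]. The coefficient left at generation [n] is
    [1 / (1 + S / Lam^j)] with [S = (Lam^j - 1) / (Lam - 1)], which stays above [1 - 1 / Lam] for
    every [j]. *)
Lemma Ex_pop_small n j (G : (word -> bool) -> bool) x : depends_on (coins d M n) G ->
  Ex p (coins d M (n + j)) (fun y => (G y && ((pop y (n + j))%:R <= Lam ^+ j)%R)%:R) x <=
  expR 1 * Ex p (coins d M n) (fun y => (G y)%:R * expR (- ((1 - Lam^-1) * (pop y n)%:R))) x.
Proof.
move=> dG; have L0 : 0 < Lam := lt_trans ltr01 L1.
have Lj : 0 < Lam ^+ j by rewrite exprn_gt0.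
have z0 : 0 <= Lam ^- j by rewrite invr_ge0 ltW.
apply: (@le_trans _ _ (expR 1 * Ex p (coins d M (n + j))
   (fun y => (G y)%:R * expR (- (Lam ^- j * (pop y (n + j))%:R))) x)).
  rewrite -Ex_scale; apply: Ex_le => [||y _]; [exact: ltW|exact: ltW|].
  case: (G y) => /=; last by rewrite mul0r mulr0.
  rewrite mul1r -expRD; case: (leP _ (Lam ^+ j)) => h /=; last exact: expR_ge0.
  by rewrite -[leLHS]expR0 ler_expR subr_ge0 mulrC ler_pdivrMr // mul1r.
rewrite ler_pM2l ?expR_gt0 //; apply: le_trans (Ex_pop_steps _ _ dG z0) _.
apply: Ex_le => [||y _]; [exact: ltW|exact: ltW|].
rewrite ler_wpM2l // ler_expR lerN2 ler_wpM2r //.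
have hS : (\sum_(0 <= i < j) Lam ^+ i) * (Lam - 1) = Lam ^+ j - 1.
  rewrite big_distrl /= (@telescope_sumr_eq _ 0 j (fun i => Lam ^+ i)) // => i _.
  by rewrite exprS; ring.
have Ln := gt_eqF Lj; rewrite divff ?Ln // mul1r.
have S0 : 0 <= \sum_(0 <= i < j) Lam ^+ i by apply: sumr_ge0 => i _; exact: exprn_ge0 (ltW L0).
have L1' := L1; move: (\sum_(0 <= i < j) Lam ^+ i) (Lam ^+ j) hS Lj S0 => S Lq hS Lq0 S0.
have -> : 1 - Lam^-1 = (Lam - 1) / Lam by rewrite mulrBl divff ?gt_eqF // mul1r.
have i0 : 0 < Lq^-1 by rewrite invr_gt0.
rewrite ler_pdivrMr // [leRHS]mulrC ler_pdivlMr; last by rewrite ltr_pwDl // mulr_ge0 // ltW.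
have -> : (Lam - 1) * (1 + S / Lq) = Lam - 1 + S * (Lam - 1) / Lq by ring.
rewrite hS mulrBl divff ?gt_eqF //; lra.
Qed.

Lemma Ex_extinction_step n x :
  Ex p (coins d M n.+1) (fun y => ((0 < pop y n)%N && (pop y n.+1 == 0%N))%:R) x =
  Ex p (coins d M n) (fun y => (0 < pop y n)%N%:R * (1 - p) ^+ (M ^ d * pop y n)) x.
Proof.
rewrite coinsS Ex_cat; apply: Ex_eq => [||y _]; [exact: ltW|exact: ltW|].
pose g (b : bool) : R := (~~ b)%:R.
have := @Ex_generation n g y erefl; rewrite /g /= mulr0 add0r => <-.
rewrite -Ex_scale; apply: Ex_eq => [||u hu]; [exact: ltW|exact: ltW|].
have -> : pop u n = pop y n.
  apply: pop_depends_on => s; rewrite mem_coins => /andP[_ sn].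
  by apply: hu; rewrite mem_words; lia.
rewrite -mulnb natrM; congr (_ * _).
rewrite /pop -leqn0 leqNgt -has_count; elim: (words d M n.+1) => [|c l IH].
  by rewrite big_nil.
by rewrite big_cons -IH /=; case: retained => /=; rewrite ?mul0r ?mul1r.
Qed.

Lemma sum_extinction y N :
  (\sum_(0 <= n < N) ((0 < pop y n)%N && (pop y n.+1 == 0%N)) <= (pop y N == 0%N))%N.
Proof.
elim: N => [|N IH]; first by rewrite big_geq.
rewrite big_nat_recr //=; apply: leq_trans (leq_add IH (leqnn _)) _.
by case: (posnP (pop y N)) => [/pop0S ->|]; case: (pop y N).
Qed.

(** The expectation is the probability of dying exactly at generation [n + 1]. These events are
    disjoint, so their probabilities cannot all exceed [e]. *)
Lemma extinction_small (e : R) x : 0 < e -> exists n,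
  Ex p (coins d M n) (fun y => (0 < pop y n)%N%:R * (1 - p) ^+ (M ^ d * pop y n)) x <= e.
Proof.
move=> e0; apply: contrapT => h.
have {}h n : e < Ex p (coins d M n.+1) (fun y => ((0 < pop y n)%N && (pop y n.+1 == 0%N))%:R) x.
  by rewrite Ex_extinction_step ltNge; apply/negP => hn; apply: h; exists n.
pose N := (Num.truncn e^-1).+1.
have hN : e^-1 < N%:R by apply: truncnS_gt.
suff : N%:R * e <= 1 by rewrite leNgt -ltr_pdivrMr // div1r hN.
apply: (@le_trans _ _ (\sum_(0 <= n < N) Ex p (coins d M N)
    (fun y => ((0 < pop y n)%N && (pop y n.+1 == 0%N))%:R) x)).
  rewrite big_mkord -[X in X%:R]card_ord mulr_natl -sumr_const; apply: ler_sum => -[n nN] _ /=.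
  rewrite -[N](subnKC nN).
  rewrite Ex_coins_widen; first exact: ltW (h n).
  move=> u v uv; rewrite (pop_depends_on uv) (@pop_depends_on n u v) // => s sn.
  by apply: uv; move: sn; rewrite !mem_coins; lia.
rewrite -(Ex_sum p0 (ltW p1)) -[leRHS](Ex_cst p (coins d M N) 1 x).
apply: Ex_le => [||y _]; [exact: ltW|exact: ltW|].
rewrite -natr_sum (_ : 1 = 1%:R) // ler_nat (leq_trans (sum_extinction y N)) //.
by case: eqP.
Qed.

(** A population between 1 and [A] dies at the next step with probability at least
    [(1 - p)^(M^d A)]. At a generation where dying is very unlikely, being alive but below [A] is
    therefore unlikely too, while a population of at least [A] makes the exponential small. *)
Lemma alive_small (c e : R) x : 0 < c -> 0 < e -> exists n,
  Ex p (coins d M n) (fun y => (0 < pop y n)%N%:R * expR (- (c * (pop y n)%:R))) x <= e.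
Proof.
move=> c0 e0.
have p1' : 0 < 1 - p by rewrite subr_gt0.
have key a b : (a <= b)%N -> 1 <= (1 - p) ^- b * (1 - p) ^+ a.
  move=> ab; rewrite ler_pdivlMl ?exprn_gt0 // mulr1 ler_wiXn2l ?(ltW p1') //.
  by rewrite gerBl ltW.
pose A := (Num.truncn (- ln (e / 2) / c)).+1.
have hA : expR (- (c * A%:R)) <= e / 2.
  have : - ln (e / 2) / c < A%:R by apply: truncnS_gt.
  rewrite ltr_pdivrMr // => h.
  by rewrite -[leRHS]lnK ?posrE ?divr_gt0 // ler_expR; lra.
have K0 : 0 < (1 - p) ^+ (M ^ d * A) by rewrite exprn_gt0.
have eK : 0 < e / 2 * (1 - p) ^+ (M ^ d * A) by rewrite mulr_gt0 // divr_gt0.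
have [n hn] := extinction_small x eK; exists n.
apply: (@le_trans _ _ (Ex p (coins d M n) (fun y => e / 2 + (1 - p) ^- (M ^ d * A) *
   ((0 < pop y n)%N%:R * (1 - p) ^+ (M ^ d * pop y n))) x)).
  apply: Ex_le => [||y _]; [exact: ltW|exact: ltW|].
  have T0 : 0 <= (1 - p) ^- (M ^ d * A) * ((0 < pop y n)%N%:R * (1 - p) ^+ (M ^ d * pop y n)).
    by rewrite !mulr_ge0 ?exprn_ge0 ?invr_ge0 ?exprn_ge0 // ltW.
  have [hp|hp] := leqP A (pop y n).
    apply: (@le_trans _ _ (e / 2)); last by rewrite lerDl.
    apply: le_trans hA; rewrite -[leRHS]mul1r ler_pM ?expR_ge0 //; first by case: (0 < _)%N.
    by rewrite ler_expR lerN2 ler_pM2l // ler_nat.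
  apply: (@le_trans _ _ ((1 - p) ^- (M ^ d * A) * ((0 < pop y n)%N%:R * (1 - p) ^+ (M ^ d * pop y n)))); last first.
    by rewrite lerDr divr_ge0 // ltW.
  rewrite mulrCA ler_wpM2l //; apply: (@le_trans _ _ 1).
    by rewrite -[leRHS]expR0 ler_expR oppr_le0 mulr_ge0 // ltW.
  by apply: key; rewrite leq_mul2l ltnW ?orbT.
rewrite Ex_add Ex_cst Ex_scale.
rewrite [_^-1 * _]mulrC [leRHS](splitr e) lerD2l.
by rewrite ler_pdivrMr.
Qed.

End Population.

Section AePopulation.
Variables (R : realType) (d M : nat) (p : R).
Hypotheses (M0 : (0 < M)%N) (p0 : 0 < p) (p1 : p < 1).
Local Notation word := (seq (digit d M)).
Local Notation Lam := (p * M%:R ^+ d).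
Hypothesis L1 : 1 < Lam.
Variables (dO : measure_display) (Omega : measurableType dO) (P : probability Omega R).
Variable (X : Omega -> word -> bool).
Hypothesis mX : forall s, measurable [set w | X w s].
Hypothesis indX : forall F : seq word, uniq F -> all (fun s => (0 < size s)%N) F ->
     P (\big[setI/setT]_(s <- F) [set w | X w s]) = (p ^+ size F)%:E.

(** Uniformity in [j] is the point: the bound then survives the passage to the event that the
    population stays small for all large [j]. *)
Lemma stagnation_small (e : R) : 0 < e -> exists n, forall j,
  (P [set w | ((0 < pop (X w) n)%N && ((pop (X w) (n + j))%:R <= Lam ^+ j)%R)] <= e%:E)%E.
Proof.
move=> e0; have c0 : 0 < 1 - Lam^-1.
  by rewrite subr_gt0 invf_lt1 // (lt_trans ltr01 L1).
have e1 : 0 < e / expR 1 by rewrite divr_gt0 // expR_gt0.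
have [n hn] := alive_small M0 p0 p1 L1 (fun=> false) c0 e1.
have dG : depends_on (coins d M n) (fun y => 0 < pop y n)%N.
  by move=> u v uv; rewrite (pop_depends_on uv).
exists n => j.
have dE : depends_on (coins d M (n + j))
    (fun y => (0 < pop y n)%N && ((pop y (n + j))%:R <= Lam ^+ j)%R).
  move=> u v uv; rewrite (pop_depends_on uv) (@pop_depends_on _ _ n u v) // => s sn.
  by apply: uv; move: sn; rewrite !mem_coins; lia.
rewrite (@law_Ex _ _ p _ _ P X (fun s => (0 < size s)%N) mX indX _ _ (fun=> false)
    (coins_uniq _ _ _) (coins_pos _ _ _) dE) lee_fin.
apply: le_trans (Ex_pop_small M0 p0 p1 L1 j (fun=> false) dG) _.
by rewrite mulrC -ler_pdivlMr // expR_gt0.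
Qed.

(** For generation [f i], staying small for all [j >= J] has probability at most [2^-i], and so has
    the increasing union over [J]. Outside the limsup of these unions, some [m = Lam^-(f i)]
    works. *)
Lemma ae_population : P.-negligible [set w | (forall n, (0 < pop (X w) n)%N) /\
   ~ exists2 m : R, 0 < m & forall N, exists2 n, (N <= n)%N & m * Lam ^+ n <= (pop (X w) n)%:R].
Proof.
have L0 : 0 < Lam := lt_trans ltr01 L1.
pose E n j := [set w | ((0 < pop (X w) n)%N && ((pop (X w) (n + j))%:R <= Lam ^+ j)%R)].
have mE n j : measurable (E n j).
  apply: (@measurable_depends_on _ _ _ _ mX (coins d M (n + j))
    (fun y => (0 < pop y n)%N && ((pop y (n + j))%:R <= Lam ^+ j)%R)).
  move=> u v uv; rewrite (pop_depends_on uv) (@pop_depends_on _ _ n u v) // => s sn.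
  by apply: uv; move: sn; rewrite !mem_coins; lia.
pose B n J := \bigcap_(j in [set j | (J <= j)%N]) E n j.
have mB n J : measurable (B n J) by apply: bigcap_measurable => //; exists J => /=.
have e0 i : 0 < (1 / 2 ^+ i : R) by rewrite divr_gt0 // exprn_gt0.
have [f hf] := choice (fun i => stagnation_small (e0 i)).
pose A i := \bigcup_J B (f i) J.
have mA i : measurable (A i) by apply: bigcupT_measurable.
apply: negligibleS (negligible_limsup mA (c := 1) _) => [w [/= al h] N|i].
  exists N => //; apply: contrapT => hA; apply: h; exists (Lam ^- f N); first by rewrite invr_gt0 exprn_gt0.
  move=> K; apply: contrapT => hK; apply: hA; exists K => // j /= Kj; rewrite /E /= al /=.
  rewrite leNgt; apply/negP => hj; apply: hK; exists (f N + j)%N; first by lia.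
  by rewrite exprD mulKf ?ltW // gt_eqF // exprn_gt0.
have ndB : {homo B (f i) : n m / (n <= m)%N >-> (n <= m)%O}.
  by move=> n m nm; apply/subsetPset => w /= h j /= mj; apply: h; rewrite /= (leq_trans nm).
have cv := @nondecreasing_cvg_mu _ _ _ P (B (f i)) (mB _) (mA i) ndB.
rewrite -(cvg_lim _ cv) //; apply: lime_le; first exact: cvgP cv.
apply: nearW => J; apply: le_trans (hf i J); apply: le_measure; rewrite ?inE //.
  exact: mE.
by move=> w h; apply: h => /=.
Qed.

End AePopulation.

(** * Lattice points on fibres *)

Section Counting.
Variable R : realType.

Lemma count_itv_ge (y : R) (l m : nat) : 0 <= y -> y + l%:R <= m%:R ->
  l%:R <= \sum_(v < m) ((y <= v%:R) && (v%:R < y + l%:R))%R%:R :> R.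
Proof.
move=> y0 ym.
have [c /andP[yc cy]] : exists c : nat, (y <= c%:R) && (c%:R < y + 1).
  have /andP[h1 h2] := truncn_itv y0.
  have [e|ne] := eqVneq ((Num.truncn y)%:R) y.
    by exists (Num.truncn y); rewrite e lexx ltrDl ltr01.
  exists (Num.truncn y).+1; rewrite (ltW h2) -natr1 ltrD2r.
  by rewrite lt_neqAle ne.
have clm : (c + l <= m)%N.
  rewrite -ltnS -(ltr_nat R) natrD -natr1; lra.
rewrite -(big_mkord xpredT (fun v => (((y <= v%:R) && (v%:R < y + l%:R))%R%:R : R))).
rewrite (@big_cat_nat _ _ _ c) //=; last by rewrite (leq_trans _ clm) // leq_addr.
rewrite (@big_cat_nat _ _ _ (c + l)%N c) ?leq_addr //=.
rewrite -[leLHS]add0r lerD ?sumr_ge0 // -[leLHS]addr0 lerD ?sumr_ge0 //.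
rewrite [leRHS](eq_big_nat _ _ (F2 := fun=> 1)) ?sumr_const_nat ?addKn // => i /andP[ci il].
have -> : y <= i%:R by rewrite (le_trans yc) // ler_nat.
have il' : (i%:R : R) + 1 <= c%:R + l%:R by rewrite natr1 -natrD ler_nat.
have -> // : i%:R < y + l%:R by lra.
Qed.

Lemma count_itv_le (y l : R) (m : nat) : 0 <= l ->
  \sum_(v < m) ((y <= v%:R) && (v%:R <= y + l))%R%:R <= l + 1 :> R.
Proof.
move=> l0.
rewrite -(big_mkord xpredT (fun v => (((y <= v%:R) && (v%:R <= y + l))%R%:R : R))).
have -> : \sum_(0 <= v < m) ((y <= v%:R) && (v%:R <= y + l))%R%:R =
    (size [seq v <- iota 0 m | (y <= v%:R) && (v%:R <= y + l)%R])%:R :> R.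
  rewrite size_filter -sum1_count natr_sum /index_iota subn0 [RHS]big_mkcond.
  by apply: eq_bigr => v _; case: ifP.
set s := seq.filter _ _.
have us : uniq s by rewrite filter_uniq ?iota_uniq.
have ps : {in s, forall v : nat, y <= v%:R <= y + l}.
  by move=> v; rewrite mem_filter => /andP[].
case: s us ps => [|v0 s] us ps; first by rewrite addr_ge0.
have [a as_ amin] : exists2 a, a \in v0 :: s & forall v, v \in v0 :: s -> (a <= v)%N.
  have ex : exists a, a \in v0 :: s by exists v0; rewrite mem_head.
  by case: (ex_minnP ex) => a as_ am; exists a => // v /am.
apply: (@le_trans _ _ (Num.truncn l).+1%:R); last first.
  by rewrite -natr1 lerD2r truncn_le.
rewrite ler_nat -(size_iota a (Num.truncn l).+1); apply: uniq_leq_size => // v vs.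
rewrite mem_iota amin //= addnS ltnS -leq_subLR truncn_ge_nat // natrB ?amin //.
have /andP[_ h1] := ps _ vs; have /andP[h2 _] := ps _ as_; lra.
Qed.

Lemma sum_ffun_prod (k m : nat) (F : 'I_k -> 'I_m -> R) :
  \sum_(u : {ffun 'I_k -> 'I_m}) \prod_j F j (u j) = \prod_j \sum_v F j v.
Proof. by rewrite bigA_distr_bigA. Qed.

Lemma sum_ffun_coord (k m : nat) (j : 'I_k) (F : 'I_m -> R) :
  \sum_(u : {ffun 'I_k -> 'I_m}) F (u j) = m%:R ^+ k.-1 * \sum_v F v.
Proof.
transitivity (\sum_(u : {ffun 'I_k -> 'I_m}) \prod_i (if i == j then F (u i) else 1)).
  by apply: eq_bigr => u _; rewrite -big_mkcond big_pred1_eq.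
rewrite (sum_ffun_prod (fun i v => if i == j then F v else 1)) (bigD1 j) //= eqxx mulrC.
congr (_ * _); under eq_bigr => i /negPf -> do rewrite sumr_const card_ord.
by rewrite prodr_const (cardC1 j) card_ord.
Qed.

End Counting.

(** A finer truncation determines the coarser one; this nests half-open cubes along prefixes. *)
Lemma truncn_divn (R : realType) (x : R) (m : nat) : (0 < m)%N -> 0 <= x ->
  (Num.truncn (m%:R * x) %/ m)%N = Num.truncn x.
Proof.
move=> m0 x0; have mp : 0 < m%:R :> R by rewrite ltr0n.
apply/esym/truncn_def.
have /andP[h1 h2] := truncn_itv (mulr_ge0 (ltW mp) x0).
set t := Num.truncn _ in h1 h2 *.
have h3 : ((t %/ m * m)%:R : R) <= t%:R by rewrite ler_nat leq_trunc_div.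
have h4 : (t.+1%:R : R) <= ((t %/ m).+1 * m)%:R by rewrite ler_nat ltn_ceil.
apply/andP; split.
  by rewrite -(ler_pM2l mp) mulrC -natrM (le_trans h3).
by rewrite -(ltr_pM2l mp) (lt_le_trans h2) // [leRHS]mulrC -natrM.
Qed.

Section Hits.
Variables (R : realType) (d k M : nat).
Hypothesis M0 : (0 < M)%N.
Local Notation word := (seq (digit d M)).
Variable sg : 'I_k -> 'I_d.
Hypothesis sgI : injective sg.
Implicit Types (x : 'I_k -> R) (z c : word).

Definition free i := i \notin codom sg.

(* The point with pivot coordinates x, and with the free coordinates of the
   corner of the cube z, lies in the half-open cube c. *)
Definition hit x z c : bool :=
  [forall j, (0 <= x j) && (Num.truncn (M%:R ^+ size c * x j) == idx c (sg j))] &&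
  [forall i, free i ==> (idx (take (size c) z) i == idx c i)].

Lemma idx_rcons_inj (a b : digit d M) (s t : word) i :
  (idx (rcons s a) i == idx (rcons t b) i) = (idx s i == idx t i) && (a i == b i).
Proof.
rewrite !idx_rcons; apply/eqP/andP => [h|[/eqP -> /eqP ->] //].
have ha := ltn_ord (a i); have hb := ltn_ord (b i).
have e1 : idx s i = idx t i.
  have := congr1 (fun n => n %/ M)%N h; rewrite ![(M * _)%N]mulnC !divnMDl //.
  by rewrite !divn_small // !addn0.
by split; apply/eqP => //; apply: val_inj => /=; move: h; rewrite e1; lia.
Qed.

(** Half-open cubes form a partition, so the next digit is forced: on pivot coordinates by the
    scaled truncation modulo [M], on free ones by the next digit of [z], which exists because
    [size c < size z]. *)
Lemma hit_rcons x z c : (size c < size z)%N -> exists a0 : digit d M,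
  forall a, hit x z (rcons c a) = hit x z c && (a == a0).
Proof.
case/lastP E : (take (size c).+1 z) => [|z' b] cz.
  by move: cz => /size_takel; rewrite E.
have sz' : size z' = size c by have := size_takel cz; rewrite E size_rcons => -[].
have tz : take (size c) z = z'.
  by rewrite -(take_takel _ (leqnSn _)) E -cats1 takel_cat ?sz' // take_oversize ?sz'.
pose t j := (Num.truncn (M%:R ^+ (size c).+1 * x j) %% M)%N.
have tM j : (t j < M)%N by rewrite ltn_pmod.
exists [ffun i => if [pick j | sg j == i] is Some j then Ordinal (tM j) else b i].
set a0 := finfun _.
have a0s j : a0 (sg j) = Ordinal (tM j).
  by rewrite ffunE; case: pickP => [j' /eqP /sgI -> //|/(_ j)]; rewrite eqxx.
have a0f i : free i -> a0 i = b i.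
  move=> fi; rewrite ffunE; case: pickP => [j /eqP ji|//].
  by move: fi; rewrite /free -ji codom_f.
have st a j : 0 <= x j -> (Num.truncn (M%:R ^+ (size c).+1 * x j) == idx (rcons c a) (sg j)) =
   (Num.truncn (M%:R ^+ size c * x j) == idx c (sg j)) && (a (sg j) == a0 (sg j)).
  move=> xj; rewrite idx_rcons a0s -val_eqE /= /t.
  have Mx : 0 <= M%:R ^+ size c * x j by rewrite mulr_ge0 ?exprn_ge0.
  rewrite exprS -mulrA -(truncn_divn M0 Mx).
  set T := Num.truncn _; have haM := ltn_ord (a (sg j)).
  have TM := divn_eq T M; have Tm := ltn_pmod T M0.
  apply/idP/andP => [/eqP ->|[/eqP e1 /eqP e2]].
    rewrite [(M * _)%N]mulnC divnMDl // divn_small // addn0 modnMDl modn_small //.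
  by rewrite -e1 e2 [(M * _)%N]mulnC -divn_eq.
move=> a; rewrite /hit size_rcons E tz.
apply/idP/idP.
  move=> /andP[/forallP h1 /forallP h2]; apply/andP; split.
    apply/andP; split; apply/forallP.
      by move=> j; have /andP[xj] := h1 j; rewrite st // xj => /andP[].
    move=> i; apply/implyP => fi; have := h2 i; rewrite fi /= idx_rcons_inj.
    by move=> /andP[].
  apply/eqP/ffunP => i; have [fi|] := boolP (free i).
    by have := h2 i; rewrite fi /= idx_rcons_inj => /andP[_ /eqP <-]; rewrite a0f.
  rewrite negbK => /codomP[j ->]; have /andP[xj] := h1 j.
  by rewrite st // => /andP[_ /eqP].
move=> /andP[/andP[/forallP h1 /forallP h2] /eqP ->].
apply/andP; split; apply/forallP.
  by move=> j; have /andP[xj e] := h1 j; rewrite xj st // e eqxx.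
move=> i; apply/implyP => fi; have := h2 i; rewrite fi /= idx_rcons_inj => -> /=.
by rewrite a0f.
Qed.

Lemma sum_hit_rcons x z c : (size c < size z)%N ->
  \sum_a (hit x z (rcons c a))%:R = (hit x z c)%:R :> R.
Proof.
move=> /(hit_rcons x)[a0 h]; rewrite (bigD1 a0) //= h eqxx andbT big1 ?addr0 // => a /negPf aa.
by rewrite h aa andbF.
Qed.

Lemma sum_hit_words x z n : (n <= size z)%N ->
  \sum_(c <- words d M n) (hit x z c)%:R <= 1 :> R.
Proof.
elim: n => [|n IH] nz.
  by rewrite /words big_seq1; case: hit.
rewrite big_words_rcons big_seq (eq_bigr (fun c => (hit x z c)%:R)) -?big_seq ?IH 1?ltnW //.
by move=> c /size_in_words cn; rewrite sum_hit_rcons // cn.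
Qed.

Definition agree_free c z : bool := [forall i, free i ==> (idx z i == idx c i)].

Lemma card_digit_agree (b : digit d M) :
  \sum_(a : digit d M) ([forall i, free i ==> (a i == b i)])%:R = M%:R ^+ k :> R.
Proof.
transitivity (\sum_(a : {ffun 'I_d -> 'I_M}) \prod_i (if free i then (a i == b i)%:R else 1 : R)).
  apply: eq_bigr => a _; case: forallP => [h|h].
    by rewrite big1 // => i _; have := h i; case: free => //= ->.
  have [i hi] : exists i, ~~ (free i ==> (a i == b i)).
    by apply: contrapT => hn; apply: h => i; apply: contrapT => /negP hi; apply: hn; exists i.
  rewrite (bigD1 i) //=; move: hi; rewrite negb_imply => /andP[-> /negPf ->].
  by rewrite mul0r.
rewrite (sum_ffun_prod (fun i v => if free i then (v == b i)%:R else 1)).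
rewrite (bigID free) /= big1 ?mul1r; last first.
  move=> i fi; rewrite fi (bigD1 (b i)) //= eqxx big1 ?addr0 // => v /negPf -> //.
under eq_bigr => i /negPf -> do rewrite sumr_const card_ord.
rewrite prodr_const; congr (_ ^+ _).
rewrite -(card_ord k) -(card_codom sgI); apply: eq_card => i.
by rewrite unfold_in /free negbK.
Qed.

Lemma sum_agree_free c :
  \sum_(s <- words d M (size c)) (agree_free c s)%:R = M%:R ^+ (k * size c) :> R.
Proof.
elim/last_ind: c => [|c b IH].
  rewrite muln0 expr0 /words big_seq1; suff -> : agree_free [::] [::] by [].
  by apply/forallP => i; rewrite eqxx implybT.
rewrite size_rcons big_words_rcons mulnS exprD mulrC -IH big_distrl /=.
apply: eq_bigr => s _; rewrite -(card_digit_agree b) big_distrr /=.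
apply: eq_bigr => a _; rewrite -natrM mulnb; congr (nat_of_bool _)%:R.
rewrite /agree_free; apply/idP/andP => [/forallP h|[/forallP h1 /forallP h2]].
  by split; apply/forallP => i; have := h i; rewrite idx_rcons_inj; case: free => //= /andP[].
by apply/forallP => i; have := h1 i; have := h2 i; rewrite idx_rcons_inj; case: free => //= -> ->.
Qed.

(** The average runs over words [z] in all [d] coordinates, although [hit] compares only the free
    ones with [c]; this avoids a separate type of [D]-dimensional words. The pivot coordinates [x z]
    depend on [z], as they do along a fibre. *)
Definition weight (H : nat) (x : word -> 'I_k -> R) c : R :=
  M%:R ^- (H * d) * \sum_(z <- words d M H) (hit (x z) z c)%:R.

(** For the upper bound the pivot conditions are dropped: agreement of the free coordinates leaves
    [M^(k (n+1))] of the [M^(d (n+1))] prefixes of length [n + 1]. *)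
Lemma weight_is_net n H (x : word -> 'I_k -> R) : (n < H)%N -> is_net (d - k) (weight H x) n.
Proof.
move=> nH; have Mn : (0 : R) < M%:R by rewrite ltr0n.
have MH : 0 <= (M%:R : R) ^- (H * d) by rewrite invr_ge0 exprn_ge0 // ltW.
split=> [c|c cn|c cn].
- by apply: mulr_ge0 => //; apply: sumr_ge0.
- rewrite /weight -big_distrr /= exchange_big /=; congr (_ * _).
  apply: eq_big_seq => z; rewrite mem_words => /eqP zH.
  by rewrite sum_hit_rcons // cn zH.
have kd : (k <= d)%N by rewrite -(card_ord k) -[d]card_ord; exact: leq_card sgI.
rewrite /weight; have -> : H = (n.+1 + (H - n.+1))%N by rewrite subnKC.
set m := (H - n.+1)%N.
apply: (@le_trans _ _ (M%:R ^- ((n.+1 + m) * d) *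
   \sum_(z <- words d M (n.+1 + m)) (agree_free c (take n.+1 z))%:R)).
  rewrite ler_wpM2l ?invr_ge0 ?exprn_ge0 ?(ltW Mn) //; apply: ler_sum => z _.
  rewrite ler_nat -cn; set a := agree_free _ _.
  have -> : hit (x z) z c = [forall j, (0 <= x z j) && (Num.truncn (M%:R ^+ size c * x z j) == idx c (sg j))] && a by [].
  by case: a; rewrite ?andbF // leq_b1.
rewrite (sum_words_take n.+1 m (fun s => (agree_free c s)%:R : R)).
have := sum_agree_free c; rewrite cn => ->; rewrite -[X in _ * X]mulr_natr natrX.
have -> : (M%:R : R) ^+ ((n.+1 + m) * d) =
    M%:R ^+ (k * n.+1) * M%:R ^+ (m * d) * M%:R ^+ ((d - k) * n.+1).
  by rewrite -!exprD; congr (_ ^+ _); nia.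
by rewrite invfM mulrAC mulVf ?mul1r // mulf_neq0 // expf_neq0 // gt_eqF.
Qed.

(** For fixed [z] the pivot coordinates run through a translated grid, so each falls into the
    interval of length [M^-N] prescribed by [c] for at least [M^(H-N)] values of [u j]. The
    hypothesis on [g] makes the grid wide enough. The bound does not involve the shear [g], hence
    not the plane. *)
Lemma sum_weight_ge N H m (g : word -> 'I_k -> R) c : size c = N -> (N <= H)%N ->
  (forall z j, size z = H -> 0 <= - g z j /\ M%:R ^+ H * (1 - g z j) <= m%:R) ->
  M%:R ^- (N * d) * M%:R ^+ (H * k) <=
  \sum_(u : {ffun 'I_k -> 'I_m}) weight H (fun z j => (u j)%:R / M%:R ^+ H + g z j) c.
Proof.
move=> cN NH hg; have Mn : (0 : R) < M%:R by rewrite ltr0n.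
have Mp e : (0 : R) < M%:R ^+ e by rewrite exprn_gt0.
have key z : size z = H -> (agree_free c (take N z))%:R * M%:R ^+ (H - N) ^+ k <=
    \sum_(u : {ffun 'I_k -> 'I_m}) (hit (fun j => (u j)%:R / M%:R ^+ H + g z j) z c)%:R :> R.
  move=> zH.
  pose F j (v : 'I_m) : R := ((0 <= v%:R / M%:R ^+ H + g z j) &&
     (Num.truncn (M%:R ^+ N * (v%:R / M%:R ^+ H + g z j)) == idx c (sg j)))%:R.
  have -> : \sum_(u : {ffun 'I_k -> 'I_m}) (hit (fun j => (u j)%:R / M%:R ^+ H + g z j) z c)%:R =
      (agree_free c (take N z))%:R * \sum_(u : {ffun 'I_k -> 'I_m}) \prod_j F j (u j).
    rewrite big_distrr /=; apply: eq_bigr => u _; rewrite /hit cN -/(agree_free c (take N z)) mulrC.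
    rewrite -mulnb natrM; congr (_ * _); rewrite /F.
    case: forallP => [h|h]; first by rewrite big1 // => j _; rewrite h.
    have [j hj] : exists j, ~~ ((0 <= (u j)%:R / M%:R ^+ H + g z j) &&
       (Num.truncn (M%:R ^+ N * ((u j)%:R / M%:R ^+ H + g z j)) == idx c (sg j))).
      by apply: contrapT => hn; apply: h => j; apply: contrapT => /negP hj; apply: hn; exists j.
    by rewrite (bigD1 j) //= (negPf hj) mul0r.
  rewrite sum_ffun_prod ler_wpM2l // -[k in leLHS]card_ord -prodr_const.
  apply: ler_prod => j _; rewrite exprn_ge0 //=.
  have [g0 gm] := hg z j zH; set a := idx c (sg j).
  have aN : (a.+1 <= M ^ N)%N by rewrite -cN; exact: idx_lt.
  have aN' : (a.+1%:R : R) <= M%:R ^+ N by rewrite -natrX ler_nat.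
  (* Left end of the window of admissible [u j], whose length in grid units is [M^(H-N)]. *)
  pose y := M%:R ^+ H * (a%:R / M%:R ^+ N - g z j).
  have Ml : ((M ^ (H - N))%N%:R : R) = M%:R ^+ H / M%:R ^+ N.
    by rewrite natrX -[in RHS](subnK NH) exprD mulfK // gt_eqF.
  have y0 : 0 <= y by rewrite mulr_ge0 ?addr_ge0 ?divr_ge0 // ltW.
  have yl : y + (M ^ (H - N))%:R = M%:R ^+ H * (a.+1%:R / M%:R ^+ N - g z j).
    by rewrite Ml -natr1 /y; ring.
  rewrite -natrX; apply: le_trans (count_itv_ge y0 _) _.
    rewrite yl; apply: le_trans gm; rewrite ler_pM2l // lerD2r ler_pdivrMr // mul1r //.
  apply: ler_sum => v _; rewrite /F ler_nat yl.
  case: andP => // -[h1 h2].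
  have e1 : a%:R / M%:R ^+ N <= v%:R / M%:R ^+ H + g z j.
    by rewrite -lerBlDr ler_pdivlMr // mulrC.
  have e2 : v%:R / M%:R ^+ H + g z j < a.+1%:R / M%:R ^+ N.
    by rewrite -ltrBrDr ltr_pdivrMr // mulrC.
  rewrite (le_trans _ e1) ?divr_ge0 ?ler0n ?(ltW (Mp _)) //=.
  suff -> : Num.truncn (M%:R ^+ N * (v%:R / M%:R ^+ H + g z j)) = a by rewrite eqxx.
  by apply: truncn_def; rewrite ![M%:R ^+ N * _]mulrC -ler_pdivrMr // e1 -ltr_pdivlMr // e2.
have -> : \sum_(u : {ffun 'I_k -> 'I_m}) weight H (fun z j => (u j)%:R / M%:R ^+ H + g z j) c =
    M%:R ^- (H * d) * \sum_(z <- words d M H) \sum_(u : {ffun 'I_k -> 'I_m})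
      (hit (fun j => (u j)%:R / M%:R ^+ H + g z j) z c)%:R.
  by rewrite exchange_big big_distrr.
apply: (@le_trans _ _ (M%:R ^- (H * d) * \sum_(z <- words d M H)
    (agree_free c (take N z))%:R * M%:R ^+ (H - N) ^+ k)); last first.
  rewrite ler_pM2l ?invr_gt0 // big_seq [leRHS]big_seq; apply: ler_sum => z.
  by move/size_in_words => /key.
have := sum_words_take N (H - N) (fun s => (agree_free c s)%:R : R).
rewrite (subnKC NH) -big_distrl /= => ->; have := sum_agree_free c; rewrite cN => ->; rewrite -[X in _ * (X * _)]mulr_natr natrX.
rewrite ler_pdivrMl // mulrCA ler_pdivlMl // -!exprM -!exprD.
by rewrite ler_weXn2l ?ler1n //; nia.
Qed.

End Hits.

(** * Rounding the parameters of a fibre *)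

Section Compare.
Variables (R : realType) (d k M : nat).
Hypothesis M0 : (0 < M)%N.
Local Notation word := (seq (digit d M)).
Local Notation Mr := (M%:R : R).
Variable sg : 'I_k -> 'I_d.
Hypothesis sgI : injective sg.
Variables (b0 L : nat) (C : 'I_d -> 'I_k -> R).
Hypothesis hC : forall l j, `|C l j| <= b0%:R.
Hypothesis L0 : (0 < L)%N.

Let Mn : (0 : R) < Mr. Proof. by rewrite ltr0n. Qed.
Let Mp e : (0 : R) < Mr ^+ e. Proof. by rewrite exprn_gt0. Qed.

Lemma idx_take (z : word) n i : (n <= size z)%N ->
  idx (take n z) i = (idx z i %/ M ^ (size z - n))%N.
Proof.
elim/last_ind: z => [|z a IH] nz; first by case: n nz => // _; rewrite div0n.
move: nz; rewrite size_rcons leq_eqVlt => /predU1P[->|].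
  by rewrite take_oversize ?size_rcons // subnn divn1.
rewrite ltnS => nz; rewrite -cats1 takel_cat // cats1 IH // subSn // expnS divnMA idx_rcons.
by rewrite [(M * _)%N]mulnC divnMDl // (divn_small (ltn_ord _)) addn0.
Qed.

Lemma floor_div (a h m : nat) :
  0 <= a%:R / Mr ^+ (h + m) - (a %/ M ^ m)%N%:R / Mr ^+ h <= Mr ^- h.
Proof.
have Mm : (0 < M ^ m)%N by rewrite expn_gt0 M0.
have h1 : ((a %/ M ^ m * M ^ m)%N%:R : R) <= a%:R by rewrite ler_nat leq_trunc_div.
have h2 : (a%:R : R) <= ((a %/ M ^ m).+1 * M ^ m)%N%:R by rewrite ler_nat ltnW // ltn_ceil.
rewrite natrM natrX in h1; rewrite natrM natrX -natr1 in h2.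
rewrite exprD; have := Mp h; have := Mp m.
move: (Mr ^+ h) (Mr ^+ m) h1 h2 => Mh Mm' h1 h2 m0 h0.
have e : a%:R / (Mh * Mm') = (a%:R / Mm') / Mh by rewrite invfM mulrA mulrAC.
rewrite e -mulrBl; apply/andP; split.
  by rewrite divr_ge0 ?(ltW h0) // subr_ge0 ler_pdivlMr.
rewrite ler_pdivrMr // mulVf ?gt_eqF // lerBlDr ler_pdivrMr //; lra.
Qed.

(** Parameters and coefficients are natural numbers shifted by [b0], so that a rounded fibre is
    described by finitely many bounded integers. *)
Definition pivot_pt (H : nat) (u : 'I_k -> nat) (c : 'I_d -> 'I_k -> nat) (z : word) j : R :=
  (u j)%:R / Mr ^+ H - b0%:R + \sum_l (idx z l)%:R / Mr ^+ H * ((c l j)%:R / Mr ^+ H - b0%:R).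

Definition exact_pt (H : nat) (u : 'I_k -> nat) (z : word) j : R :=
  (u j)%:R / Mr ^+ H - b0%:R + \sum_l (idx z l)%:R / Mr ^+ H * C l j.

Definition round_u (n H : nat) (u : 'I_k -> nat) j := (u j %/ M ^ (H - L * n))%N.
Definition round_C (n : nat) l j := Num.truncn ((C l j + b0%:R) * Mr ^+ (L * n)).

Definition round_pt n H u (z : word) := pivot_pt (L * n) (round_u n H u) (round_C n) (take (L * n) z).

(** One unit for rounding [u]; for each [l], one for rounding [C l j], multiplied by a coordinate at
    most 1, and [b0] for shortening [z], which is multiplied by [C l j]. *)
Definition slack : R := 1 + d%:R * (1 + b0%:R).

Lemma round_C_dist n l j :
  `|(round_C n l j)%:R / Mr ^+ (L * n) - b0%:R - C l j| <= Mr ^- (L * n).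
Proof.
have := hC l j; rewrite ler_norml => /andP[c1 c2].
have c0 : 0 <= (C l j + b0%:R) * Mr ^+ (L * n) by rewrite mulr_ge0 ?(ltW (Mp _)) //; lra.
have /andP[h1 h2] := truncn_itv c0; rewrite -natr1 in h2; rewrite /round_C.
set t := _%:R in h1 h2 *; have := Mp (L * n); move: (Mr ^+ _) h1 h2 => m h1 h2 m0.
have mm : m * m^-1 = 1 by rewrite mulfV // gt_eqF.
have mi : 0 < m^-1 by rewrite invr_gt0.
have e1 : t * m^-1 <= C l j + b0%:R by rewrite ler_pdivrMr.
have e2 : C l j + b0%:R <= t * m^-1 + m^-1.
  by have := ltW h2; rewrite -ler_pdivlMr // mulrDl mul1r.
rewrite ler_norml; apply/andP; split; lra.
Qed.

Lemma round_pt_dist n H u z j : size z = H -> (L * n <= H)%N ->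
  `|round_pt n H u z j - exact_pt H u z j| <= slack * Mr ^- (L * n).
Proof.
move=> zH nH; rewrite /round_pt /pivot_pt /exact_pt /slack.
have HE : H = (L * n + (H - L * n))%N by rewrite subnKC.
set h := (L * n)%N; set e := Mr ^- h.
have e0 : 0 < e by rewrite invr_gt0.
have ud := floor_div (u j) h (H - h); rewrite -HE in ud.
have key l : `|(idx (take h z) l)%:R / Mr ^+ h * ((round_C n l j)%:R / Mr ^+ h - b0%:R) -
     (idx z l)%:R / Mr ^+ H * C l j| <= (1 + b0%:R) * e.
  have := floor_div (idx z l) h (H - h); rewrite -HE => zd.
  rewrite idx_take ?zH //; set a' := (_ %/ _)%:R / _ in zd *.
  set a := (idx z l)%:R / _ in zd *.
  have a'0 : 0 <= a' by rewrite divr_ge0.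
  have a1 : a <= 1.
    by rewrite ler_pdivrMr // mul1r -natrX ler_nat ltnW // -zH idx_lt.
  have := round_C_dist n l j; rewrite -/h -/e; set c' := _ - b0%:R.
  have := hC l j; rewrite !ler_norml; move: (C l j) => c /andP[c1 c2] /andP[d1 d2].
  have /andP[z1 z2] := zd; rewrite -/e in z2.
  have b0' : 0 <= b0%:R :> R by [].
  have -> : a' * c' - a * c = a' * (c' - c) - (a - a') * c by ring.
  have t1 : `|a' * (c' - c)| <= 1 * e.
    rewrite normrM (ger0_norm a'0) ler_pM //; first by lra.
    by rewrite ler_norml d1 d2.
  have t2 : `|(a - a') * c| <= e * b0%:R.
    rewrite normrM (ger0_norm z1) ler_pM //.
    by rewrite ler_norml c1 c2.
  rewrite -ler_norml (le_trans (ler_normB _ _)) //; lra.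
have -> (A B A' B' b : R) : A - b + B - (A' - b + B') = (A - A') + (B - B') by ring.
rewrite -sumrB (le_trans (ler_normD _ _)) // mulrDl lerD //.
  rewrite mul1r distrC ger0_norm; first by case/andP: ud.
  by case/andP: ud.
apply: le_trans (ler_norm_sum _ _ _) _; apply: le_trans (ler_sum _ (fun l _ => key l)) _.
by rewrite sumr_const card_ord -[leLHS]mulr_natl mulrA.
Qed.

(* Some exact pivot coordinate is so close to a wall of level n that rounding the
   parameters at scale L * n may move the point to another cube of level n. *)
Definition near n H u z : bool := [exists j, [exists v : 'I_(M ^ n).+1,
  `|exact_pt H u z j - v%:R / Mr ^+ n| <= slack * Mr ^- (L * n)]].

Lemma slack_gt0 : 0 < slack.
Proof. by rewrite /slack ltr_pwDl // mulr_ge0 // addr_ge0. Qed.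

(** If the two roundings truncate differently, a wall separates them. Both lie within
    [slack * M^-(L n)] of the exact point, hence so does the wall. *)
Lemma hit_near n H u z c : size z = H -> (L * n.+1 <= H)%N -> size c = n ->
  hit sg (round_pt n.+1 H u z) z c -> hit sg (round_pt n H u z) z c || near n H u z.
Proof.
move=> zH nH cn h; have [//|nh /=] := boolP (hit sg (round_pt n H u z) z c).
have dl : slack * Mr ^- (L * n.+1) <= slack * Mr ^- (L * n).
  rewrite ler_pM2l ?slack_gt0 // lef_pV2 ?posrE // ler_weXn2l ?ler1n //; lia.
have nH' : (L * n <= H)%N by apply: leq_trans nH; lia.
move: h nh; rewrite /hit => /andP[/forallP h1 ->]; rewrite andbT.
rewrite negb_forall => /existsP[j hj]; apply/existsP; exists j.
have /andP[x0 /eqP xa] := h1 j; rewrite cn in xa hj.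
have d1 := round_pt_dist u j zH nH; have d2 := round_pt_dist u j zH nH'.
move: (round_pt n.+1 H u z j) (round_pt n H u z j) (exact_pt H u z j) x0 xa hj d1 d2.
move=> x' x y x0 xa hj d1 d2; set a := idx c (sg j) in xa hj.
set del := slack * _ in dl d2 *.
have aM : (a.+1 <= M ^ n)%N by rewrite -cn; exact: idx_lt.
have {d1} := le_trans d1 dl; rewrite ler_norml => /andP[d1 d1'].
move: d2; rewrite ler_norml => /andP[d2 d2'].
have /andP[] := truncn_itv (mulr_ge0 (ltW (Mp n)) x0); rewrite xa => l1 l2.
have {}l1 : a%:R / Mr ^+ n <= x' by rewrite ler_pdivrMr // mulrC.
have {}l2 : x' < a.+1%:R / Mr ^+ n by rewrite ltr_pdivlMr // mulrC.
have [xs|xs] := ltP x (a%:R / Mr ^+ n).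
  apply/existsP; exists (Ordinal (leqW aM : (a < (M ^ n).+1)%N)) => /=.
  by rewrite ler_norml; apply/andP; split; lra.
have [xl|xl] := ltP x (a.+1%:R / Mr ^+ n).
  case/negP: hj; have x00 : 0 <= x by rewrite (le_trans _ xs) // divr_ge0 // ltW.
  rewrite x00 /=; apply/eqP/truncn_def; rewrite ![Mr ^+ n * _]mulrC.
  by rewrite -ler_pdivrMr // xs -ltr_pdivlMr // xl.
have aM' : (a.+1 < (M ^ n).+1)%N by [].
apply/existsP; exists (Ordinal aM') => /=.
by rewrite ler_norml; apply/andP; split; lra.
Qed.

(** Both [u] and [C] enter through their roundings at scale [L * n] only, so that exponentially many
    weights suffice at level [n]. *)
Definition net_weight n H (u : 'I_k -> nat) : word -> R :=
  weight sg (L * n) (pivot_pt (L * n) (round_u n H u) (round_C n)).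

(** An average over a common fine scale [H] allows the weights of successive levels to be compared
    word by word. *)
Lemma net_weightE n H u c : (L * n <= H)%N -> (size c <= L * n)%N ->
  net_weight n H u c = Mr ^- (H * d) * \sum_(z <- words d M H) (hit sg (round_pt n H u z) z c)%:R.
Proof.
move=> nH cn; rewrite /net_weight /weight /round_pt.
have := sum_words_take (L * n) (H - L * n)
  (fun z => (hit sg (pivot_pt (L * n) (round_u n H u) (round_C n) z) z c)%:R : R).
rewrite subnKC // => hs.
have -> : \sum_(z <- words d M H) (hit sg (pivot_pt (L * n) (round_u n H u) (round_C n) (take (L * n) z)) z c)%:R
   = \sum_(z <- words d M H) (hit sg (pivot_pt (L * n) (round_u n H u) (round_C n) (take (L * n) z)) (take (L * n) z) c)%:R :> R.
  by apply: eq_bigr => z _; rewrite /hit take_takel.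
rewrite hs; set S := \sum_(z <- words d M (L * n)) _; rewrite -(mulr_natr S) natrX.
have -> : Mr ^+ (H * d) = Mr ^+ (L * n * d) * Mr ^+ ((H - L * n) * d).
  by rewrite -exprD -mulnDl subnKC.
by rewrite invfM -mulrA [_^-1 * (S * _)]mulrC mulfK // gt_eqF.
Qed.

Variable p : R.
Hypothesis p0 : 0 < p.

Definition flow_err n H u : R := p ^- n * (Mr ^- (H * d) * \sum_(z <- words d M H) (near n H u z)%:R).

Lemma flow_err_ge0 n H u : 0 <= flow_err n H u.
Proof.
by rewrite !mulr_ge0 ?invr_ge0 ?exprn_ge0 ?(ltW p0) // sumr_ge0.
Qed.

(** A word [z] away from the walls that hits [c] under the finer rounding also hits it under the
    coarser one. A word near a wall hits at most one cube of level [n], so its total contribution is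
    at most 1 whatever [Q] and [x] are. *)
Lemma flow_compare x Q n H u : (L * n.+1 <= H)%N ->
  flow p (net_weight n.+1 H u) x Q n <= flow p (net_weight n H u) x Q n + flow_err n H u.
Proof.
move=> nH; have nH' : (L * n <= H)%N by apply: leq_trans nH; lia.
have L0' := L0.
rewrite /flow /flow_err -mulrDr ler_pM2l ?invr_gt0 ?exprn_gt0 //.
apply: (@le_trans _ _ (\sum_(c <- words d M n | take (size Q) c == Q)
   (net_weight n H u c * (retained x c)%:R + Mr ^- (H * d) *
     \sum_(z <- words d M H) (hit sg (round_pt n.+1 H u z) z c && near n H u z)%:R))).
  rewrite big_seq_cond [leRHS]big_seq_cond; apply: ler_sum => c /andP[/size_in_words cn _].
  have nLn : (n <= L * n)%N by rewrite leq_pmull.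
  rewrite !net_weightE ?cn //; last by apply: leq_trans nLn _; lia.
  case: retained; last by rewrite !mulr0 add0r mulr_ge0 ?invr_ge0 ?(ltW (Mp _)) ?sumr_ge0.
  rewrite !mulr1 -mulrDr ler_pM2l ?invr_gt0 // -big_split /= big_seq [leRHS]big_seq.
  apply: ler_sum => z /size_in_words zH; rewrite -natrD ler_nat.
  have := @hit_near n H u z c zH nH cn; case: hit => //= /(_ isT).
  by case: hit; case: near.
rewrite big_split lerD2l /= -big_distrr /= ler_pM2l ?invr_gt0 //.
rewrite exchange_big /= big_seq [leRHS]big_seq; apply: ler_sum => z /size_in_words zH.
case: (near n H u z); last by rewrite big1 // => c _; rewrite andbF.
under eq_bigr do rewrite andbT.
apply: le_trans (@sum_hit_words R d k M M0 sg sgI (round_pt n.+1 H u z) z n _); last first.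
  by rewrite zH; apply: leq_trans nH; rewrite (leq_trans (leqnSn n)) // leq_pmull.
by rewrite big_mkcond /=; apply: ler_sum => c _; case: ifP.
Qed.

(** For fixed [z], pivot index and wall, only [u j] is constrained, to an interval of length
    [2 slack M^(H - L n)] in grid units; the other [k - 1] parameters are free. *)
Lemma sum_flow_err n H m : (L * n <= H)%N ->
  \sum_(u : {ffun 'I_k -> 'I_m}) flow_err n H (fun j => u j) <=
  p ^- n * (k%:R * ((M ^ n).+1%:R * (m%:R ^+ k.-1 * (2 * slack * Mr ^+ (H - L * n) + 1)))).
Proof.
move=> nH; set B := k%:R * _.
rewrite /flow_err -big_distrr /= ler_pM2l ?invr_gt0 ?exprn_gt0 //.
rewrite -big_distrr /= exchange_big /=.
have HB : (Mr ^+ (H * d) * B)= \sum_(z <- words d M H) B.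
  by rewrite big_const_seq count_predT iter_addr_0 size_words -(mulr_natl B) natrX.
rewrite ler_pdivrMl // HB big_seq [leRHS]big_seq; apply: ler_sum => z /size_in_words zH.
pose g j := exact_pt H (fun=> 0%N) z j.
pose del := slack * Mr ^- (L * n).
pose F j (v : 'I_(M ^ n).+1) (a : 'I_m) : R :=
   (`|a%:R / Mr ^+ H + g j - v%:R / Mr ^+ n| <= del)%R%:R.
apply: (@le_trans _ _ (\sum_(u : {ffun 'I_k -> 'I_m}) \sum_j \sum_v F j v (u j))).
  apply: ler_sum => u _; case nz: near; last by apply: sumr_ge0 => j _; apply: sumr_ge0.
  have /existsP[j /existsP[v hv]] := nz.
  rewrite (bigD1 j) //= (bigD1 v) //= -addrA /F.
  have -> : (u j)%:R / Mr ^+ H + g j = exact_pt H (fun j => u j) z j.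
    by rewrite /g /exact_pt mulr0n mul0r sub0r addrA.
  rewrite /del hv lerDl addr_ge0 ?sumr_ge0 // => j' _; exact: sumr_ge0.
rewrite exchange_big /=.
have -> : B = \sum_(j < k) (M ^ n).+1%:R * (m%:R ^+ k.-1 * (2 * slack * Mr ^+ (H - L * n) + 1)).
  by rewrite sumr_const card_ord -[RHS]mulr_natl.
apply: ler_sum => j _; rewrite exchange_big /=.
have -> : forall c : R, (M ^ n).+1%:R * c = \sum_(v < (M ^ n).+1) c.
  by move=> c; rewrite sumr_const card_ord -[RHS]mulr_natl.
apply: ler_sum => v _; rewrite (sum_ffun_coord j (F j v)) ler_wpM2l ?exprn_ge0 //.
have E : 2 * slack * Mr ^+ (H - L * n) = Mr ^+ H * (2 * del).
  have -> : Mr ^+ H = Mr ^+ (H - L * n) * Mr ^+ (L * n) by rewrite -exprD subnK.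
  by rewrite /del; field; rewrite gt_eqF.
have d0 : 0 <= Mr ^+ H * (2 * del).
  by rewrite !mulr_ge0 ?(ltW (Mp _)) ?invr_ge0 ?(ltW (Mp _)) ?(ltW slack_gt0).
rewrite E; apply: le_trans (count_itv_le (Mr ^+ H * (v%:R / Mr ^+ n - g j - del)) m d0).
apply: ler_sum => a _; rewrite /F ler_nat ler_norml.
case: andP => // -[h1 h2]; rewrite -mulrDr.
have -> : Mr ^+ H * (v%:R / Mr ^+ n - g j - del) <= a%:R.
  by rewrite mulrC -ler_pdivlMr //; lra.
have -> // : a%:R <= Mr ^+ H * (v%:R / Mr ^+ n - g j - del + 2 * del).
by rewrite [leRHS]mulrC -ler_pdivrMr //; lra.
Qed.

End Compare.

(** * Bounds for regular and irregular fibres *)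

(** Discrete Gronwall inequality: [1 + a <= exp a], and every additive term is amplified by at most
    the whole product. *)
Lemma grow_chain (R : realType) (f a e s : nat -> R) n N :
  (n <= N)%N -> (forall i, 0 <= f i) -> (forall i, 0 <= a i) -> (forall i, 0 <= e i) ->
  (forall i, 0 <= s i) ->
  (forall i, (n <= i < N)%N -> f i.+1 <= (1 + a i) * (f i + e i) + s i) ->
  f N <= expR (\sum_(n <= i < N) a i) * (f n + \sum_(n <= i < N) (e i + s i)).
Proof.
move=> + f0 a0 e0 s0; elim: N => [|N IH].
  by rewrite leqn0 => /eqP -> _; rewrite !big_geq // expR0 mul1r addr0.
rewrite leq_eqVlt => /predU1P[<- _|]; first by rewrite !big_geq // expR0 mul1r addr0.
rewrite ltnS => nN h; have {}IH := IH nN _.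
have {IH} : f N <= expR (\sum_(n <= i < N) a i) * (f n + \sum_(n <= i < N) (e i + s i)).
  by apply: IH => i /andP[ni iN]; apply: h; rewrite ni ltnW.
rewrite !big_nat_recr //= expRD; set A := \sum_(n <= i < N) a i; set S := \sum_(n <= i < N) _ => h1.
have h2 := h N; rewrite nN ltnS leqnn in h2; have {}h2 := h2 isT.
have A1 : 1 <= expR A by rewrite -[leLHS]expR0 ler_expR sumr_ge0.
have := expR_ge1Dx (a N); move: (expR (a N)) => Ea aN; have := a0 N; have := e0 N; have := s0 N; have := f0 N.
have S0 : 0 <= f n + S by rewrite addr_ge0 ?sumr_ge0 // => i _; rewrite addr_ge0.
move: (expR A) (f N) (f N.+1) (a N) (e N) (s N) A1 aN h1 h2 S0.
move=> EA u v al ee ss A1 aN h1 h2 S0 u0 s0' e0' a0'.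
have Ea1 : 1 <= Ea by lra.
have t1 : u + ee <= EA * (f n + S + ee).
  by rewrite mulrDr lerD // ler_peMl.
have t2 : (1 + al) * (u + ee) <= Ea * (EA * (f n + S + ee)) by apply: ler_pM => //; lra.
have t3 : ss <= EA * Ea * ss by rewrite ler_peMl // mulr_ege1.
have -> : EA * Ea * (f n + (S + (ee + ss))) = Ea * (EA * (f n + S + ee)) + EA * Ea * ss by ring.
by rewrite (le_trans h2) // lerD.
Qed.

Section Regular.
Variables (R : realType) (d k M : nat).
Hypothesis M1 : (1 < M)%N.
Local Notation word := (seq (digit d M)).
Local Notation Mr := (M%:R : R).
Variable sg : 'I_k -> 'I_d.
Hypothesis sgI : injective sg.
Variables (b0 L : nat) (C : 'I_d -> 'I_k -> R).
Hypothesis hC : forall l j, `|C l j| <= b0%:R.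
Hypothesis Ld : (4 * d + 2 <= L)%N.
Hypothesis k0 : (0 < k)%N.
Variables p r : R.
Hypotheses (p0 : 0 < p) (p1 : p <= 1) (r1 : 1 < r).
Local Notation D := (d - k)%N.
Local Notation q := (p * Mr ^+ D).
Hypothesis rq : r ^+ 3 <= q.
Variable (x : word -> bool) (n1 : nat).
Local Notation W := (net_weight sg b0 L C).
Hypothesis steps : forall n H u, (n1 <= n)%N -> (L * n.+1 <= H)%N ->
  (forall j, (u j < 2 * b0 * M ^ H)%N) -> flow_steps D p r (W n.+1 H u) x n.
Local Notation err := (flow_err M b0 L C p).

Let M0 : (0 < M)%N := ltnW M1.
Let Mp e : (0 : R) < Mr ^+ e. Proof. by rewrite exprn_gt0 // ltr0n. Qed.
Let L0 : (0 < L)%N. Proof. by apply: leq_trans Ld; rewrite addnC. Qed.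
Let r0 : 0 < r := lt_trans ltr01 r1.
Let q0 : 0 < q. Proof. by rewrite mulr_gt0 // exprn_gt0 // ltr0n. Qed.
Let rqq : r <= q.
Proof. by apply: le_trans rq; rewrite -[leLHS]expr1 ler_weXn2l // ltW. Qed.
Let q1 : 1 < q := lt_le_trans r1 rqq.

Lemma weight_below H (y : word -> 'I_k -> R) Q n : (size Q <= n <= H)%N ->
  \sum_(c <- words d M n | take (size Q) c == Q) weight sg H y c = weight sg H y Q.
Proof.
move=> /andP[]; elim: n => [|n IH].
  rewrite leqn0 size_eq0 => /eqP -> _ /=; rewrite /words big_cons big_nil /= addr0 //.
rewrite leq_eqVlt => /predU1P[e _|Qn nH].
  rewrite e big_mkcond /= -(sum_pred1_uniq (r := words d M n.+1) _ (words_uniq _ _ _)) ?mem_words ?e //.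
  apply: eq_big_seq => c; rewrite mem_words => /eqP cn.
  by rewrite take_oversize ?cn //.
rewrite -IH ?(ltnW nH) // big_mkcond big_words_rcons [RHS]big_mkcond /=.
apply: eq_big_seq => c; rewrite mem_words => /eqP cn.
under eq_bigr do rewrite -cats1 takel_cat ?cn // cats1.
have [_ h _] := @weight_is_net R d k M M0 sg sgI n H y nH.
by case: ifP => _; rewrite ?h // big1.
Qed.

Lemma weight_le H (y : word -> 'I_k -> R) Q : (size Q <= H)%N ->
  weight sg H y Q <= Mr ^- (D * size Q).
Proof.
case: (posnP (size Q)) => [e|Q0] QH; last first.
  have nH : ((size Q).-1 < H)%N by rewrite prednK.
  have [_ _ h] := @weight_is_net R d k M M0 sg sgI (size Q).-1 H y nH.
  by have := h Q; rewrite prednK // => /(_ erefl).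
rewrite e muln0 expr0 invr1 /weight mulrC ler_pdivrMr // mul1r.
apply: (@le_trans _ _ (\sum_(z <- words d M H) 1)); last first.
  by rewrite big_const_seq count_predT iter_addr_0 size_words natrX.
by apply: ler_sum => z _; case: hit.
Qed.

Lemma flow_le_start H (y : word -> 'I_k -> R) Q n : (size Q <= n <= H)%N ->
  flow p (weight sg H y) x Q n <= p ^- n * Mr ^- (D * size Q).
Proof.
move=> h; rewrite /flow ler_pM2l ?invr_gt0 ?exprn_gt0 //.
have QH : (size Q <= H)%N by move: h => /andP[]; exact: leq_trans.
apply: le_trans (weight_le y QH); rewrite -(weight_below y h); apply: ler_sum => c _.
have w0 : 0 <= weight sg H y c.
  by rewrite mulr_ge0 ?invr_ge0 ?(ltW (Mp _)) // sumr_ge0.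
by case: retained; rewrite ?mulr1 // mulr0.
Qed.

Definition geom : R := (1 - r^-1)^-1.

Let ri : 0 <= r^-1 < 1.
Proof. by rewrite invr_ge0 (ltW r0) invf_lt1. Qed.

Lemma geom_ge1 : 1 <= geom.
Proof.
have /andP[h1 h2] := ri; rewrite /geom invf_ge1 ?subr_gt0 // gerBl //.
Qed.

Lemma sum_rV m n : \sum_(m <= i < n) r ^- i <= r ^- m * geom.
Proof. by under eq_bigr do rewrite -exprVn; rewrite -exprVn; exact: sum_geometric_le. Qed.

Lemma rV_le1 m : r ^- m <= 1.
Proof. by rewrite invf_le1 ?exprn_gt0 // exprn_ege1 // ltW. Qed.

(** Passing from level [i] to [i + 1] takes two moves: the one-step bound for the net weight of
    level [i + 1], then a return to the net weight of level [i] at the cost of [err i]. *)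
Lemma flow_chain Q N u n : (n1 <= n <= N)%N -> (size Q <= n)%N ->
  (forall j, (u j < 2 * b0 * M ^ (L * N))%N) ->
  flow p (W N (L * N) u) x Q N <= expR geom * (flow p (W n (L * N) u) x Q n +
    \sum_(n <= i < N) err i (L * N) u + 2 * geom * (r ^+ size Q / q ^+ size Q)).
Proof.
move=> /andP[n1n nN] Qn hu; set j := size Q in Qn *.
have rp e : 0 < r ^+ e by rewrite exprn_gt0.
have qp e : 0 < q ^+ e by rewrite exprn_gt0.
pose s i := 2 * r ^+ (2 * j) / (r ^+ i * q ^+ j).
have w0 i c : 0 <= W i (L * N) u c.
  by rewrite mulr_ge0 ?invr_ge0 ?(ltW (Mp _)) // sumr_ge0.
have := @grow_chain R (fun i => flow p (W i (L * N) u) x Q i) (fun i => r ^- (i - j))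
   (fun i => err i (L * N) u) s n N nN _ _ _ _ _.
move=> h; apply: le_trans (h _ _ _ _ _) _ => {h}.
- by move=> i; apply: flow_ge0.
- by move=> i; rewrite invr_ge0 ltW.
- by move=> i; apply: flow_err_ge0.
- by move=> i; rewrite /s !mulr_ge0 ?invr_ge0 ?mulr_ge0 // ltW.
- move=> i /andP[ni iN]; have iN' : (L * i.+1 <= L * N)%N by rewrite leq_mul2l iN orbT.
  have n1i : (n1 <= i)%N by apply: leq_trans ni.
  have := steps n1i iN' hu (leq_trans Qn ni); rewrite -/j -/(s i) => h.
  apply: le_trans h _; rewrite lerD2r ler_pM2l ?ltr_pwDl ?invr_ge0 ?(ltW (rp _)) //.
  exact: flow_compare.
have gA : \sum_(n <= i < N) r ^- (i - j) <= geom.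
  rewrite -{1}(subnK Qn) big_addn; under eq_bigr do rewrite addnK.
  apply: le_trans (sum_rV _ _) _; rewrite ler_piMl ?rV_le1 //.
  exact: le_trans ler01 geom_ge1.
have gS : \sum_(n <= i < N) s i <= 2 * geom * (r ^+ j / q ^+ j).
  have -> : \sum_(n <= i < N) s i = 2 * (r ^+ j * r ^+ j) / q ^+ j * \sum_(n <= i < N) r ^- i.
    rewrite big_distrr /=; apply: eq_bigr => i _; rewrite /s mul2n -addnn exprD invfM.
    by rewrite [(r ^+ i)^-1 * _]mulrC (mulrA (2 * _)).
  apply: (@le_trans _ _ (2 * (r ^+ j * r ^+ j) / q ^+ j * (r ^- j * geom))).
    rewrite ler_pM2l ?mulr_gt0 ?invr_gt0 //; apply: le_trans (sum_rV _ _) _.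
    rewrite ler_pM2r; last exact: lt_le_trans ltr01 geom_ge1.
    by rewrite lef_pV2 ?posrE // ler_weXn2l // ltW.
  suff -> : 2 * (r ^+ j * r ^+ j) / q ^+ j * (r ^- j * geom) = 2 * geom * (r ^+ j / q ^+ j) by [].
  have := gt_eqF (rp j); have := gt_eqF (qp j); move: (r ^+ j) (q ^+ j) (geom) => a b g b_ a_.
  by field; rewrite a_ b_.
rewrite ler_pM ?expR_ge0 ?ler_expR //.
  by rewrite addr_ge0 ?flow_ge0 // sumr_ge0 // => i _; rewrite addr_ge0 ?flow_err_ge0 //
    /s !mulr_ge0 ?invr_ge0 ?mulr_ge0 // ltW.
by rewrite big_split /= addrA lerD2l.
Qed.

(** The threshold makes the errors from level [j = size Q] on add up to at most [geom * q^-j], which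
    is absorbed by the other terms, of order [r^j / q^j]. *)
Definition regular N u := forall i, (n1 <= i < N)%N -> err i (L * N) u <= (q * r) ^- i.

Lemma root_flow N u : (n1 <= N)%N -> (forall j, (u j < 2 * b0 * M ^ (L * N))%N) ->
  flow p (W N (L * N) u) x [::] N <= expR geom * (p ^- n1 + 2 * geom) +
    expR geom * \sum_(n1 <= i < N) err i (L * N) u.
Proof.
move=> nN hu; have h := @flow_chain [::] N u n1 _ (leq0n _) hu.
rewrite leqnn nN in h; apply: le_trans (h isT) _.
rewrite !expr0 divr1 mulr1 -mulrDr ler_pM2l ?expR_gt0 //.
have h2 : flow p (W n1 (L * N) u) x [::] n1 <= p ^- n1 * Mr ^- (D * 0).
  by apply: flow_le_start; rewrite /= leq_pmull.
rewrite muln0 expr0 invr1 mulr1 in h2.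
rewrite addrAC -addrA addrA; rewrite -!addrA lerD // addrC.
Qed.

(** The chain starts at the larger of [size Q] and [n1]. At level [j = size Q] the mass is at most
    [p^-j M^-(D j) = q^-j]; for shorter [Q] the trivial bound at level [n1] costs the constant
    [p^-n1 q^n1]. *)
Lemma regular_flow N u Q : (n1 <= N)%N -> (size Q <= N)%N ->
  (forall j, (u j < 2 * b0 * M ^ (L * N))%N) -> regular N u ->
  flow p (W N (L * N) u) x Q N <=
   expR geom * (p ^- n1 * q ^+ n1 + 3 * geom) * (r ^+ size Q / q ^+ size Q).
Proof.
move=> nN QN hu reg; set j := size Q in QN *; pose n := maxn j n1.
have rp e : 0 < r ^+ e by rewrite exprn_gt0.
have qp e : 0 < q ^+ e by rewrite exprn_gt0.
have qn e : 1 <= q ^+ e by rewrite exprn_ege1 // ltW.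
have pe e : 1 <= p ^- e by rewrite invf_ge1 ?exprn_gt0 // exprn_ile1 // ltW.
have n1n : (n1 <= n <= N)%N by rewrite leq_maxr geq_max QN nN.
apply: le_trans (flow_chain n1n (leq_maxl _ _) hu) _.
rewrite -[leRHS]mulrA ler_pM2l ?expR_gt0 // -/j.
have G1 := geom_ge1; have G0 : 0 < geom := lt_le_trans ltr01 G1.
have rj : 1 <= r ^+ j by rewrite exprn_ege1 // ltW.
have st : flow p (W n (L * N) u) x Q n <= p ^- n1 * q ^+ n1 * (r ^+ j / q ^+ j).
  apply: (@le_trans _ _ (p ^- n1 * q ^+ n1 * (1 / q ^+ j))); last first.
    by rewrite ler_pM2l ?mulr_gt0 ?invr_gt0 ?exprn_gt0 // ler_pM2r ?invr_gt0.
  have [jn|jn] := leqP j n1.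
    have -> : n = n1 by apply/maxn_idPr.
    have h : flow p (W n1 (L * N) u) x Q n1 <= p ^- n1 * Mr ^- (D * j).
      by apply: flow_le_start; rewrite jn leq_pmull.
    apply: le_trans h _; rewrite -mulrA ler_pM2l ?invr_gt0 ?exprn_gt0 // div1r.
    apply: (@le_trans _ _ 1).
      by rewrite invf_le1 // exprn_ege1 // ler1n.
    by rewrite ler_pdivlMr // mul1r ler_weXn2l // ltW.
  have -> : n = j by apply/maxn_idPl; exact: ltnW.
  have h : flow p (W j (L * N) u) x Q j <= p ^- j * Mr ^- (D * j).
    by apply: flow_le_start; rewrite leqnn leq_pmull.
  apply: le_trans h _; rewrite -invfM exprM -exprMn div1r ler_peMl ?invr_ge0 ?(ltW (qp _)) //.
  exact: mulr_ege1.
have er : \sum_(n <= i < N) err i (L * N) u <= geom * (r ^+ j / q ^+ j).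
  apply: (@le_trans _ _ (\sum_(n <= i < N) q ^- j * r ^- i)).
    apply: ler_sum_nat => i /andP[ni iN]; apply: le_trans (reg i _) _.
      by rewrite iN andbT; apply: leq_trans ni; rewrite leq_maxr.
    rewrite exprMn invfM ler_pM2r ?invr_gt0 // lef_pV2 ?posrE //.
    by rewrite ler_weXn2l ?(ltW q1) //; apply: leq_trans ni; rewrite leq_maxl.
  rewrite -big_distrr /=; apply: (@le_trans _ _ (q ^- j * geom)).
    rewrite ler_pM2l ?invr_gt0 //; apply: le_trans (sum_rV _ _) _.
    by rewrite ler_piMl ?rV_le1 // ltW.
  by rewrite mulrC ler_pM2l // ler_peMl // invr_ge0 ltW.
move: (r ^+ j / q ^+ j) st er => a st er.
have -> : (p ^- n1 * q ^+ n1 + 3 * geom) * a = p ^- n1 * q ^+ n1 * a + geom * a + 2 * geom * a by ring.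
by rewrite lerD2r lerD.
Qed.

Definition irregular_const : R :=
  expR geom * (2 + 2 * geom) * (2 * k%:R * (2 * b0%:R) ^+ k.-1 * (2 * slack R d b0 + 1)) * 2.

(** Each of [1/p], [q] and [r] is at most [M^D], so the left side is at most [M^(4 D + 1 - L)]. This
    is the origin of [4 d + 2]. *)
Lemma irregular_decay : p ^- 1 * p ^- 1 * q * r * Mr * Mr ^- L <= Mr^-1.
Proof.
have Mge e f : (e <= f)%N -> Mr ^+ e <= Mr ^+ f by move=> ef; rewrite ler_weXn2l ?ler1n.
have pM : p ^- 1 <= Mr ^+ D.
  by rewrite expr1 -[leLHS]mul1r ler_pdivrMr // mulrC ltW.
have qM : q <= Mr ^+ D by rewrite ler_piMl ?(ltW (Mp _)).
have rM : r <= Mr ^+ D by apply: le_trans qM.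
rewrite ler_pdivrMr // ler_pdivlMl ?ltr0n //.
apply: (@le_trans _ _ (Mr ^+ 1 * (Mr ^+ D * Mr ^+ D * Mr ^+ D * Mr ^+ D * Mr ^+ 1))).
  rewrite expr1 ler_pM2l ?ltr0n // ler_pM2r ?ltr0n //.
  by rewrite !ler_pM // ?mulr_ge0 ?invr_ge0 ?exprn_ge0 // ltW.
rewrite -!exprD; apply/Mge/(leq_trans _ Ld); have := leq_subr k d.
by move: (d - k)%N => e; clear; lia.
Qed.

(** Chebyshev's idea: for an irregular fibre the sum of [(q r)^i err i] is at least 1, so
    multiplying the constant term of [root_flow] by it makes the bound linear in the errors, whose
    averages are known. What remains at level [i] is of order [M^-i], and the sum starts at [n1]. *)
Lemma irregular_mass N : (n1 <= N)%N ->
  Mr ^- (L * N * k) * \sum_(u : {ffun 'I_k -> 'I_(2 * b0 * M ^ (L * N))} | ~~ `[< regular N (fun j => u j) >])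
     flow p (W N (L * N) (fun j => u j)) x [::] N <= irregular_const * Mr ^- n1.
Proof.
move=> nN; set m := (2 * b0 * M ^ (L * N))%N.
have G1 := geom_ge1; have G0 : 0 < geom := lt_le_trans ltr01 G1.
have qr1 i : 1 <= (q * r) ^+ i by rewrite exprn_ege1 // mulr_ege1 // ltW.
have pe e : 1 <= p ^- e by rewrite invf_ge1 ?exprn_gt0 // exprn_ile1 // ltW.
have MH : 0 < Mr ^- (L * N * k) by rewrite invr_gt0.
pose A := 2 * k%:R * (2 * b0%:R) ^+ k.-1 * (2 * slack R d b0 + 1).
have sl := slack_gt0 R d b0.
have A0 : 0 <= A by rewrite /A !mulr_ge0 ?exprn_ge0 ?addr_ge0 ?mulr_ge0 ?(ltW sl).
pose co i := expR geom * (2 + 2 * geom) * (p ^- i * (q * r) ^+ i).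
have co0 i : 0 <= co i.
  apply: mulr_ge0; first by rewrite mulr_ge0 ?expR_ge0 // addr_ge0 // mulr_ge0 // ltW.
  by rewrite mulr_ge0 // (le_trans ler01).
have point (u : {ffun 'I_k -> 'I_m}) : ~~ `[< regular N (fun j => u j) >] ->
    flow p (W N (L * N) (fun j => u j)) x [::] N <=
    \sum_(n1 <= i < N) co i * err i (L * N) (fun j => u j).
  move=> /asboolPn hreg; have hu j : (u j < m)%N by [].
  apply: le_trans (root_flow nN hu) _.
  have [i hi] : exists i, (n1 <= i < N)%N /\ (q * r) ^- i < err i (L * N) (fun j => u j).
    apply: contrapT => hn; apply: hreg => i hi; rewrite leNgt; apply/negP => h.
    by apply: hn; exists i.
  have S1 : 1 <= \sum_(n1 <= i < N) (q * r) ^+ i * err i (L * N) (fun j => u j).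
    case: hi => /andP[h1 h2] h3; rewrite (bigD1_seq i) ?mem_index_iota ?iota_uniq ?h1 //=.
    rewrite -[leLHS]addr0 lerD //.
      by rewrite mulrC -ler_pdivrMr ?(lt_le_trans ltr01 (qr1 i)) // div1r ltW.
    by apply: sumr_ge0 => l _; rewrite mulr_ge0 ?flow_err_ge0 // (le_trans ler01).
  apply: (@le_trans _ _ (expR geom * (p ^- n1 + 2 * geom) *
       (\sum_(n1 <= i < N) (q * r) ^+ i * err i (L * N) (fun j => u j)) +
      expR geom * \sum_(n1 <= i < N) err i (L * N) (fun j => u j))).
    rewrite lerD2r ler_peMr // mulr_ge0 ?expR_ge0 // addr_ge0 ?(le_trans ler01 (pe _)) //.
    by rewrite mulr_ge0 // ltW.
  rewrite !big_distrr /= -big_split /=; apply: ler_sum_nat => l /andP[n1l lN].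
  have e0 := flow_err_ge0 M b0 L C p0 l (L * N) (fun j => u j).
  have pn : p ^- n1 <= p ^- l.
    by rewrite lef_pV2 ?posrE ?exprn_gt0 // ler_wiXn2l // ltW.
  have h1 := qr1 l; have h2 := pe l; have h3 := pe n1; rewrite /co.
  move: (err l _ _) e0 => ee e0; have := expR_gt0 geom; move: (expR geom) => EG EG0.
  move: (p ^- n1) (p ^- l) ((q * r) ^+ l) pn h1 h2 h3 => a b c ab c1 b1 a1.
  have t1 : (a + 2 * geom) * c <= (b + 2 * geom * b) * c.
    by rewrite ler_pM2r ?(lt_le_trans ltr01) // lerD // ler_peMr // mulr_ge0 // ltW.
  have t2 : 1 <= b * c by rewrite mulr_ege1.
  have -> : EG * (a + 2 * geom) * (c * ee) + EG * ee = EG * ((a + 2 * geom) * c + 1) * ee by ring.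
  rewrite ler_wpM2r // -mulrA ler_pM2l //.
  have -> : (2 + 2 * geom) * (b * c) = (b + 2 * geom * b) * c + b * c by ring.
  by rewrite lerD.
apply: (@le_trans _ _ (\sum_(n1 <= i < N) expR geom * (2 + 2 * geom) * A * Mr ^- i)).
  apply: (@le_trans _ _ (Mr ^- (L * N * k) * \sum_(n1 <= i < N) co i *
      \sum_(u : {ffun 'I_k -> 'I_m}) err i (L * N) (fun j => u j))).
    rewrite ler_pM2l //; under [leRHS]eq_bigr do rewrite big_distrr /=.
    rewrite exchange_big /= big_mkcond; apply: ler_sum => u _.
    case: ifP => [/point //|_]; apply: sumr_ge0 => i _; rewrite mulr_ge0 // flow_err_ge0 //.
  rewrite big_distrr /=; apply: ler_sum_nat => i /andP[n1i iN].
  have iN' : (L * i <= L * N)%N by rewrite leq_mul2l (ltnW iN) orbT.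
  have h := @sum_flow_err R d k M M0 b0 L C p p0 i (L * N) m iN'.
  apply: (@le_trans _ _ (Mr ^- (L * N * k) * (co i * (p ^- i * (A * Mr ^+ i * Mr ^- (L * i) * Mr ^+ (L * N * k)))))).
    rewrite ler_pM2l // ler_wpM2l //; apply: le_trans h _.
    rewrite ler_pM2l ?invr_gt0 ?exprn_gt0 //.
    have e1 : m%:R ^+ k.-1 = (2 * b0%:R) ^+ k.-1 * Mr ^+ (L * N * k.-1) :> R.
      by rewrite /m !natrM natrX exprMn -exprM.
    have e2 : Mr ^+ (L * N * k) = Mr ^+ (L * N * k.-1) * Mr ^+ (L * N).
      by rewrite -exprD -mulnSr prednK.
    have e3 : Mr ^+ (L * N) = Mr ^+ (L * N - L * i) * Mr ^+ (L * i) by rewrite -exprD subnK.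
    have t1 : ((M ^ i).+1%:R : R) <= 2 * Mr ^+ i.
      by rewrite -natrX -natrM ler_nat mul2n -addnn -addn1 leq_add2l expn_gt0 M0.
    have t2 : 2 * slack R d b0 * Mr ^+ (L * N - L * i) + 1 <= (2 * slack R d b0 + 1) * Mr ^+ (L * N - L * i).
      by rewrite [leRHS]mulrDl mul1r lerD2l exprn_ege1 // ler1n.
    have T : A * Mr ^+ i * Mr ^- (L * i) * Mr ^+ (L * N * k) =
      k%:R * (2 * Mr ^+ i * (m%:R ^+ k.-1 * ((2 * slack R d b0 + 1) * Mr ^+ (L * N - L * i)))).
      rewrite e2 e1 e3 /A; have := gt_eqF (Mp (L * i)).
      move: (Mr ^+ (L * i)) => y /negbT y0; by field.
    rewrite T ler_wpM2l // ler_pM //.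
      by rewrite mulr_ge0 ?exprn_ge0 // addr_ge0 // !mulr_ge0 // ?(ltW sl) // ltW.
    by rewrite ler_wpM2l ?exprn_ge0.
  have := irregular_decay; rewrite expr1 => dc.
  have dc' : (p^-1 * p^-1 * q * r * Mr * Mr ^- L) ^+ i <= Mr ^- i.
    rewrite -[Mr ^- i]exprVn lerXn2r ?nnegrE ?invr_ge0 //.
    by rewrite !mulr_ge0 ?invr_ge0 // ?ltW // ?exprn_gt0.
  rewrite /co.
  have -> : Mr ^- (L * N * k) * (expR geom * (2 + 2 * geom) * (p ^- i * (q * r) ^+ i) *
     (p ^- i * (A * Mr ^+ i * Mr ^- (L * i) * Mr ^+ (L * N * k)))) =
     expR geom * (2 + 2 * geom) * A * (p^-1 * p^-1 * q * r * Mr * Mr ^- L) ^+ i.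
    have -> : (p^-1 * p^-1 * q * r * Mr * Mr ^- L) ^+ i =
        p ^- i * p ^- i * (q * r) ^+ i * Mr ^+ i * Mr ^- (L * i).
      by rewrite !exprMn !exprVn -!exprM !mulrA.
    have := gt_eqF (Mp (L * N * k)).
    move: (Mr ^+ (L * N * k)) (Mr ^- (L * i)) (p ^- i) ((q * r) ^+ i) (Mr ^+ i) => y Li a w Mi /negbT y0.
    by field.
  by rewrite ler_wpM2l // !mulr_ge0 ?expR_ge0 // addr_ge0 // mulr_ge0 // ltW.
rewrite -big_distrr /= /irregular_const -/A -[leRHS]mulrA ler_wpM2l //.
  by rewrite !mulr_ge0 ?expR_ge0 // addr_ge0 // mulr_ge0 // ltW.
under eq_bigr do rewrite -exprVn.
have Mi : 0 <= Mr^-1 < 1 by rewrite invr_ge0 ler0n invf_lt1 ?ltr0n // ltr1n.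
apply: le_trans (sum_geometric_le n1 N Mi) _; rewrite exprVn mulrC ler_pM2r ?invr_gt0 //.
have M2 : Mr^-1 <= 2^-1 by rewrite lef_pV2 ?posrE ?ltr0n // ler_nat.
rewrite -[leRHS]invrK lef_pV2 ?posrE //; first by lra.
by move/andP: Mi => [_]; rewrite subr_gt0.
Qed.

End Regular.

(** * Finite nets of fibres *)

Section NetFlows.
Variables (R : realType) (d k M L : nat) (p r : R).
Hypotheses (M1 : (1 < M)%N) (p0 : 0 < p) (p1 : p <= 1) (r1 : 1 < r).
Hypothesis L0 : (0 < L)%N.
Hypothesis rq : r ^+ 3 <= p * M%:R ^+ (d - k).
Local Notation word := (seq (digit d M)).
Let M0 : (0 < M)%N := ltnW M1.

(** Letting [b0] go up to [M^n] gives one null set for all planes: every plane has some [b0] and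
    enters the nets from some level on. *)
Definition net_flows (x : word -> bool) n1 := forall n b0 (sg : 'I_k -> 'I_d) C H u,
  (n1 <= n)%N -> (b0 <= M ^ n)%N -> injective sg ->
  (forall l j, `|C l j| <= b0%:R :> R) -> (L * n.+1 <= H)%N ->
  (forall j, (u j < 2 * b0 * M ^ H)%N) ->
  flow_steps (d - k) p r (net_weight sg b0 L C n.+1 H u) x n.

Definition grid n := (2 * M ^ (n + L * n.+1))%N.
Definition net n : finType := ('I_(M ^ n).+1 * {ffun 'I_k -> 'I_d} *
  {ffun 'I_d * 'I_k -> 'I_(grid n).+1} * {ffun 'I_k -> 'I_(grid n).+1})%type.

(** The index type contains all maps as pivot choices; those that are not injective get the zero
    weight, which is a net for trivial reasons. *)
Definition net_fun n (t : net n) : word -> R :=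
  let: (b, sg, c, u) := t in
  if injectiveb sg then
    weight sg (L * n.+1) (@pivot_pt R d k M b (L * n.+1)%N (fun j => u j) (fun l j => c (l, j)))
  else fun=> 0.

Lemma net_fun_is_net n t : is_net (d - k) (@net_fun n t) n.
Proof.
case: t => [[[b sg] c] u] /=; case: injectiveP => [sgI|_].
  by apply: weight_is_net => //; rewrite (leq_trans _ (leq_pmull _ L0)).
by split=> // e _; rewrite ?invr_ge0 ?exprn_ge0 // big1.
Qed.

Lemma card_net n : (#|net n| <= (2 * d ^ k * (3 * M ^ L) ^ (d * k) * (3 * M ^ L) ^ k) *
  (M * (M ^ L.+1) ^ (d * k) * (M ^ L.+1) ^ k) ^ n)%N.
Proof.
rewrite !card_prod !card_ffun card_prod !card_ord.
have Mn m : (0 < M ^ m)%N by rewrite expn_gt0 M0.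
have h1 : ((M ^ n).+1 <= 2 * M ^ n)%N by have := Mn n; lia.
have h2 : ((grid n).+1 <= 3 * M ^ L * (M ^ L.+1) ^ n)%N.
  have -> : (3 * M ^ L * (M ^ L.+1) ^ n = 3 * M ^ (n + L * n.+1))%N.
    by rewrite -mulnA -expnM -expnD; congr (_ * M ^ _)%N; lia.
  by rewrite /grid; have := Mn (n + L * n.+1)%N; lia.
have h3 e : ((grid n).+1 ^ e <= (3 * M ^ L) ^ e * ((M ^ L.+1) ^ e) ^ n)%N.
  by rewrite -(expnM _ e) mulnC [(e * n)%N]mulnC expnM mulnC -expnMn; case: e => // e; rewrite leq_exp2r.
have := leq_mul (leq_mul (leq_mul h1 (leqnn (d ^ k))) (h3 (d * k)%N)) (h3 k).
rewrite !expnMn; move: (M ^ n)%N ((M ^ L.+1) ^ (d * k))%N ((M ^ L.+1) ^ k)%N => a b c.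
move=> h; apply: leq_trans h _; rewrite leq_eqVlt; apply/orP; left; apply/eqP.
by move: ((_ ^ n)%N) => b'; ring.
Qed.

Variables (dO : measure_display) (Omega : measurableType dO) (P : probability Omega R).
Variable (X : Omega -> word -> bool).
Hypothesis mX : forall s, measurable [set w | X w s].
Hypothesis indX : forall F : seq word, uniq F -> all (fun s => (0 < size s)%N) F ->
     P (\big[setI/setT]_(s <- F) [set w | X w s]) = (p ^+ size F)%:E.

Lemma ae_net_flows : P.-negligible [set w | ~ exists n1, net_flows (X w) n1].
Proof.
apply: negligibleS (ae_flow_steps M0 p0 p1 r1 rq mX indX card_net net_fun_is_net) => w /= hw h.
apply: hw; case: h => N hN; exists N => n b0 sg C H u Nn bn sgI hC nH hu.
have Mn m : (0 < M ^ m)%N by rewrite expn_gt0 M0.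
have bm : (2 * b0 * M ^ (L * n.+1) <= grid n)%N.
  by rewrite /grid -mulnA leq_mul2l /= expnD leq_mul2r bn orbT.
have ru j : (round_u M L n.+1 H u j < (grid n).+1)%N.
  rewrite ltnS (leq_trans _ bm) // ltnW // /round_u ltn_divLR //.
  by rewrite -mulnA -expnD subnKC.
have rC l j : (round_C M b0 L C n.+1 l j < (grid n).+1)%N.
  rewrite ltnS (leq_trans _ bm) // /round_C -(natrK (R := R) (2 * b0 * M ^ (L * n.+1))%N).
  apply: le_truncn; rewrite natrM natrX ler_wpM2r ?exprn_ge0 //.
  have := hC l j; rewrite ler_norml natrM => /andP[_]; lra.
have bb : (b0 < (M ^ n).+1)%N by [].
(* Once rounded, admissible data coincide with a member of the net exactly, not just
   approximately. *)
have -> : net_weight sg b0 L C n.+1 H u = @net_fun n (Ordinal bb, finfun sg,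
   [ffun lj => Ordinal (rC lj.1 lj.2)], [ffun j => Ordinal (ru j)]).
  rewrite /net_fun; have -> : injectiveb (finfun sg).
    by apply/injectiveP => a b; rewrite !ffunE; exact: sgI.
  rewrite /net_weight; have -> : (finfun sg : 'I_k -> 'I_d) = sg by apply/funext => j; rewrite ffunE.
  congr (weight sg _ (pivot_pt _ _ _ _ _)).
    by apply/funext => j; rewrite ffunE.
  by apply/funext => l; apply/funext => j; rewrite ffunE.
exact: hN.
Qed.

End NetFlows.

Section PopBound.
Variables (R : realType) (d M : nat) (p r : R).
Hypotheses (M0 : (0 < M)%N) (p0 : 0 < p) (p1 : p <= 1) (r1 : 1 < r).
Hypothesis rL : r ^+ 3 <= p * M%:R ^+ d.
Local Notation word := (seq (digit d M)).
Local Notation Lam := (p * M%:R ^+ d).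
Variables (dO : measure_display) (Omega : measurableType dO) (P : probability Omega R).
Variable (X : Omega -> word -> bool).
Hypothesis mX : forall s, measurable [set w | X w s].
Hypothesis indX : forall F : seq word, uniq F -> all (fun s => (0 < size s)%N) F ->
     P (\big[setI/setT]_(s <- F) [set w | X w s]) = (p ^+ size F)%:E.

(** The fibre estimate with [D = d]: for the uniform weight [M^-(d n)], the only member of its net,
    the flow from the root is [pop / Lam^n]. *)
Lemma ae_pop_bounded : P.-negligible [set w | ~ exists K : R,
  forall n, (pop (X w) n)%:R <= K * Lam ^+ n].
Proof.
pose W (n : nat) (t : unit) (c : word) : R := M%:R ^- (d * size c).
have Mp e : (0 : R) < M%:R ^+ e by rewrite exprn_gt0 // ltr0n.
have W0 c : 0 <= (M%:R : R) ^- c by rewrite invr_ge0 ltW.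
have nW n t : is_net d (W n t) n.
  split=> [c|c cn|c cn]; rewrite /W ?cn //.
  under eq_bigr do rewrite size_rcons cn.
  rewrite sumr_const card_digit -[RHS]mulr_natr natrX mulnS exprD invfM [RHS]mulrC mulVKf //.
  by rewrite gt_eqF.
have cU n : (#|{: unit}| <= 1 * 1 ^ n)%N by rewrite card_unit exp1n.
apply: negligibleS (ae_flow_steps M0 p0 p1 r1 rL mX indX cU nW) => w /= hw h.
apply: hw; case: h => N hN.
have L1 : 1 <= Lam by apply: le_trans rL; rewrite exprn_ege1 // ltW.
have L0 e : 0 < Lam ^+ e by rewrite exprn_gt0 // (lt_le_trans ltr01).
have fE n : flow p (W n tt) (X w) [::] n = (pop (X w) n)%:R / Lam ^+ n.
  rewrite /flow; have -> : \sum_(c <- words d M n | take (size (nil : word)) c == [::]) W n tt c * (retained (X w) c)%:R =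
      (M%:R ^+ d) ^- n * (pop (X w) n)%:R.
    rewrite big_mkcond popE big_distrr /=; apply: eq_big_seq => c /size_in_words cn.
    by rewrite take0 eqxx /W cn exprM.
  by rewrite exprMn invfM mulrA mulrC.
have rp e : 0 <= r ^- e by rewrite invr_ge0 exprn_ge0 // ltW // (lt_trans ltr01).
have W00 c : 0 <= W 0%N tt c by exact: W0.
pose K1 := expR (geom r) * (flow p (W N tt) (X w) [::] N + 2 * geom r).
have HK n : (N <= n)%N -> (pop (X w) n)%:R <= K1 * Lam ^+ n.
  move=> Nn; rewrite -ler_pdivrMr // -fE.
  have := @grow_chain R (fun i => flow p (W i tt) (X w) [::] i) (fun i => r ^- i) (fun=> 0)
     (fun i => 2 * r ^- i) N n Nn _ _ _ _ _.
  move=> h; apply: le_trans (h _ _ _ _ _) _ => {h} //.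
  - by move=> i; apply: flow_ge0.
  - by move=> i; rewrite mulr_ge0.
  - move=> i /andP[Ni _]; have := hN i Ni tt [::] isT.
    by rewrite /= subn0 muln0 !expr0 !mulr1 addr0.
  have gr := sum_rV r1 N n; have G1 := geom_ge1 r1.
  have gs : \sum_(N <= i < n) r ^- i <= geom r.
    by apply: le_trans gr _; rewrite ler_piMl ?rV_le1 // (le_trans ler01).
  apply: ler_pM; rewrite ?expR_ge0 ?ler_expR //.
    by rewrite addr_ge0 ?flow_ge0 // sumr_ge0 // => i _; rewrite add0r mulr_ge0.
  rewrite lerD2l; under eq_bigr do rewrite add0r.
  by rewrite -big_distrr /= ler_pM2l.
exists (K1 + \sum_(0 <= n < N) (pop (X w) n)%:R) => n.
have K10 : 0 <= K1.
  by rewrite mulr_ge0 ?expR_ge0 // addr_ge0 ?flow_ge0 // mulr_ge0 // (le_trans ler01) // geom_ge1.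
have [Nn|nN] := leqP N n.
  by apply: le_trans (HK n Nn) _; rewrite ler_pM2r // lerDl sumr_ge0.
rewrite -[leLHS]mulr1; apply: ler_pM => //; last by rewrite exprn_ege1.
rewrite (bigD1_seq n) ?mem_index_iota ?iota_uniq //= addrCA lerDl addr_ge0 // sumr_ge0 //.
Qed.

End PopBound.

(** * Compactness and lattice counting *)

Section Geometry.
Variable R : realType.

Lemma archi_inv (e : R) : 0 < e -> exists n, forall m, (n <= m)%N -> m.+1%:R^-1 < e.
Proof.
move=> e0; exists (Num.truncn e^-1).+1 => m nm.
rewrite invf_plt ?posrE ?ltr0n //; apply: lt_trans (truncnS_gt _) _.
by rewrite ltr_nat.
Qed.

(** Bolzano-Weierstrass with an explicit rate; [m <= f m] stands in for a subsequence. *)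
Lemma cluster_seq n (v : nat -> 'rV[R]_n) (b : R) :
  (forall i j, - b <= v i ord0 j <= b) -> exists (v' : 'rV[R]_n) (f : nat -> nat),
  forall m, (m <= f m)%N /\ forall j, `|v (f m) ord0 j - v' ord0 j| < m.+1%:R^-1.
Proof.
move=> hv.
have cA := @rV_compact R n (fun=> `[- b, b]%classic) (fun=> @segment_compact R (- b) b).
have FF : ProperFilter (v @ \oo) by exact: fmap_proper_filter.
have FA : (v @ \oo) [set w : 'rV[R]_n | forall j, `[- b, b]%classic (w ord0 j)].
  by exists 0%N => // i _ j /=; rewrite in_itv /= hv.
have [v' [_ clv]] := cA _ FF FA; exists v'.
have key m : exists i, (m <= i)%N /\ forall j, `|v i ord0 j - v' ord0 j| < m.+1%:R^-1.
  have Fm : (v @ \oo) [set w | exists2 i, (m <= i)%N & w = v i].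
    by exists m => // i /= mi; exists i.
  have e0 : 0 < (m.+1%:R^-1 : R) by rewrite invr_gt0 ltr0n.
  have [w [[i mi ->] hb]] := clv _ _ Fm (nbhsx_ballx v' (m.+1%:R^-1) e0).
  exists i; split => // j; have := hb.2 ord0 j.
  by rewrite /ball /= distrC.
have [f hf] := choice key; by exists f.
Qed.

Variables d M : nat.
Hypothesis M0 : (0 < M)%N.
Local Notation word := (seq (digit d M)).

Lemma cube_take (c : word) n (y : 'rV[R]_d) : (n <= size c)%N ->
  cube c y -> cube (take n c) y.
Proof.
move=> nc; rewrite !cubeE // => h i /=; have /andP[h1 h2] := h i.
rewrite idx_take // size_takel //.
have Mp e : 0 < (M%:R : R) ^+ e by rewrite exprn_gt0 // ltr0n.
have := floor_div R M0 (idx c i) n (size c - n); rewrite subnKC // => /andP[f1 _].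
rewrite subr_ge0 in f1; apply/andP; split; first exact: le_trans f1 h1.
apply: le_trans h2 _.
rewrite ler_pdivrMr // mulrAC ler_pdivlMr // -!natrX -!natrM ler_nat.
have -> : (M ^ size c = M ^ (size c - n) * M ^ n)%N by rewrite -expnD subnK.
by rewrite mulnA leq_mul2r ltn_ceil ?orbT // expn_gt0 M0.
Qed.

Lemma closed_cube (c : word) : closed (@cube R d M c).
Proof.
rewrite cubeE //; apply: compact_closed; first exact: norm_hausdorff.
rewrite (_ : [set _ | _] = [set v : 'rV[R]_d | forall i : 'I_d,
  `[(idx c i)%:R / M%:R ^+ size c, (idx c i).+1%:R / M%:R ^+ size c]%classic (v ord0 i)]).
  apply: (@rV_compact R d (fun i => `[(idx c i)%:R / M%:R ^+ size c,
    (idx c i).+1%:R / M%:R ^+ size c]%classic)) => i; exact: segment_compact.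
by apply/seteqP; split => v /= h i; have := h i; rewrite in_itv.
Qed.

Lemma closed_Kn (x : word -> bool) n : closed (@Kn R d M x n).
Proof.
rewrite /Kn (_ : [set s | _] = [set` [seq s <- words d M n | retained x s]]).
  by apply: closed_bigcup => [|s _]; [exact: finite_seq|exact: closed_cube].
apply/seteqP; split => s /=; rewrite mem_filter mem_words.
  by move=> [/eqP -> ->].
by move=> /andP[-> /eqP].
Qed.

(** Each [Kn] is closed, as a finite union of closed cubes, and contains [y m] once [m >= n],
    through the prefix of length [n] of [c m]. *)
Lemma limit_mandelbrot (x : word -> bool) (c : nat -> word) (y : nat -> 'rV[R]_d) (y' : 'rV[R]_d) :
  (forall m, (m <= size (c m))%N) -> (forall m, retained x (c m)) ->
  (forall m, cube (c m) (y m)) ->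
  (forall m i, `|y m ord0 i - y' ord0 i| < m.+1%:R^-1) -> mandelbrot x y'.
Proof.
move=> sc rc yc yy n _; apply: closed_Kn => B /nbhs_ballP[e /= e0 eB].
have [m0 hm0] := archi_inv e0; pose m := maxn m0 n.
exists (y m); split.
  have nm : (n <= size (c m))%N by rewrite (leq_trans _ (sc m)) // leq_maxr.
  exists (take n (c m)) => /=; last exact: cube_take.
  by rewrite size_takel // retained_take.
apply: eB; split; first exact: e0.
by move=> i j; rewrite (ord1 i) /ball /= distrC (lt_trans (yy m j)) // hm0 // leq_maxl.
Qed.

End Geometry.

Section AffineCount.
Variables (R : realType) (k M : nat) (A : 'M[R]_k).
Hypotheses (M0 : (0 < M)%N) (uA : A \in unitmx).
Local Notation Mr := (M%:R : R).

(** The point over which the fibre with grid parameter [u] lies: pivot parameters form a cubic grid,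
    and [A] carries them to the frame coordinates of the projection. *)
Definition grid_pt H (b0 : nat) (u : 'I_k -> nat) : 'rV[R]_k :=
  \row_j ((u j)%:R / Mr ^+ H - b0%:R) *m A.

Definition inv_norm : R := \sum_i \sum_j `|invmx A i j|.

Lemma grid_pt_inj H b0 (u v : 'I_k -> nat) :
  (forall i, `|grid_pt H b0 u ord0 i - grid_pt H b0 v ord0 i| <= Mr ^- H) ->
  forall j, `|(u j)%:R - (v j)%:R| <= inv_norm.
Proof.
move=> h j; have MH : 0 < Mr ^+ H by rewrite exprn_gt0 // ltr0n.
have E : (u j)%:R / Mr ^+ H - (v j)%:R / Mr ^+ H =
    \sum_i (grid_pt H b0 u ord0 i - grid_pt H b0 v ord0 i) * invmx A i j.
  have := congr1 (fun Z : 'rV[R]_k => Z ord0 j) (mulmxBl (grid_pt H b0 u) (grid_pt H b0 v) (invmx A)).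
  rewrite /grid_pt !mulmxK // !mxE => e.
  transitivity ((u j)%:R / Mr ^+ H - b0%:R - ((v j)%:R / Mr ^+ H - b0%:R)); first by ring.
  by rewrite -e; apply: eq_bigr => i _; rewrite !mxE.
have -> : (u j)%:R - (v j)%:R = Mr ^+ H * ((u j)%:R / Mr ^+ H - (v j)%:R / Mr ^+ H).
  by rewrite mulrBr ![Mr ^+ H * _]mulrC !mulfVK // gt_eqF.
rewrite normrM (gtr0_norm MH) E mulrC -ler_pdivlMr //.
apply: le_trans (ler_norm_sum _ _ _) _; rewrite /inv_norm mulr_suml.
apply: ler_sum => i _; rewrite normrM mulrC ler_pM //.
by rewrite (bigD1 j) //= lerDl sumr_ge0.
Qed.

(** The box is cut into cubes of side [M^-H]. Parameters of two grid points in one cube differ by at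
    most [inv_norm], so a cube holds at most [(2 inv_norm + 1)^k] of them. The added [M^-H] accounts
    for incomplete cubes at the boundary. *)
Lemma count_affine (H m b0 : nat) (a b : 'rV[R]_k) : (forall i, a ord0 i <= b ord0 i) ->
  \sum_(u : {ffun 'I_k -> 'I_m})
    [forall i, (a ord0 i <= grid_pt H b0 (fun j => u j) ord0 i) &&
               (grid_pt H b0 (fun j => u j) ord0 i <= b ord0 i)]%:R <=
  (2 * inv_norm + 1) ^+ k * (Mr ^+ (H * k) * \prod_i (b ord0 i - a ord0 i + Mr ^- H)).
Proof.
move=> ab; have MH : 0 < Mr ^+ H by rewrite exprn_gt0 // ltr0n.
have I0 : 0 <= inv_norm by apply: sumr_ge0 => i _; apply: sumr_ge0.
pose pt (u : {ffun 'I_k -> 'I_m}) i := grid_pt H b0 (fun j => u j) ord0 i.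
pose Z := (\max_i Num.truncn ((b ord0 i - a ord0 i) * Mr ^+ H)).+1.
pose S (v : {ffun 'I_k -> 'I_Z}) (u : {ffun 'I_k -> 'I_m}) := [forall i,
  (a ord0 i + (v i)%:R / Mr ^+ H <= pt u i) && (pt u i < a ord0 i + (v i).+1%:R / Mr ^+ H)].
pose V (v : {ffun 'I_k -> 'I_Z}) := [forall i, ((v i)%:R <= (b ord0 i - a ord0 i) * Mr ^+ H)%R].
have S_le v : \sum_u (S v u)%:R <= (2 * inv_norm + 1) ^+ k.
  have [[u0 Su0]|none] := pselect (exists u0, S v u0); last first.
    rewrite big1 ?exprn_ge0 ?addr_ge0 ?mulr_ge0 // => u _.
    by case Su: (S v u) => //; case: none; exists u.
  pose F j (w : 'I_m) : R := (((u0 j)%:R - inv_norm <= w%:R) && (w%:R <= (u0 j)%:R - inv_norm + 2 * inv_norm))%R%:R.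
  apply: (@le_trans _ _ (\sum_(u : {ffun 'I_k -> 'I_m}) \prod_j F j (u j))).
    apply: ler_sum => u _; case Su: (S v u); last by rewrite prodr_ge0.
    suff h j : F j (u j) = 1 by rewrite big1.
    have hh : `|(u j)%:R - (u0 j)%:R| <= inv_norm.
      apply: (@grid_pt_inj H b0 (fun j => u j) (fun j => u0 j)) => i.
      have /andP[s1 s2] := forallP Su i; have /andP[s3 s4] := forallP Su0 i.
      rewrite -/(pt u i) -/(pt u0 i); rewrite -natr1 mulrDl mul1r in s2; rewrite -natr1 mulrDl mul1r in s4.
      by rewrite ler_norml; apply/andP; split; lra.
    move: hh; rewrite ler_norml /F => /andP[h1 h2].
    have -> : (u0 j)%:R - inv_norm <= (u j)%:R by lra.
    by have -> : (u j)%:R <= (u0 j)%:R - inv_norm + 2 * inv_norm by lra.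
  rewrite sum_ffun_prod -[k in leRHS]card_ord -prodr_const; apply: ler_prod => j _.
  rewrite sumr_ge0 //=; apply: count_itv_le; rewrite mulr_ge0 //.
apply: (@le_trans _ _ (\sum_u \sum_(v : {ffun 'I_k -> 'I_Z}) (V v)%:R * (S v u)%:R)).
  apply: ler_sum => u _; case: forallP => [hu|_]; last by apply: sumr_ge0 => v _; rewrite mulr_ge0.
  pose w i := Num.truncn ((pt u i - a ord0 i) * Mr ^+ H).
  have w0 i : 0 <= (pt u i - a ord0 i) * Mr ^+ H.
    by have /andP[h1 h2] := hu i; rewrite mulr_ge0 ?(ltW MH) // subr_ge0.
  have wle i : (w i)%:R <= (b ord0 i - a ord0 i) * Mr ^+ H.
    have /andP[h1 _] := truncn_itv (w0 i); apply: le_trans h1 _.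
    by have /andP[_ h2] := hu i; rewrite ler_pM2r // lerD2r.
  have wZ i : (w i < Z)%N.
    rewrite ltnS; apply: leq_trans (leq_bigmax i); rewrite truncn_ge_nat //.
    by rewrite mulr_ge0 ?(ltW MH) // subr_ge0.
  rewrite (bigD1 [ffun i => Ordinal (wZ i)]) //= -[leLHS]addr0 lerD //.
    have -> : V [ffun i => Ordinal (wZ i)] by apply/forallP => i; rewrite ffunE /= wle.
    rewrite mul1r; suff -> : S [ffun i => Ordinal (wZ i)] u by [].
    apply/forallP => i; rewrite ffunE /=; have /andP[h1 h2] := truncn_itv (w0 i).
    by rewrite -lerBrDl ler_pdivrMr // h1 -ltrBlDl ltr_pdivlMr.
  by apply: sumr_ge0 => v _; rewrite mulr_ge0.
rewrite exchange_big /=.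
apply: (@le_trans _ _ (\sum_(v : {ffun 'I_k -> 'I_Z}) (V v)%:R * (2 * inv_norm + 1) ^+ k)).
  by apply: ler_sum => v _; rewrite -big_distrr /= ler_wpM2l.
rewrite -big_distrl /= mulrC ler_wpM2l ?exprn_ge0 ?addr_ge0 ?mulr_ge0 //.
pose F i (w : 'I_Z) : R := ((0 <= (w : nat)%:R :> R) && ((w : nat)%:R <= 0 + (b ord0 i - a ord0 i) * Mr ^+ H))%R%:R.
have -> : \sum_(v : {ffun 'I_k -> 'I_Z}) (V v)%:R = \sum_(v : {ffun 'I_k -> 'I_Z}) \prod_i F i (v i).
  apply: eq_bigr => v _; rewrite /V; case: forallP => [h|h].
    by rewrite big1 // => i _; rewrite /F ler0n add0r h.
  have [i hi] : exists i, ~~ ((v i)%:R <= (b ord0 i - a ord0 i) * Mr ^+ H).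
    by apply: contrapT => hn; apply: h => i; apply: contrapT => /negP hj; apply: hn; exists i.
  by rewrite (bigD1 i) //= /F add0r (negPf hi) andbF mul0r.
rewrite sum_ffun_prod exprM.
have -> : Mr ^+ H ^+ k = \prod_(i < k) Mr ^+ H by rewrite prodr_const card_ord.
rewrite -big_split /=.
apply: ler_prod => i _; rewrite sumr_ge0 //=.
apply: le_trans (count_itv_le _ _ _) _; first by rewrite mulr_ge0 ?(ltW MH) // subr_ge0.
by rewrite mulrDr mulfV ?gt_eqF // mulrC.
Qed.

End AffineCount.

(** [B^T] has rank [k], so some [k] of its rows form an invertible [A]. Then [E = B^T A^-1] is the
    identity on these rows, and its other rows are those of [- C]. *)
Lemma pivot (R : realType) (k d : nat) (B : 'M[R]_(k, d)) : orthonormal_frame B ->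
  exists (sg : 'I_k -> 'I_d) (A : 'M[R]_k) (C : 'I_d -> 'I_k -> R),
  [/\ injective sg, A \in unitmx, forall j' j, C (sg j') j = 0 &
   forall y : 'rV[R]_d, y *m B^T =
     \row_j (y ord0 (sg j) - \sum_l y ord0 l * C l j) *m A].
Proof.
move=> BB; have fB : row_full B^T by apply/row_fullP; exists B.
pose sg : 'I_k -> 'I_d := fullrankfun fB; pose A := rowsub sg B^T.
have uA : A \in unitmx by exact: fullrowsub_unit.
have sgI : injective sg by exact: fullrankfun_inj.
pose E := B^T *m invmx A.
have Esg j' j : E (sg j') j = (j' == j)%:R.
  have : rowsub sg E = 1%:M by rewrite /E -mul_rowsub_mx mulmxV.
  by move/matrixP/(_ j' j); rewrite !mxE.
exists sg, A, (fun l j => if l \in codom sg then 0 else - E l j); split => // [j' j|y].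
  by rewrite codom_f.
have -> : y *m B^T = (y *m E) *m A by rewrite /E mulmxA mulmxKV.
congr (_ *m A); apply/rowP => j; rewrite !mxE.
rewrite [LHS](bigD1 (sg j)) //= Esg eqxx mulr1 [X in _ = _ - X](bigD1 (sg j)) //= codom_f mulr0 add0r.
congr (_ + _); rewrite -sumrN; apply: eq_bigr => l lj.
case: ifP => [/codomP[j' e]|_]; last by rewrite mulrN opprK.
rewrite e Esg; case: eqP => [e'|_]; last by rewrite !mulr0 oppr0.
by move: lj; rewrite e e' eqxx.
Qed.

Section FibrePoints.
Variables (R : realType) (d k M : nat).
Hypothesis M0 : (0 < M)%N.
Local Notation word := (seq (digit d M)).
Local Notation Mr := (M%:R : R).
Variables (sg : 'I_k -> 'I_d) (A : 'M[R]_k) (C : 'I_d -> 'I_k -> R) (b0 L : nat).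
Hypothesis sgI : injective sg.
Hypothesis Csg : forall j' j, C (sg j') j = 0.
Hypothesis L0 : (0 < L)%N.
Variable cm : R.
Hypothesis cm0 : 0 <= cm.
Hypothesis hcm : forall l j, `|C l j| <= cm.
(** Makes the parameter range [[-b0, b0)] contain all fibres meeting the unit cube; [cm + 1] instead
    of [cm] leaves room for the rounding of [C]. *)
Hypothesis hb0 : d%:R * (cm + 1) + 1 <= b0%:R.
Hypothesis d0 : (0 < d)%N.

Let Mp e : (0 : R) < Mr ^+ e. Proof. by rewrite exprn_gt0 // ltr0n. Qed.

Lemma entry_le l j : `|C l j| <= b0%:R.
Proof.
have d1 : (1 : R) <= d%:R by rewrite ler1n.
have hb := hb0; have cm0' := cm0; apply: le_trans (hcm l j) _; nra.
Qed.

Definition frame_norm : R := \sum_i \sum_j `|A i j|.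

Lemma frame_norm_ge0 : 0 <= frame_norm.
Proof. by apply: sumr_ge0 => i _; apply: sumr_ge0. Qed.

(** The witness takes its pivot coordinates from the rounded point and its free ones from the corner
    of [z]. As [C] vanishes on pivot rows, its projection is the grid point up to the rounding
    error. *)
Lemma hit_point N u (z c : word) : size z = (L * N)%N -> size c = N ->
  hit sg (round_pt b0 L C N (L * N) u z) z c ->
  exists2 y : 'rV[R]_d, cube c y &
    forall i, `|(\row_j (y ord0 (sg j) - \sum_l y ord0 l * C l j) *m A) ord0 i -
      grid_pt M A (L * N) b0 u ord0 i| <= slack R d b0 * frame_norm * Mr ^- N.
Proof.
move=> zH cN; set xp := round_pt _ _ _ _ _ _ _ => /andP[/forallP h1 /forallP h2].
rewrite cN in h1 h2; have NL : (N <= L * N)%N by rewrite leq_pmull.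
pose y : 'rV[R]_d := \row_i (if [pick j | sg j == i] is Some j then xp j
   else (idx z i)%:R / Mr ^+ (L * N)).
have ysg j : y ord0 (sg j) = xp j.
  by rewrite mxE; case: pickP => [j' /eqP /sgI -> //|/(_ j)]; rewrite eqxx.
have yfree i : free sg i -> y ord0 i = (idx z i)%:R / Mr ^+ (L * N).
  rewrite mxE; case: pickP => [j /eqP <-|//]; by rewrite /free codom_f.
exists y => [|i].
  rewrite cubeE // => i /=; rewrite cN; have [fi|] := boolP (free sg i).
    have /eqP e := implyP (h2 i) fi; rewrite yfree // -e -natr1 mulrDl mul1r.
    have := floor_div R M0 (idx z i) N (L * N - N); rewrite subnKC // idx_take ?zH //.
    by move=> /andP[f1 f2]; apply/andP; split; lra.
  rewrite negbK => /codomP[j ->]; rewrite ysg; have /andP[x0 /eqP e] := h1 j.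
  have /andP[] := truncn_itv (mulr_ge0 (ltW (Mp N)) x0); rewrite e => f1 f2.
  by rewrite ler_pdivrMr // mulrC f1 ler_pdivlMr // mulrC ltW.
have key j : `|(y ord0 (sg j) - \sum_l y ord0 l * C l j) - ((u j)%:R / Mr ^+ (L * N) - b0%:R)|
    <= slack R d b0 * Mr ^- N.
  rewrite ysg; have -> : \sum_l y ord0 l * C l j = \sum_l (idx z l)%:R / Mr ^+ (L * N) * C l j.
    apply: eq_bigr => l _; have [fl|] := boolP (free sg l); first by rewrite yfree.
    by rewrite negbK => /codomP[j' ->]; rewrite Csg !mulr0.
  have := round_pt_dist M0 entry_le u j zH (leqnn _); rewrite -/xp /exact_pt => hd.
  have -> (a b t s : R) : a - s - (t - b) = a - (t - b + s) by ring.
  apply: le_trans hd _; rewrite ler_pM2l ?slack_gt0 // lef_pV2 ?posrE //.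
  by rewrite ler_weXn2l // ler1n.
rewrite /grid_pt !mxE -sumrB; apply: le_trans (ler_norm_sum _ _ _) _.
rewrite /frame_norm mulrAC mulr_sumr; apply: ler_sum => j _.
rewrite !mxE -mulrBl normrM ler_pM //; first by have := key j; rewrite mxE.
by rewrite (bigD1 i) //= lerDl sumr_ge0.
Qed.

Variables (p : R) (x : word -> bool).
Hypothesis p0 : 0 < p.

Lemma total_mass N : (pop x N)%:R / (p * Mr ^+ d) ^+ N <=
  Mr ^- (L * N * k) * \sum_(u : {ffun 'I_k -> 'I_(2 * b0 * M ^ (L * N))})
     flow p (net_weight sg b0 L C N (L * N) (fun j => u j)) x [::] N.
Proof.
set m := (2 * b0 * _)%N; set H := (L * N)%N; have NL : (N <= H)%N by rewrite leq_pmull.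
pose g (z : word) j : R := - b0%:R + \sum_l (idx z l)%:R / Mr ^+ H * ((round_C M b0 L C N l j)%:R / Mr ^+ H - b0%:R).
(* At [H = L * N] the rounding of [u] is trivial, so the weights have the form treated by
   [sum_weight_ge], with shear [g]. *)
have wE (u : {ffun 'I_k -> 'I_m}) c : net_weight sg b0 L C N H (fun j => u j) c =
    weight sg H (fun z j => (u j)%:R / Mr ^+ H + g z j) c.
  rewrite /net_weight -/H; congr (weight sg H _ c); apply/funext => z; apply/funext => j.
  by rewrite /pivot_pt /round_u subnn expn0 divn1 /g addrA.
have gb z j : size z = H -> 0 <= - g z j /\ Mr ^+ H * (1 - g z j) <= m%:R.
  move=> zH; have sb : `|\sum_l (idx z l)%:R / Mr ^+ H * ((round_C M b0 L C N l j)%:R / Mr ^+ H - b0%:R)|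
      <= d%:R * (cm + 1).
    apply: le_trans (ler_norm_sum _ _ _) _.
    apply: (@le_trans _ _ (\sum_(l < d) (cm + 1))); last first.
      by rewrite sumr_const card_ord -[leLHS]mulr_natl.
    apply: ler_sum => l _; rewrite normrM -[leRHS]mul1r ler_pM //.
      rewrite ger0_norm ?divr_ge0 ?(ltW (Mp _)) // ler_pdivrMr // mul1r -natrX ler_nat.
      by rewrite ltnW // -zH idx_lt.
    have := round_C_dist M0 L entry_le N l j; rewrite -/H; set a := _ - b0%:R => ha.
    have -> : a = C l j + (a - C l j) by ring.
    apply: le_trans (ler_normD _ _) _; rewrite lerD // (le_trans ha) //.
    by rewrite invf_le1 // exprn_ege1 // ler1n.
  rewrite /g; move: sb; rewrite ler_norml => /andP[s1 s2]; have hb := hb0; split; first by lra.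
  rewrite /m natrM natrX mulrC ler_pM2r // natrM; lra.
have L1 : 0 < p * Mr ^+ d by rewrite mulr_gt0.
have -> : \sum_(u : {ffun 'I_k -> 'I_m}) flow p (net_weight sg b0 L C N H (fun j => u j)) x [::] N =
    p ^- N * \sum_(c <- words d M N) (\sum_(u : {ffun 'I_k -> 'I_m})
      weight sg H (fun z j => (u j)%:R / Mr ^+ H + g z j) c) * (retained x c)%:R.
  rewrite mulr_sumr; under [RHS]eq_bigr do rewrite mulr_suml mulr_sumr.
  rewrite [RHS]exchange_big /=; apply: eq_bigr => u _; rewrite /flow mulr_sumr.
  by apply: eq_big => [c|c _]; rewrite ?take0 ?eqxx // wE.
rewrite popE exprMn invfM.
apply: (@le_trans _ _ (Mr ^- (H * k) * (p ^- N * \sum_(c <- words d M N)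
    (Mr ^- (N * d) * Mr ^+ (H * k)) * (retained x c)%:R))).
  rewrite -mulr_sumr; set S := \sum_(c <- _) _.
  have -> : (Mr ^+ d) ^- N = Mr ^- (N * d) by rewrite -exprM mulnC.
  have := gt_eqF (Mp (H * k)); move: (Mr ^+ (H * k)) => y /negbT y0.
  suff -> : y^-1 * (p ^- N * (Mr ^- (N * d) * y * S)) = S * (p ^- N / Mr ^+ (N * d)) by [].
  by move: (p ^- N) (Mr ^- (N * d)) S => a b s; field.
rewrite ler_pM2l ?invr_gt0 // ler_pM2l ?invr_gt0 ?exprn_gt0 // big_seq [leRHS]big_seq.
apply: ler_sum => c /size_in_words cN; rewrite ler_wpM2r //.
exact: sum_weight_ge.
Qed.

End FibrePoints.

(** * Hausdorff measure *)

Section Diameter.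
Variables (R : realType) (n : nat).
Implicit Types (U : set 'rV[R]_n) (x y : 'rV[R]_n).

Lemma coord_le_eucl x i : `|x ord0 i| <= eucl x.
Proof.
rewrite /eucl -sqrtr_sqr ler_wsqrtr // (bigD1 i) //= lerDl.
by apply: sumr_ge0 => j _; exact: sqr_ge0.
Qed.

Lemma eucl_le (e : R) x : 0 <= e -> (forall i, `|x ord0 i| <= e) -> eucl x <= n%:R * e.
Proof.
move=> e0 h; have ne : 0 <= n%:R * e by rewrite mulr_ge0.
rewrite -[leRHS](ger0_norm ne) -sqrtr_sqr ler_wsqrtr //.
apply: (@le_trans _ _ (\sum_(i < n) e ^+ 2)).
  by apply: ler_sum => i _; rewrite -real_normK ?num_real // lerXn2r ?nnegrE.
rewrite sumr_const card_ord -[leLHS]mulr_natl exprMn ler_wpM2r ?sqr_ge0 //.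
by rewrite -natrX ler_nat; case: (n) => // m; rewrite leq_pmulr.
Qed.

Lemma diam_fin U (e : R) : (diam U <= e%:E)%E -> U !=set0 ->
  [/\ 0 <= fine (diam U), fine (diam U) <= e &
      forall x y, U x -> U y -> forall i, `|x ord0 i - y ord0 i| <= fine (diam U)].
Proof.
move=> Ue [x0 Ux0].
have ub x y : U x -> U y -> ((eucl (x - y))%:E <= diam U)%E.
  by move=> Ux Uy; apply: ereal_sup_ubound; exists x => //; exists y.
have d0 : (0 <= diam U)%E.
  by apply: le_trans (ub x0 x0 Ux0 Ux0); rewrite lee_fin sqrtr_ge0.
have fin : diam U \is a fin_num by rewrite ge0_fin_numE // (le_lt_trans Ue) // ltry.
split; first exact: fine_ge0.
  by rewrite -lee_fin fineK.
move=> x y Ux Uy i; rewrite -lee_fin fineK //; apply: le_trans (ub x y Ux Uy).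
by rewrite lee_fin; have := coord_le_eucl (x - y) i; rewrite !mxE.
Qed.

Lemma diam_pow_ge0 s U : (0 <= diam_pow s U)%E.
Proof. by rewrite /diam_pow; case: pselect => [e|ne] /=; rewrite ?lee_fin ?powR_ge0. Qed.

Lemma dimH_lt U (s0 : R) : U !=set0 -> (dimH U < s0%:E)%E ->
  exists s, 0 <= s <= s0 /\ hausdorff_measure s U = 0%E.
Proof.
move=> [x Ux]; rewrite /dimH; case: pselect => [U0|nU] /=.
  by exfalso; move: Ux; rewrite U0.
move=> /ereal_inf_lt [_ [s [s_ge Hs] <-]]; rewrite lte_fin => ss.
by exists s; rewrite s_ge ltW.
Qed.

End Diameter.

Section Covering.
Variables (R : realType) (d M : nat).
Hypothesis M1 : (1 < M)%N.
Local Notation word := (seq (digit d M)).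
Local Notation Mr := (M%:R : R).
Let M0 : (0 < M)%N := ltnW M1.
Let Mp e : (0 : R) < Mr ^+ e. Proof. by rewrite exprn_gt0 // ltr0n. Qed.

Lemma idx_inj (s t : word) : size s = size t -> (forall i, idx s i = idx t i) -> s = t.
Proof.
elim/last_ind: s t => [|s a IH] t; first by case: t.
case/lastP: t => [|t b]; rewrite !size_rcons // => -[st] h.
have h' i : idx s i = idx t i /\ a i = b i.
  have /eqP := h i; rewrite (@idx_rcons_inj d M M0) //.
  by move=> /andP[/eqP e1 /eqP e2]; split.
congr rcons; first by apply: IH => // i; case: (h' i).
by apply/ffunP => i; case: (h' i).
Qed.

(** The margin of 3 sides covers the diameter of a covering set, the distance to an approximating
    point and the cube itself. An interval of length 6 holds at most 7 integers, whence [7^d]. *)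
Definition close_words (v : 'rV[R]_d) j : seq word :=
  [seq Q <- words d M j | [forall i, (v ord0 i * Mr ^+ j - 3 <= (idx Q i)%:R) &&
     ((idx Q i)%:R <= v ord0 i * Mr ^+ j - 3 + 6)]].

Lemma size_close_words v j : (size (close_words v j) <= 7 ^ d)%N.
Proof.
have Mj : (0 < M ^ j)%N by rewrite expn_gt0 M0.
pose f (Q : word) : {ffun 'I_d -> 'I_(M ^ j)} :=
  [ffun i => if insub (idx Q i) is Some w then w else Ordinal Mj].
have fE Q i : size Q = j -> f Q i = idx Q i :> nat.
  by move=> Qj; rewrite ffunE insubT -?Qj ?idx_lt.
pose S := [pred g : {ffun 'I_d -> 'I_(M ^ j)} |
  [forall i, (v ord0 i * Mr ^+ j - 3 <= (g i)%:R) && ((g i)%:R <= v ord0 i * Mr ^+ j - 3 + 6)]].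
have h1 : (size (close_words v j) <= #|S|)%N.
  rewrite -(size_map f) cardE; apply: uniq_leq_size.
    rewrite map_inj_in_uniq ?filter_uniq ?words_uniq // => Q Q'.
    rewrite !mem_filter => /andP[_ /size_in_words Qj] /andP[_ /size_in_words Qj'] ff.
    by apply: idx_inj => [|i]; rewrite ?Qj // -fE // ff fE.
  move=> g /mapP[Q]; rewrite mem_filter => /andP[/forallP hQ /size_in_words Qj] ->.
  by rewrite mem_enum; apply/forallP => i; rewrite fE.
apply: leq_trans h1 _; rewrite -(ler_nat R) natrX -sum1_card natr_sum big_mkcond /=.
pose F (i : 'I_d) (w : 'I_(M ^ j)) : R := ((v ord0 i * Mr ^+ j - 3 <= w%:R) && (w%:R <= v ord0 i * Mr ^+ j - 3 + 6))%R%:R.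
apply: (@le_trans _ _ (\sum_(g : {ffun 'I_d -> 'I_(M ^ j)}) \prod_i F i (g i))).
  apply: ler_sum => g _; case: ifP => [/forallP h|_]; last by apply: prodr_ge0.
  by rewrite big1 // => i _; rewrite /F h.
rewrite sum_ffun_prod; have -> : 7 ^+ d = \prod_(i < d) (7 : R) by rewrite prodr_const card_ord.
apply: ler_prod => i _; rewrite sumr_ge0 //=.
by apply: le_trans (count_itv_le _ _ _) _; lra.
Qed.

Lemma close_words_prefix (U : set 'rV[R]_d) (v y y' : 'rV[R]_d) (c : word) j :
  (forall i, `|y ord0 i - v ord0 i| <= Mr ^- j) ->
  (forall i, `|y' ord0 i - y ord0 i| <= Mr ^- j) ->
  cube c y' -> (j <= size c)%N -> take j c \in close_words v j.
Proof.
move=> yv y'y cy jc; rewrite mem_filter mem_words size_takel // eqxx andbT.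
have := cube_take M0 jc cy; rewrite cubeE // size_takel // => h.
apply/forallP => i; have /andP[h1 h2] := h i; move: (yv i) (y'y i).
set a : nat := idx _ i in h1 h2 *; rewrite !ler_norml => /andP[g1 g2] /andP[g3 g4].
rewrite ler_pdivrMr // in h1; rewrite ler_pdivlMr // -natr1 in h2.
have mm : Mr ^- j * Mr ^+ j = 1 by rewrite mulVf // gt_eqF.
have := Mp j; move: (Mr ^+ j) (Mr ^- j) mm h1 h2 g1 g2 g3 g4 => m mi mm h1 h2 g1 g2 g3 g4 m0.
have k1 : (y' ord0 i - v ord0 i) * m <= 2.
  have -> : 2 = (mi + mi) * m by rewrite mulrDl mm.
  by rewrite ler_pM2r //; lra.
have k2 : - 2 <= (y' ord0 i - v ord0 i) * m.
  have -> : - 2 = - (mi + mi) * m by rewrite mulNr mulrDl mm.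
  by rewrite ler_pM2r //; lra.
by rewrite mulrBl in k1 k2; apply/andP; split; lra.
Qed.

Variable s0 : R.
Hypothesis s00 : 0 < s0.
Local Notation g := (Mr `^ s0).

Let g1 : 1 < g.
Proof. by rewrite -[ltLHS]expR0 /powR gt_eqF ?ltr0n // ltr_expR mulr_gt0 // ln_gt0 // ltr1n. Qed.

(** For [del > 0], [j] is the last level with [del <= M^-j], so [M^-(j+1) < del] and one factor [g]
    is lost. For diameter 0 there is no last level, whence the extra [e]. *)
Lemma covering_scale (del s e : R) : 0 <= del <= 1 -> 0 <= s <= s0 -> 0 < e ->
  exists j, del <= Mr ^- j /\ g ^- j <= g * del `^ s + e.
Proof.
move=> /andP[]; rewrite le_eqVlt => /predU1P[<- _ _ e0|del0 del1 /andP[s0' ss] e0].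
  have [j hj] := @expr_unbounded R g e^-1 g1; exists j; split.
    by rewrite invr_ge0 ltW.
  apply: (@le_trans _ _ e); last by rewrite lerDr mulr_ge0 ?powR_ge0.
  by rewrite -[leRHS]invrK lef_pV2 ?posrE ?exprn_gt0 ?invr_gt0 // (lt_trans ltr01 g1).
have [n0 hn0] := @expr_unbounded R Mr (del^-1 + 1) ltac:(by rewrite ltr1n).
have ex : exists n, Mr ^- n < del.
  exists n0; rewrite invf_plt ?posrE //; apply: lt_le_trans hn0; rewrite ltrDl ltr01 //.
case: (ex_minnP ex) => -[|j] hj jmin; first by move: hj; rewrite expr0 invr1 ltNge del1.
exists j; split; first by rewrite leNgt; apply/negP => /jmin; rewrite ltnn.
apply: (@le_trans _ _ (g * del `^ s)); last by rewrite lerDl ltW.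
have gp : 0 < g := lt_trans ltr01 g1.
have -> : g ^- j = g * g ^- j.+1.
  by rewrite exprS invfM mulrA mulfV ?mul1r // gt_eqF.
rewrite ler_pM2l //; have -> : g ^- j.+1 = (Mr ^- j.+1) `^ s0.
  by rewrite -powR_mulrn ?powR_ge0 // powRAC -powRN powR_mulrn // -powR_inv1 ?(ltW (Mp _)) // powRAC powRN powR_inv1 ?powR_ge0.
apply: (@le_trans _ _ (del `^ s0)).
  by apply: ge0_ler_powR; rewrite ?nnegrE ?(ltW s00) ?invr_ge0 ?(ltW (Mp _)) ?ltW.
by apply: ger_powR; rewrite // del0.
Qed.

(** Covering sets are replaced by words of comparable size, neighbours included, so that long cubes
    passing close to a point of [F] are caught as well. This openness is what the compactness
    argument uses. *)
Lemma fibre_cover (F : set 'rV[R]_d) (s eta : R) : 0 <= s <= s0 ->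
  hausdorff_measure s F = 0%E -> 0 < eta ->
  exists cov : nat -> seq word,
    (forall I, \sum_(0 <= l < I) \sum_(Q <- cov l) g ^- size Q <= eta) /\
    forall y, F y -> exists l m0, forall m (y' : 'rV[R]_d) (c : word), (m0 <= m)%N ->
      (forall i, `|y' ord0 i - y ord0 i| < m.+1%:R^-1) -> cube c y' -> (m <= size c)%N ->
      has (fun Q => (size Q <= size c)%N && (take (size Q) c == Q)) (cov l).
Proof.
move=> hs HF eta0; have gp : 0 < g := lt_trans ltr01 g1.
pose D7 : R := 7 ^+ d; have D0 : 0 < D7 by rewrite exprn_gt0.
(* The two halves of [eta]: a covering set costs a factor [7^d * g], and the [l]-th one may use an
   extra [e0 * 2^-l]. *)
pose eta' := eta / (2 * D7 * g); pose e0 := eta / (4 * D7).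
have eta'0 : 0 < eta' by rewrite divr_gt0 // !mulr_gt0.
have e00 : 0 < e0 by rewrite divr_gt0 // mulr_gt0.
have cF : (hausdorff_content s 1 F < eta'%:E)%E.
  apply: (@le_lt_trans _ _ 0%E); last by rewrite lte_fin.
  by rewrite -HF; apply: ereal_sup_ubound; exists 1 => //=; exact: ltr01.
have [S [U [FU hU] SE] Slt] := ereal_inf_lt cF.
pose pw l := fine (diam_pow s (U l)).
have pwE l : (pw l)%:E = diam_pow s (U l).
  by rewrite /pw fineK // /diam_pow; case: pselect.
have spw I : \sum_(0 <= l < I) pw l <= eta'.
  rewrite -lee_fin -sumEFin; apply: le_trans (ltW Slt).
  rewrite -SE; under eq_bigr do rewrite pwE.
  by apply: nneseries_lim_ge => l _ _; exact: diam_pow_ge0.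
have pick_cov l : exists cv : seq word,
    \sum_(Q <- cv) g ^- size Q <= D7 * (g * pw l + e0 * 2^-1 ^+ l) /\
    forall y, U l y -> exists m0, forall m (y' : 'rV[R]_d) (c : word), (m0 <= m)%N ->
      (forall i, `|y' ord0 i - y ord0 i| < m.+1%:R^-1) -> cube c y' -> (m <= size c)%N ->
      has (fun Q => (size Q <= size c)%N && (take (size Q) c == Q)) cv.
  have el : 0 < e0 * 2^-1 ^+ l by rewrite mulr_gt0 // exprn_gt0 // invr_gt0.
  have [[v Uv]|Ul] := pselect (U l !=set0).
  - have [d0 d1 dU] := diam_fin (hU l) (ex_intro _ v Uv).
    have [j [dj gj]] := @covering_scale (fine (diam (U l))) s _ (introT andP (conj d0 d1)) hs el.
    have pwl : pw l = fine (diam (U l)) `^ s.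
      rewrite /pw /diam_pow; case: pselect => // U0; exfalso; by move: Uv; rewrite U0.
    exists (close_words v j); split.
      apply: (@le_trans _ _ (\sum_(Q <- close_words v j) g ^- j)).
        rewrite big_seq [leRHS]big_seq; apply: ler_sum => Q; rewrite mem_filter => /andP[_].
        by move/size_in_words => ->.
      rewrite big_const_seq count_predT iter_addr_0 -[leLHS]mulr_natl ler_pM ?invr_ge0 ?exprn_ge0 ?(ltW gp) //.
        by rewrite /D7 -natrX ler_nat size_close_words.
      by rewrite pwl.
    move=> y Uy; have [m1 hm1] : exists m1, forall m, (m1 <= m)%N -> m.+1%:R^-1 < Mr ^- j.
      by apply: archi_inv; rewrite invr_gt0.
    exists (maxn m1 j) => m y' c; rewrite geq_max => /andP[mm jm] yy cy mc.
    have jc : (j <= size c)%N by apply: leq_trans mc.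
    apply/hasP; exists (take j c); last by rewrite size_takel // jc eqxx.
    apply: (@close_words_prefix (U l) v y y') => // i.
      by apply: le_trans dj; apply: dU.
    by apply: ltW; apply: lt_trans (yy i) _; exact: hm1.
  - exists [::]; split; last by move=> y Uy; case: Ul; exists y.
    rewrite big_nil mulr_ge0 ?(ltW D0) // addr_ge0 ?(ltW el) // mulr_ge0 ?(ltW gp) //.
    by rewrite fine_ge0 // diam_pow_ge0.
have [cov hcov] := choice pick_cov; exists cov; split => [I|y Fy].
  apply: (@le_trans _ _ (\sum_(0 <= l < I) D7 * (g * pw l + e0 * 2^-1 ^+ l))).
    by apply: ler_sum => l _; case: (hcov l).
  rewrite -mulr_sumr big_split /= -!mulr_sumr.
  apply: (@le_trans _ _ (D7 * (g * eta' + e0 * 2))).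
    by rewrite ler_pM2l // lerD // ler_pM2l // sum_half_le2.
  have -> : D7 * (g * eta' + e0 * 2) = eta.
    by rewrite /eta' /e0; field; rewrite !gt_eqF.
  by [].
have [l _ Ul] := FU y Fy; have [_ /(_ y Ul)[m0 h]] := hcov l.
by exists l, m0.
Qed.

End Covering.

(** * Upper bound on the dimension of the percolation set *)

Section UpperDimension.
Variables (R : realType) (d M : nat).
Hypothesis M1 : (1 < M)%N.
Local Notation word := (seq (digit d M)).
Local Notation Mr := (M%:R : R).
Let M0 : (0 < M)%N := ltnW M1.
Let Mp e : (0 : R) < Mr ^+ e. Proof. by rewrite exprn_gt0 // ltr0n. Qed.

Lemma diam_pow_cube s (c : word) : 0 <= s ->
  (diam_pow s (@cube R d M c) <= ((d%:R * Mr ^- size c) `^ s)%:E)%E.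
Proof.
move=> s0; have De : 0 <= d%:R * Mr ^- size c by rewrite mulr_ge0 // invr_ge0 ltW.
rewrite /diam_pow; case: pselect => [e|ne]; first by rewrite lee_fin powR_ge0.
have dc : (diam (@cube R d M c) <= (d%:R * Mr ^- size c)%:E)%E.
  apply: ge_ereal_sup => _ [u cu [v cv <-]]; rewrite lee_fin.
  apply: eucl_le => [|i]; first by rewrite invr_ge0 ltW.
  move: cu cv; rewrite cubeE // => /(_ i) /andP[h1 h2] /(_ i) /andP[h3 h4].
  rewrite -natr1 mulrDl mul1r in h2 h4; rewrite !mxE ler_norml; apply/andP; split; lra.
have U0 : @cube R d M c !=set0.
  by apply/set0P/eqP.
have [d0 d1 _] := diam_fin dc U0.
by rewrite lee_fin; apply: ge0_ler_powR.
Qed.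

Lemma hausdorff_content_mandelbrot (x : word -> bool) s delta n :
  0 <= s -> d%:R * Mr ^- n <= delta ->
  (hausdorff_content s delta (mandelbrot x) <=
    ((pop x n)%:R * (d%:R * Mr ^- n) `^ s)%:E)%E.
Proof.
move=> s0 hd; pose l := [seq c <- words d M n | retained x c].
have sl : size l = pop x n by rewrite size_filter.
pose U i : set 'rV[R]_d := if (i < size l)%N then cube (nth [::] l i) else set0.
have lP i : (i < size l)%N -> size (nth [::] l i) = n.
  by move=> il; have := mem_nth [::] il; rewrite mem_filter => /andP[_ /size_in_words].
have pU i : (diam_pow s (U i) <= ((i < size l)%N%:R * (d%:R * Mr ^- n) `^ s)%:E)%E.
  rewrite /U; case: ifP => il; first by rewrite mul1r; have := diam_pow_cube (nth [::] l i) s0; rewrite lP.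
  by rewrite mul0r /diam_pow; case: pselect.
apply: (@le_trans _ _ (\sum_(0 <= i <oo) diam_pow s (U i))%E).
  apply: ereal_inf_lbound; exists U => //; split => [y Ky|i].
    have [c [cn rc] cy] := Ky n I.
    have cl : c \in l by rewrite mem_filter rc mem_words cn /=.
    by exists (index c l) => //; rewrite /U index_mem cl nth_index.
  rewrite /U; case: ifP => il; last first.
    by apply: ge_ereal_sup => _ [u [] ].
  apply: (@le_trans _ _ (d%:R * Mr ^- n)%:E); last by rewrite lee_fin.
  apply: ge_ereal_sup => _ [u cu [v cv <-]]; rewrite lee_fin.
  apply: eucl_le => [|j]; first by rewrite invr_ge0 ltW.
  move: cu cv; rewrite cubeE // lP // => /(_ j) /andP[h1 h2] /(_ j) /andP[h3 h4].
  rewrite -natr1 mulrDl mul1r in h2 h4; rewrite !mxE ler_norml; apply/andP; split; lra.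
apply: lime_le; first by apply: is_cvg_nneseries => i _ _; exact: diam_pow_ge0.
apply: nearW => I; apply: (@le_trans _ _ (\sum_(0 <= i < I) ((i < size l)%N%:R * (d%:R * Mr ^- n) `^ s)%:E)%E).
  by apply: lee_sum => i _; exact: pU.
rewrite sumEFin lee_fin -mulr_suml ler_wpM2r ?powR_ge0 // -sl -natr_sum ler_nat.
rewrite -[leqRHS]subn0 -[leqRHS]muln1 -sum_nat_const_nat.
have [Il|lI] := leqP I (size l).
  rewrite (@big_cat_nat _ _ _ I 0 (size l)) //= -[leqLHS]addn0 leq_add //.
  by apply: leq_sum => i _; exact: leq_b1.
rewrite (@big_cat_nat _ _ _ (size l) 0 I) ?(ltnW lI) //= -[leqRHS]addn0 leq_add //.
  by apply: leq_sum => i _; exact: leq_b1.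
rewrite leqn0 big_nat_cond big1 // => i /andP[/andP[h _] _].
by rewrite ltnNge h.
Qed.

(** Covering by the retained cubes of level [n] costs at most a constant times [(Lam / M^s)^n],
    which tends to 0. *)
Lemma dimH_mandelbrot_le (x : word -> bool) (K Lam s : R) : 0 <= s -> 0 < Lam ->
  Lam < Mr `^ s -> (forall n, (pop x n)%:R <= K * Lam ^+ n) ->
  (dimH (@mandelbrot R d M x) <= s%:E)%E.
Proof.
move=> s0 L0 Ls hpop; rewrite /dimH; case: pselect => [e|ne]; first by rewrite leNye.
apply: ereal_inf_lbound; exists s => //; split => //.
have c0 delta : (0 <= hausdorff_content s delta (@mandelbrot R d M x))%E.
  apply: le_ereal_inf_tmp => _ [U _ <-]; apply: nneseries_ge0 => i _ _; exact: diam_pow_ge0.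
apply/eqP; rewrite eq_le; apply/andP; split; last first.
  by apply: le_trans (c0 1) _; apply: ereal_sup_ubound; exists 1 => //=; exact: ltr01.
apply: ge_ereal_sup => _ [delta delta0 <-]; apply/lee_addgt0Pr => e e0; rewrite add0e.
have gp : 0 < Mr `^ s by rewrite powR_gt0 // ltr0n.
pose K' := (`|K| + 1) * (d%:R `^ s + 1).
have K'0 : 0 < K' by rewrite mulr_gt0 // ltr_wpDl ?powR_ge0.
have [n1 h1] := @expr_unbounded R (Mr `^ s / Lam) (K' / e) ltac:(by rewrite ltr_pdivlMr // mul1r).
have [n2 h2] := @expr_unbounded R Mr (d%:R / delta) ltac:(by rewrite ltr1n).
pose n := maxn n1 n2.
have {}h1 : K' / e <= (Mr `^ s / Lam) ^+ n.
  by apply: le_trans h1 _; rewrite ler_weXn2l ?leq_maxl // ler_pdivlMr // mul1r ltW.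
have {}h2 : d%:R / delta <= Mr ^+ n.
  by apply: le_trans h2 _; rewrite ler_weXn2l ?leq_maxr // ler1n.
have hd : d%:R * Mr ^- n <= delta.
  by rewrite ler_pdivrMr // mulrC -ler_pdivrMr.
apply: le_trans (hausdorff_content_mandelbrot x s0 hd) _; rewrite lee_fin.
rewrite powRM ?invr_ge0 ?(ltW (Mp _)) //.
have -> : (Mr ^- n) `^ s = (Mr `^ s) ^- n.
  have e1 : (Mr ^+ n) `^ s = (Mr `^ s) ^+ n.
    by rewrite -(powR_mulrn n (ler0n _ _)) powRAC powR_mulrn // powR_ge0.
  by rewrite -powR_inv1 ?(ltW (Mp _)) // powRAC e1 powR_inv1 // exprn_ge0 // powR_ge0.
apply: (@le_trans _ _ (K' * (Lam ^+ n * (Mr `^ s) ^- n))).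
  have a1 : (pop x n)%:R <= (`|K| + 1) * Lam ^+ n.
    by apply: le_trans (hpop n) _; rewrite ler_pM2r ?exprn_gt0 // ler_wpDr // ler_norm.
  have -> : K' * (Lam ^+ n * (Mr `^ s) ^- n) =
     (`|K| + 1) * Lam ^+ n * (Mr `^ s) ^- n * (d%:R `^ s + 1) by rewrite /K'; ring.
  rewrite [(d%:R `^ s) * _]mulrC mulrA.
  apply: ler_pM.
  - by rewrite divr_ge0 // exprn_ge0 // ltW.
  - exact: powR_ge0.
  - by rewrite ler_pM2r // invr_gt0 exprn_gt0.
  - by rewrite lerDl.
have -> : Lam ^+ n * (Mr `^ s) ^- n = ((Mr `^ s / Lam) ^+ n)^-1.
  by rewrite exprMn exprVn invfM invrK mulrC.
have u0 : 0 < (Mr `^ s / Lam) ^+ n by rewrite exprn_gt0 // divr_gt0.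
by rewrite ler_pdivrMr // mulrC -ler_pdivrMr.
Qed.

End UpperDimension.

(** * Fibres avoiding large slices *)

Lemma eq_of_le_inv (R : realType) (a b c : R) :
  (forall m : nat, `|a - b| <= c * m.+1%:R^-1) -> a = b.
Proof.
move=> h; apply/eqP; rewrite -subr_eq0 -normr_le0 leNgt; apply/negP => ab0.
have c0 : 0 < c.
  by have := lt_le_trans ab0 (h 0%N); rewrite invr1 mulr1.
have [n hn] := archi_inv (divr_gt0 ab0 c0).
have := le_lt_trans (h n) _; have := hn n (leqnn n).
rewrite ltr_pdivlMr // mulrC => h1 /(_ _ h1); by rewrite ltxx.
Qed.

Section Alternatives.
Variables (R : realType) (d k M : nat).
Hypothesis M1 : (1 < M)%N.
Local Notation word := (seq (digit d M)).
Local Notation Mr := (M%:R : R).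
Let M0 : (0 < M)%N := ltnW M1.
Let Mp e : (0 : R) < Mr ^+ e. Proof. by rewrite exprn_gt0 // ltr0n. Qed.
Variables (B : 'M[R]_(k, d)) (sg : 'I_k -> 'I_d) (A : 'M[R]_k) (C : 'I_d -> 'I_k -> R) (b0 L : nat).
Hypothesis sgI : injective sg.
Hypothesis Csg : forall j' j, C (sg j') j = 0.
Hypothesis BE : forall y : 'rV[R]_d, y *m B^T =
     \row_j (y ord0 (sg j) - \sum_l y ord0 l * C l j) *m A.
Hypothesis L0 : (0 < L)%N.
Variable cm : R.
Hypothesis cm0 : 0 <= cm.
Hypothesis hcm : forall l j, `|C l j| <= cm.
Hypothesis hb0 : d%:R * (cm + 1) + 1 <= b0%:R.
Hypothesis d0 : (0 < d)%N.
Variable x : word -> bool.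
Variable s0 : R.
Hypothesis s00 : 0 < s0.
Local Notation g := (Mr `^ s0).
Variables (T : set 'rV[R]_k) (a b : nat -> 'rV[R]_k) (rho : nat -> R) (eta : R).
Hypothesis rho0 : forall n, 0 < rho n.
Hypothesis eta0 : 0 < eta.
Hypothesis Tcov : T `<=` \bigcup_n box (a n) (b n).
Local Notation fibre t := (mandelbrot x `&` [set y | y *m B^T = t]).
Hypothesis Tdim : forall t, ~ T t -> exists s, 0 <= s <= s0 /\
  (fibre t !=set0 -> hausdorff_measure s (fibre t) = 0%E).

Definition in_box n N u := forall i, a n ord0 i - rho n <= grid_pt M A (L * N) b0 u ord0 i /\
  grid_pt M A (L * N) b0 u ord0 i <= b n ord0 i + rho n.

Definition covered N u := exists cov : seq word, \sum_(Q <- cov) g ^- size Q <= eta /\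
  forall z c : word, size z = (L * N)%N -> size c = N -> retained x c ->
    hit sg (round_pt b0 L C N (L * N) u z) z c ->
    has (fun Q => (size Q <= size c)%N && (take (size Q) c == Q)) cov.

Lemma grid_pt_bound N u i : (forall j, (u j < 2 * b0 * M ^ (L * N))%N) ->
  `|grid_pt M A (L * N) b0 u ord0 i| <= b0%:R * frame_norm A.
Proof.
move=> hu; rewrite /grid_pt mxE; apply: le_trans (ler_norm_sum _ _ _) _.
rewrite /frame_norm mulr_sumr; apply: ler_sum => j _; rewrite !mxE normrM ler_pM //.
  have := ltnW (hu j); rewrite -(ler_nat R) natrM natrX natrM => h.
  rewrite ler_norml; have : 0 <= (u j)%:R / Mr ^+ (L * N) by rewrite divr_ge0 // ltW.
  have : (u j)%:R / Mr ^+ (L * N) <= 2 * b0%:R by rewrite ler_pdivrMr.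
  by move=> h1 h2; apply/andP; split; lra.
by rewrite (bigD1 i) //= lerDl sumr_ge0.
Qed.

Lemma mulmx_coord_le (v : 'rV[R]_d) e i : (forall l, `|v ord0 l| <= e) ->
  `|(v *m B^T) ord0 i| <= (\sum_l `|B i l|) * e.
Proof.
move=> h; rewrite mxE mulr_suml; apply: le_trans (ler_norm_sum _ _ _) _.
by apply: ler_sum => l _; rewrite !mxE normrM mulrC ler_wpM2l.
Qed.

Lemma inv_expM_le m N : (m <= N)%N -> Mr ^- N <= m.+1%:R^-1.
Proof.
move=> mN; rewrite lef_pV2 ?posrE // ?ltr0n // -natrX ler_nat.
by apply: leq_trans (ltn_expl N M1); rewrite ltnS.
Qed.

(* A sequence of parameters violating both alternatives would accumulate at some t
   outside T, and the retained cubes missed by the cover of the fibre over t would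
   accumulate at a point of that fibre. *)
Lemma alternatives : exists N0, forall N u, (N0 <= N)%N ->
  (forall j, (u j < 2 * b0 * M ^ (L * N))%N) ->
  (exists2 n, (n < N0)%N & in_box n N u) \/ covered N u.
Proof.
apply: contrapT => hn.
have bad N0 : exists Nu : nat * ('I_k -> nat), [/\ (N0 <= Nu.1)%N,
    forall j, (Nu.2 j < 2 * b0 * M ^ (L * Nu.1))%N,
    ~ (exists2 n, (n < N0)%N & in_box n Nu.1 Nu.2) & ~ covered Nu.1 Nu.2].
  apply: contrapT => h; apply: hn; exists N0 => N u NN hu.
  apply: contrapT => /not_orP[h1 h2]; apply: h; by exists (N, u).
have [F hF] := choice bad => {hn bad}.
pose NN i := (F i).1; pose uu i := (F i).2.
pose t i := grid_pt M A (L * NN i) b0 (uu i).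
have [i j|t' [f1 hf1]] := @cluster_seq R k t (b0%:R * frame_norm A).
  by rewrite -ler_norml; apply: grid_pt_bound; case: (hF i).
have nT : ~ T t'.
  move=> Tt; have [n _ bx] := Tcov Tt; have [m0 hm0] := archi_inv (rho0 n).
  pose m := maxn m0 n.+1; have [mf tf] := hf1 m; have [_ _ nb _] := hF (f1 m).
  apply: nb; exists n; first by apply: leq_trans mf; rewrite leq_maxr.
  move=> i; have hm := hm0 m (leq_maxl _ _); have := tf i; have /andP[b1 b2] := bx i.
  have -> : grid_pt M A (L * (F (f1 m)).1) b0 (F (f1 m)).2 ord0 i = t (f1 m) ord0 i by [].
  move: (t (f1 m) ord0 i) => ti; rewrite ltr_norml => /andP[l1 l2].
  move: hm l1 l2; move: (m.+1%:R^-1) => e; split; lra.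
have [cov [scov hcov]] : exists cov : nat -> seq word,
    (forall I, \sum_(0 <= l < I) \sum_(Q <- cov l) g ^- size Q <= eta) /\
    forall y, fibre t' y -> exists l m0, forall m (y' : 'rV[R]_d) (c : word), (m0 <= m)%N ->
      (forall i, `|y' ord0 i - y ord0 i| < m.+1%:R^-1) -> cube c y' -> (m <= size c)%N ->
      has (fun Q => (size Q <= size c)%N && (take (size Q) c == Q)) (cov l).
  have [s [hs Hs]] := Tdim nT.
  have [ne|em] := pselect (fibre t' !=set0).
    by apply: (fibre_cover M1 s00 hs (Hs ne) eta0).
  exists (fun=> [::]); split => [I|y Fy]; last by case: em; exists y.
  by rewrite big1 ?ltW // => l _; rewrite big_nil.
(* The finite cover tested at stage [m] joins the first [f1 m] lists; since it fails, some retained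
   cube escapes all of them. *)
have pt m : exists yc : 'rV[R]_d * word, [/\ size yc.2 = NN (f1 m), retained x yc.2,
    cube yc.2 yc.1, forall i, `|(yc.1 *m B^T) ord0 i - t (f1 m) ord0 i| <=
       slack R d b0 * frame_norm A * Mr ^- NN (f1 m) &
    ~~ has (fun Q => (size Q <= size yc.2)%N && (take (size Q) yc.2 == Q))
        (flatten [seq cov l | l <- iota 0 (f1 m)])].
  have [_ _ _ nc] := hF (f1 m); apply: contrapT => h; apply: nc.
  exists (flatten [seq cov l | l <- iota 0 (f1 m)]); split.
    rewrite big_flatten big_map /=; apply: le_trans (scov (f1 m)).
    by rewrite /index_iota subn0.
  move=> z c zH cN rc hc; apply: contrapT => /negP nh; apply: h.
  have [y cy hy] := hit_point M0 A sgI Csg L0 cm0 hcm hb0 d0 zH cN hc.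
  by exists (y, c); split => //= i; rewrite BE.
have [G hG] := choice pt.
have [m i|y' [f2 hf2]] := @cluster_seq R d (fun m => (G m).1) 1.
  have [_ _ cy _ _] := hG m; move: cy; rewrite cubeE // => /(_ i) /andP[h1 h2].
  have i0 : 0 <= (idx (G m).2 i)%:R / Mr ^+ size (G m).2 by rewrite divr_ge0 // ltW.
  have i1 : (idx (G m).2 i).+1%:R / Mr ^+ size (G m).2 <= 1.
    by rewrite ler_pdivrMr // mul1r -natrX ler_nat idx_lt.
  by apply/andP; split; lra.
have sz m : (m <= NN (f1 (f2 m)))%N.
  have [h1 _] := hf2 m; have [h2 _] := hf1 (f2 m); have [h3 _ _ _] := hF (f1 (f2 m)).
  by apply: leq_trans h1 _; apply: leq_trans h2 h3.
have Ky : mandelbrot x y'.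
  apply: (@limit_mandelbrot R d M M0 x (fun m => (G (f2 m)).2) (fun m => (G (f2 m)).1)) => [m|m|m|m i].
  - by have [-> _ _ _ _] := hG (f2 m).
  - by have [_ ? _ _ _] := hG (f2 m).
  - by have [_ _ ? _ _] := hG (f2 m).
  - by have [_ ] := hf2 m.
have yt : y' *m B^T = t'.
  apply/rowP => i; apply: (@eq_of_le_inv R _ _ (\sum_l `|B i l| + slack R d b0 * frame_norm A + 1)) => m.
  have [f2m yy] := hf2 m; have [f1m tt] := hf1 (f2 m); have [_ _ _ hd _] := hG (f2 m).
  have e1 : `|((y' - (G (f2 m)).1) *m B^T) ord0 i| <= (\sum_l `|B i l|) * m.+1%:R^-1.
    by apply: mulmx_coord_le => l; rewrite !mxE distrC ltW.
  have e2 : `|((G (f2 m)).1 *m B^T) ord0 i - t (f1 (f2 m)) ord0 i| <=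
      slack R d b0 * frame_norm A * m.+1%:R^-1.
    apply: le_trans (hd i) _; rewrite ler_wpM2l ?mulr_ge0 ?frame_norm_ge0 ?(ltW (slack_gt0 _ _ _)) //.
    exact: inv_expM_le.
  have e3 : `|t (f1 (f2 m)) ord0 i - t' ord0 i| <= m.+1%:R^-1.
    apply: le_trans (ltW (tt i)) _; rewrite lef_pV2 ?posrE ?ltr0n // ler_nat ltnS.
    exact: f2m.
  have subE : ((y' - (G (f2 m)).1) *m B^T) ord0 i = (y' *m B^T) ord0 i - ((G (f2 m)).1 *m B^T) ord0 i.
    by rewrite mulmxBl [LHS]mxE [X in _ + X]mxE.
  rewrite subE in e1; rewrite 2!mulrDl mul1r; move: e1 e2 e3.
  move: ((y' *m B^T) ord0 i) (((G (f2 m)).1 *m B^T) ord0 i) (t (f1 (f2 m)) ord0 i) (t' ord0 i).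
  move=> u v w s e1 e2 e3; have -> : u - s = (u - v) + (v - w) + (w - s) by ring.
  apply: le_trans (ler_normD _ _) _; apply: lerD; last exact: e3.
  by apply: le_trans (ler_normD _ _) _; apply: lerD.
have [l [m0 hm0]] := hcov y' (conj Ky yt).
(* As [m > l], the list [cov l] is among those that were escaped. *)
pose m := maxn m0 l.+1; have [f2m yy] := hf2 m; have [f1m _] := hf1 (f2 m).
have [sc _ cy _ nh] := hG (f2 m).
have := hm0 m (G (f2 m)).1 (G (f2 m)).2 (leq_maxl _ _) yy cy.
rewrite sc sz => /(_ isT) /hasP[Q Ql hQ]; move/negP: nh; apply; apply/hasP; exists Q => //; last by rewrite sc.
apply/flattenP; exists (cov l) => //; apply: map_f; rewrite mem_iota add0n /=.
by apply: leq_trans (leq_trans f2m f1m); rewrite leq_maxr.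
Qed.

End Alternatives.

Lemma prod_enlarge (R : realType) (I : Type) (l : seq I) (w : I -> R) (e : R) :
  (forall i, 0 <= w i) -> 0 < e -> exists rho, 0 < rho /\
    forall rho', 0 <= rho' <= rho -> \prod_(i <- l) (w i + rho') <= \prod_(i <- l) w i + e.
Proof.
move=> w0; elim: l e => [|i l IH] e e0.
  by exists 1; split => // rho' _; rewrite !big_nil lerDl ltW.
have P0 : 0 <= \prod_(j <- l) w j by apply: prodr_ge0.
have wi := w0 i; have w1 : 0 < w i + 1 by lra.
have e1 : 0 < e / 2 / (w i + 1) by rewrite !divr_gt0.
have [r1 [r10 h1]] := IH _ e1; set P := \prod_(j <- l) w j in P0 h1 *.
have Pe : 0 < P + e / 2 / (w i + 1) by lra.
exists (Num.min r1 (e / 2 / (P + e / 2 / (w i + 1)))); split.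
  by rewrite lt_min r10 !divr_gt0.
move=> r' /andP[r'0]; rewrite le_min => /andP[r'1 r'2]; rewrite !big_cons -/P.
have hP : \prod_(j <- l) (w j + r') <= P + e / 2 / (w i + 1) by apply: h1; rewrite r'0.
apply: (@le_trans _ _ ((w i + r') * (P + e / 2 / (w i + 1)))).
  by rewrite ler_wpM2l // addr_ge0.
rewrite ler_pdivlMr // in r'2.
have hw : w i * (e / 2 / (w i + 1)) <= e / 2.
  rewrite mulrA ler_pdivrMr // mulrC ler_wpM2l ?divr_ge0 ?(ltW e0) //; lra.
move: r'2 hw; move: (e / 2 / (w i + 1)) => f r'2 hw.
have -> : (w i + r') * (P + f) = w i * P + w i * f + r' * (P + f) by ring.
lra.
Qed.

Section Slices.
Variables (R : realType) (d k M : nat).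
Hypothesis M1 : (1 < M)%N.
Local Notation word := (seq (digit d M)).
Local Notation Mr := (M%:R : R).
Let M0 : (0 < M)%N := ltnW M1.
Let Mp e : (0 : R) < Mr ^+ e. Proof. by rewrite exprn_gt0 // ltr0n. Qed.
Hypotheses (d0 : (0 < d)%N) (k0 : (0 < k)%N).
Local Notation L := (4 * d + 2)%N.
Variables p r : R.
Hypotheses (p0 : 0 < p) (p1 : p <= 1) (r1 : 1 < r).
Local Notation D := (d - k)%N.
Local Notation q := (p * Mr ^+ D).
Hypothesis rq : r ^+ 3 <= q.
Variable s0 : R.
Hypothesis s00 : 0 < s0.
Hypothesis gE : Mr `^ s0 = q / r.
Variable x : word -> bool.

(** A retained cube of nonzero weight is hit through some [z], hence lies below a word of [cov]; the
    masses below the words add up to at least the whole. *)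
Lemma covered_flow sg C b0 N u cov : injective sg ->
  (forall z c : word, size z = (L * N)%N -> size c = N -> retained x c ->
    hit sg (@round_pt R d k M b0 L C N (L * N) u z) z c ->
    has (fun Q => (size Q <= size c)%N && (take (size Q) c == Q)) cov) ->
  flow p (net_weight sg b0 L C N (L * N) u) x [::] N <=
  \sum_(Q <- cov | (size Q <= N)%N) flow p (net_weight sg b0 L C N (L * N) u) x Q N.
Proof.
move=> sgI hcov; rewrite /flow -mulr_sumr ler_pM2l ?invr_gt0 ?exprn_gt0 //.
have w0 c : 0 <= net_weight sg b0 L C N (L * N) u c.
  by rewrite mulr_ge0 ?invr_ge0 ?(ltW (Mp _)) // sumr_ge0.
rewrite [leRHS](eq_bigr (fun Q => \sum_(c <- words d M N)
   if take (size Q) c == Q then net_weight sg b0 L C N (L * N) u c * (retained x c)%:R else 0)); last first.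
  by move=> Q _; rewrite big_mkcond.
rewrite exchange_big /= big_mkcond big_seq [leRHS]big_seq; apply: ler_sum => c /size_in_words cN.
rewrite take0 eqxx; case rc: (retained x c); last first.
  by rewrite mulr0 big1 // => Q _; case: ifP.
rewrite mulr1; have S0 : 0 <= \sum_(Q <- cov | (size Q <= N)%N)
    (if take (size Q) c == Q then net_weight sg b0 L C N (L * N) u c else 0).
  by apply: sumr_ge0 => Q _; case: ifP.
have [wz|wn] := eqVneq (net_weight sg b0 L C N (L * N) u c) 0; first by rewrite {1}wz.
have NL : (N <= L * N)%N by rewrite leq_pmull // addn2.
have [z zH hz] : exists2 z : word, size z = (L * N)%N & hit sg (round_pt b0 L C N (L * N) u z) z c.
  apply: contrapT => nz; move/eqP: wn; apply; rewrite net_weightE // ?cN //.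
  rewrite big_seq big1 ?mulr0 // => z /size_in_words zH.
  by case hz: hit => //; case: nz; exists z.
have /hasP[Q Qc /andP[QN Qp]] := hcov z c zH cN rc hz.
rewrite (big_rem Q) //= -cN QN Qp lerDl cN.
by apply: sumr_ge0 => Q' _; case: ifP.
Qed.

Variables (n1 : nat) (m : R).
Hypothesis flows : @net_flows R d k M L p r x n1.
Hypothesis m0 : 0 < m.
Hypothesis pop_ge : forall N, exists2 n, (N <= n)%N & m * (p * Mr ^+ d) ^+ n <= (pop x n)%:R.
Variable B : 'M[R]_(k, d).
Hypothesis frB : orthonormal_frame B.
Variable T : set 'rV[R]_k.
Local Notation fibre t := (mandelbrot x `&` [set y | y *m B^T = t]).
Hypothesis Tdim : forall t, ~ T t -> exists s, 0 <= s <= s0 /\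
  (fibre t !=set0 -> hausdorff_measure s (fibre t) = 0%E).

(** If [T] were null, the mean mass, at least [m] for suitable [N], would be shared among irregular,
    boxed and covered parameters, each kind contributing at most [m / 4]. *)
Lemma slices_positive : (0 < lebesgue_outer T)%E.
Proof.
have [sg [A [C [sgI uA Csg BE]]]] := pivot frB.
pose cm : R := \sum_l \sum_j `|C l j|.
have cm0 : 0 <= cm by apply: sumr_ge0 => l _; apply: sumr_ge0.
have hcm l j : `|C l j| <= cm.
  rewrite /cm (bigD1 l) //= (bigD1 j) //= -addrA lerDl addr_ge0 ?sumr_ge0 // => l' _.
  exact: sumr_ge0.
pose b0 := (Num.truncn (d%:R * (cm + 1) + 1)).+1.
have hb0 : d%:R * (cm + 1) + 1 <= b0%:R by apply: ltW; apply: truncnS_gt.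
have L0 : (0 < L)%N by rewrite addn2.
have hC := entry_le cm0 hcm hb0 d0.
pose Kir := irregular_const d k b0 r.
have [n2 n2M] := @expr_unbounded R Mr (4 * Kir / m) ltac:(by rewrite ltr1n).
(* [n2] makes the irregular share at most [m / 4], and [b0] guarantees [b0 <= M^n], as the nets
   require. *)
pose n3 := maxn (maxn n1 n2) b0.
have n13 : (n1 <= n3)%N by rewrite /n3 -maxnA leq_maxl.
have irr : Kir * Mr ^- n3 <= m / 4.
  have h : 4 * Kir / m <= Mr ^+ n3.
    apply: le_trans n2M _; rewrite ler_weXn2l ?ler1n //.
    by rewrite (leq_trans (leq_maxr n1 n2)) // leq_maxl.
  rewrite ler_pdivrMr // in h; rewrite ler_pdivrMr //; lra.
have b0M n : (n3 <= n)%N -> (b0 <= M ^ n)%N.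
  move=> h; apply: leq_trans (ltnW (ltn_expl b0 M1)) _; rewrite leq_exp2l //.
  by apply: leq_trans h; rewrite leq_maxr.
have steps n H u : (n3 <= n)%N -> (L * n.+1 <= H)%N ->
    (forall j, (u j < 2 * b0 * M ^ H)%N) -> flow_steps D p r (net_weight sg b0 L C n.+1 H u) x n.
  by move=> h nH hu; apply: flows => //; [exact: leq_trans h|exact: b0M].
have G1 := geom_ge1 r1; have qp : 0 < q by rewrite mulr_gt0.
pose C2 : R := expR (geom r) * (p ^- n3 * q ^+ n3 + 3 * geom r).
have C20 : 0 < C2.
  rewrite mulr_gt0 ?expR_gt0 // addr_gt0 //; last by rewrite mulr_gt0 // (lt_le_trans ltr01).
  by rewrite mulr_gt0 ?invr_gt0 ?exprn_gt0.
have C2E : C2 = expR (geom r) * (p ^- n3 * q ^+ n3 + 3 * geom r) by [].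
clearbody C2.
pose K3 : R := (2 * inv_norm A + 1) ^+ k.
have K30 : 0 < K3.
  have I0 : 0 <= inv_norm A by apply: sumr_ge0 => i _; apply: sumr_ge0.
  rewrite exprn_gt0 //; lra.
have K3E : K3 = (2 * inv_norm A + 1) ^+ k by [].
clearbody K3.
(* The boxes have total volume at most [ep] and their enlargement adds at most [2 ep], so their
   share is [C2 * K3 * 3 ep = m / 4]. *)
pose ep := m / (12 * C2 * K3); have ep0 : 0 < ep by rewrite divr_gt0 // !mulr_gt0.
pose V : R := (2 * b0%:R) ^+ k.
have V0 : 0 < V by rewrite exprn_gt0 // mulr_gt0 // ltr0n.
have VE : V = (2 * b0%:R) ^+ k by [].
clearbody V.
(* [V] is the volume of the parameter range, so the covered share is [C2 * eta * V = m / 4]. *)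
pose eta := m / (4 * C2 * V); have eta0 : 0 < eta by rewrite divr_gt0 // !mulr_gt0.
rewrite ltNge; apply/negP => T0.
have Tlt : (lebesgue_outer T < ep%:E)%E by apply: le_lt_trans T0 _; rewrite lte_fin.
have [Z [a [b [ab Tcov ZE]]] Zlt] := ereal_inf_lt Tlt.
have w0 n i : 0 <= b n ord0 i - a n ord0 i by rewrite subr_ge0.
pose vol n := \prod_(i < k) (b n ord0 i - a n ord0 i).
have vol_sum I : \sum_(0 <= n < I) vol n <= ep.
  rewrite -lee_fin -sumEFin; apply: le_trans (ltW Zlt); rewrite ZE.
  by apply: nneseries_lim_ge => n _ _; rewrite lee_fin prodr_ge0.
have ek n : 0 < ep * 2^-1 ^+ n by rewrite mulr_gt0 // exprn_gt0 // invr_gt0.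
have [rho hrho] := choice (fun n => prod_enlarge (index_enum 'I_k) (w0 n) (ek n)).
(* A third, because the sides grow by [rh n] at both ends and by [M^-H <= rh n] in
   [count_affine]. *)
pose rh n := rho n / 3; have rh0 n : 0 < rh n by have [h _] := hrho n; rewrite divr_gt0.
have [N0 alt] := @alternatives R d k M M1 B sg A C b0 L sgI Csg BE L0 cm cm0 hcm hb0 d0 x
  s0 s00 T a b rh eta rh0 eta0 Tcov Tdim.
have [fN hfN] := choice (fun n => @expr_unbounded R Mr (rh n)^-1 ltac:(by rewrite ltr1n)).
pose N3 := \max_(n < N0) fN n.
have [N Nbig popN] := pop_ge (maxn (maxn n3 N0) N3).
have [n3N N0N] : (n3 <= N)%N /\ (N0 <= N)%N.
  by move: Nbig; rewrite !geq_max => /andP[/andP[]].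
have hrh n : (n < N0)%N -> Mr ^- (L * N) <= rh n.
  move=> nN0; rewrite invf_ple ?posrE //; apply: le_trans (hfN n) _.
  rewrite ler_weXn2l ?ler1n //; apply: (@leq_trans N3); first exact: (leq_bigmax (Ordinal nN0)).
  by apply: leq_trans (_ : (N <= _)%N); [move: Nbig; rewrite geq_max => /andP[] | rewrite leq_pmull].
set H := (L * N)%N in hrh *.
pose f (u : {ffun 'I_k -> 'I_(2 * b0 * M ^ H)}) := flow p (net_weight sg b0 L C N H (fun j => u j)) x [::] N.
have L1 : 0 < p * Mr ^+ d by rewrite mulr_gt0.
have tot : m <= Mr ^- (H * k) * \sum_u f u.
  apply: le_trans (total_mass M0 sgI L0 cm0 hcm hb0 d0 x p0 N).
  by rewrite ler_pdivlMr ?exprn_gt0.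
pose reg (u : {ffun 'I_k -> 'I_(2 * b0 * M ^ H)}) := `[< regular M b0 L C p r n3 N (fun j => u j) >].
have MH : 0 < Mr ^- (H * k) by rewrite invr_gt0.
pose box_ind n (u : {ffun 'I_k -> 'I_(2 * b0 * M ^ H)}) : R :=
  [forall i, (((a n - const_mx (rh n)) : 'rV[R]_k) ord0 i <= grid_pt M A H b0 (fun j => u j) ord0 i) &&
     (grid_pt M A H b0 (fun j => u j) ord0 i <= ((b n + const_mx (rh n)) : 'rV[R]_k) ord0 i)]%:R.
have fle u : reg u -> f u <= C2 * (\sum_(0 <= n < N0) box_ind n u) + C2 * eta.
  move=> /asboolP hr; have hu j : (u j < 2 * b0 * M ^ H)%N by [].
  have S0 : 0 <= \sum_(0 <= n < N0) box_ind n u by apply: sumr_ge0.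
  have reg_le Q : (size Q <= N)%N -> flow p (net_weight sg b0 L C N H (fun j => u j)) x Q N <=
      C2 * (r ^+ size Q / q ^+ size Q).
    by move=> QN; rewrite C2E; apply: (regular_flow M1 sgI hC (leqnn _) p0 p1 r1 rq steps).
  have [[n nN0 inb]|[cov [scov hcov]]] := alt N (fun j => u j) N0N hu.
    apply: (@le_trans _ _ C2); last first.
      rewrite -[leLHS]addr0 lerD //; last by rewrite mulr_ge0 // ltW.
      rewrite ler_peMr ?(ltW C20) // (bigD1_seq n) ?mem_index_iota ?iota_uniq //=.
      have -> : box_ind n u = 1.
        rewrite /box_ind; case: forallP => // -[] i; have [h1 h2] := inb i.
        have -> : (a n - const_mx (rh n)) ord0 i = a n ord0 i - rh n by rewrite !mxE.
        by have -> : (b n + const_mx (rh n)) ord0 i = b n ord0 i + rh n; [rewrite !mxE | rewrite h1 h2].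
      by rewrite lerDl sumr_ge0.
    by have := reg_le [::] isT; rewrite !expr0 divr1 mulr1.
  apply: (@le_trans _ _ (C2 * eta)); last by rewrite lerDr mulr_ge0 // ltW.
  apply: le_trans (covered_flow sgI hcov) _.
  apply: (@le_trans _ _ (\sum_(Q <- cov | (size Q <= N)%N) C2 * (Mr `^ s0) ^- size Q)).
    apply: ler_sum => Q QN; apply: le_trans (reg_le Q QN) _.
    by rewrite gE expr_div_n invf_div.
  rewrite -mulr_sumr ler_pM2l //; apply: le_trans scov.
  by rewrite big_mkcond /=; apply: ler_sum => Q _; case: ifP; rewrite // invr_ge0 exprn_ge0 // powR_ge0.
have irr_le : Mr ^- (H * k) * \sum_(u | ~~ reg u) f u <= m / 4.
  apply: le_trans irr; exact: (irregular_mass M1 sgI hC (leqnn _) k0 p0 p1 r1 rq steps n3N).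
have box_le n : (n < N0)%N -> Mr ^- (H * k) * \sum_u box_ind n u <= K3 * (vol n + ep * 2^-1 ^+ n).
  move=> nN0; have [r0 hr] := hrho n.
  have := @count_affine R k M A M0 uA H (2 * b0 * M ^ H) b0 (a n - const_mx (rh n)) (b n + const_mx (rh n)).
  move=> cnt; rewrite ler_pdivrMl //; apply: le_trans (cnt _) _.
    move=> i; rewrite !mxE; apply: (@le_trans _ _ (a n ord0 i)); first by rewrite gerBl ltW.
    by apply: le_trans (ab n i) _; rewrite lerDl ltW.
  rewrite -K3E mulrCA ler_pM2l // ler_pM2l //.
  apply: (@le_trans _ _ (\prod_i (b n ord0 i - a n ord0 i + rho n))); last first.
    by apply: hr; rewrite lexx (ltW r0).
  apply: ler_prod => i _; rewrite !mxE; have hN := hrh n nN0; have w := w0 n i.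
  have hh : 0 <= Mr ^- H by rewrite invr_ge0 ltW.
  have rE : rho n = 3 * rh n by rewrite /rh mulrCA mulfV ?mulr1 // pnatr_eq0.
  have -> : b n ord0 i + rh n - (a n ord0 i - rh n) + Mr ^- H =
    (b n ord0 i - a n ord0 i) + (rh n + rh n + Mr ^- H) by ring.
  have -> : rho n = rh n + rh n + rh n by rewrite rE; ring.
  have rp := ltW (rh0 n); rewrite addr_ge0 ?(addr_ge0 (addr_ge0 rp rp)) //=.
  by rewrite !lerD2l.
have reg_sum : Mr ^- (H * k) * \sum_(u | reg u) f u <= C2 * (K3 * (3 * ep)) + C2 * eta * V.
  apply: (@le_trans _ _ (Mr ^- (H * k) * \sum_u (C2 * (\sum_(0 <= n < N0) box_ind n u) + C2 * eta))).
    rewrite ler_pM2l // big_mkcond /=; apply: ler_sum => u _; case: ifP => [/fle //|_].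
    have S0 : 0 <= \sum_(0 <= n < N0) box_ind n u by apply: sumr_ge0.
    by apply: addr_ge0; apply: mulr_ge0; rewrite // ltW.
  rewrite big_split /= -mulr_sumr mulrDr; apply: lerD; last first.
    have -> : \sum_(u : {ffun 'I_k -> 'I_(2 * b0 * M ^ H)}) C2 * eta = V * Mr ^+ (H * k) * (C2 * eta).
      by rewrite sumr_const card_ffun !card_ord -[LHS]mulr_natl VE natrX !natrM natrX exprMn -exprM.
    have := gt_eqF (Mp (H * k)); move: (Mr ^+ (H * k)) => y /negbT y0.
    suff -> : y^-1 * (V * y * (C2 * eta)) = C2 * eta * V by [].
    by field.
  rewrite mulrCA ler_pM2l // exchange_big /= mulr_sumr.
  apply: (@le_trans _ _ (\sum_(0 <= n < N0) K3 * (vol n + ep * 2^-1 ^+ n))).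
    by apply: ler_sum_nat => n /andP[_ nN0]; exact: box_le.
  rewrite -mulr_sumr ler_pM2l // big_split /= -mulr_sumr.
  have : ep * \sum_(0 <= l < N0) (2^-1 : R) ^+ l <= ep * 2 by rewrite ler_pM2l // sum_half_le2.
  have -> : 3 * ep = ep + ep * 2 by ring.
  exact: lerD (vol_sum N0).
have e1 : C2 * (K3 * (3 * ep)) = m / 4 by rewrite /ep; field; rewrite !gt_eqF.
have e2 : C2 * eta * V = m / 4 by rewrite /eta; field; rewrite !gt_eqF.
move: tot; rewrite (bigID reg) /= mulrDr leNgt => /negP; apply.
apply: le_lt_trans (lerD reg_sum irr_le) _; rewrite e1 e2; have := m0; lra.
Qed.

End Slices.

Theorem theorem3p4 (R : realType) (d k M : nat) (p : R)
  (dO : measure_display) (Omega : measurableType dO) (P : probability Omega R)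
  (X : Omega -> seq (digit d M) -> bool) :
  (2 <= d)%N -> (1 <= k <= d - 1)%N -> (2 <= M)%N ->
  (M%:R : R) ^- (d - k) < p -> p < 1 ->
  (* each retention event is measurable *)
  (forall s, measurable [set w | X w s]) ->
  (* the retention events of distinct (non-root) cubes are mutually
     independent, each of probability p *)
  (forall F : seq (seq (digit d M)), uniq F -> all (fun s => (0 < size s)%N) F ->
     P (\big[setI/setT]_(s <- F) [set w | X w s]) = (p ^+ size F)%:E) ->
  forall eps : R, 0 < eps ->
  P.-negligible
    [set w | @mandelbrot R d M (X w) !=set0 /\
       ~ (forall B : 'M[R]_(k, d), orthonormal_frame B ->
            (0 < lebesgueV B
                   [set x | (exists t : 'rV[R]_k, x = t *m B) /\
                      (dimH (@mandelbrot R d M (X w) `&` [set y | projV B y = x])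
                         >= dimH (@mandelbrot R d M (X w)) - (k%:R + eps)%:E)%E])%E)].
Proof.
move=> d2 /andP[k1 kd] M1 pM p1 mX indX eps eps0.
have M0 : (0 < M)%N := ltnW M1.
have Mp e : (0 : R) < M%:R ^+ e by rewrite exprn_gt0 // ltr0n.
have Mr1 : (1 : R) < M%:R by rewrite ltr1n.
have Mn0 : (M%:R : R) != 0 by rewrite gt_eqF // (lt_trans ltr01).
have lnM : 0 < ln (M%:R : R) by rewrite ln_gt0.
have d0 : (0 < d)%N by lia.
have dk : (d - k + k = d)%N by lia.
have p0 : 0 < p by apply: lt_trans pM; rewrite invr_gt0.
set q := p * M%:R ^+ (d - k).
have q1 : 1 < q by rewrite -ltr_pdivrMr // div1r.
have q0 : 0 < q := lt_trans ltr01 q1.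
have powR_gt1 (c e : R) : 1 < c -> 0 < e -> 1 < c `^ e.
  move=> c1 e0; rewrite -[ltLHS]expR0 /powR gt_eqF ?(lt_trans ltr01) // ltr_expR.
  by rewrite mulr_gt0 // ln_gt0.
(* The first bound gives [r^3 <= q] for the exponential moment, the second [r^2 <= M^eps] for the
   comparison of dimensions. *)
pose r := Num.min (q `^ 3^-1) (M%:R `^ (eps / 2)).
have r1 : 1 < r by rewrite lt_min !powR_gt1 // divr_gt0.
have r0 : 0 < r := lt_trans ltr01 r1.
have rq : r ^+ 3 <= q.
  apply: (@le_trans _ _ ((q `^ 3^-1) ^+ 3)).
    by rewrite lerXn2r ?nnegrE ?powR_ge0 ?(ltW r0) // ge_min lexx.
  by rewrite -powR_mulrn ?powR_ge0 // -powRrM mulVf ?powRr1 ?(ltW q0) // pnatr_eq0.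
have r2 : r ^+ 2 <= M%:R `^ eps.
  apply: (@le_trans _ _ ((M%:R `^ (eps / 2)) ^+ 2)).
    by rewrite lerXn2r ?nnegrE ?powR_ge0 ?(ltW r0) // ge_min lexx orbT.
  by rewrite -powR_mulrn ?powR_ge0 // -powRrM mulfVK // pnatr_eq0.
have qr1 : 1 < q / r.
  rewrite ltr_pdivlMr // mul1r; apply: lt_le_trans rq.
  by rewrite -[ltLHS]expr1 ltr_eXn2l.
pose s0 := ln (q / r) / ln (M%:R : R).
have s00 : 0 < s0 by rewrite divr_gt0 // ln_gt0.
have gE : (M%:R : R) `^ s0 = q / r.
  rewrite /powR gt_eqF ?ltr0n // /s0 mulfVK ?gt_eqF // lnK // posrE.
  exact: lt_trans qr1.
have qL : q <= p * M%:R ^+ d by rewrite ler_pM2l // ler_weXn2l ?ler1n // leq_subr.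
have L1 : 1 < p * M%:R ^+ d := lt_le_trans q1 qL.
have L0 : (0 < 4 * d + 2)%N by rewrite addn2.
have n1 := ae_net_flows M1 p0 (ltW p1) r1 L0 rq mX indX.
have n2 := ae_pop_bounded M0 p0 (ltW p1) r1 (le_trans rq qL) mX indX.
have n3 := ae_population M0 p0 p1 L1 mX indX.
apply: negligibleS (negligibleU (negligibleU n1 n2) n3) => w /= [[y0 Ky0] hw].
apply: contrapT => hn; apply: hw => B frB.
have [N1 flows] : exists N, net_flows k (4 * d + 2) p r (X w) N.
  by apply: contrapT => h; apply: hn; left; left.
have [K hK] : exists K : R, forall n, (pop (X w) n)%:R <= K * (p * M%:R ^+ d) ^+ n.
  by apply: contrapT => h; apply: hn; left; right.
have [m m0 hm] : exists2 m : R, 0 < m & forall N, exists2 n, (N <= n)%N &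
    m * (p * M%:R ^+ d) ^+ n <= (pop (X w) n)%:R.
  apply: contrapT => h; apply: hn; right; split => // n.
  have [s [sn rs] _] := Ky0 n I.
  by rewrite /pop -has_count; apply/hasP; exists s => //; rewrite mem_words sn.
(* [Lam = q M^k] is below [M^(s0 + k + eps) = (q / r) M^k M^eps], because [M^eps >= r^2] leaves a
   spare factor [r > 1]. *)
have dimK : (dimH (@mandelbrot R d M (X w)) <= (s0 + (k%:R + eps))%:E)%E.
  apply: (dimH_mandelbrot_le M1 _ (lt_trans ltr01 L1) _ hK).
    by rewrite !addr_ge0 // ltW.
  rewrite powRD; last by rewrite Mn0 implybT.
  rewrite powRD; last by rewrite Mn0 implybT.
  rewrite powR_mulrn // gE.
  apply: (@lt_le_trans _ _ (q / r * (M%:R ^+ k * r ^+ 2))).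
    have -> : q / r * (M%:R ^+ k * r ^+ 2) = p * (M%:R ^+ (d - k) * M%:R ^+ k) * r.
      by rewrite /q; field; rewrite gt_eqF.
    by rewrite -exprD dk ltr_pMr // (lt_trans ltr01).
  by rewrite ler_pM2l ?divr_gt0 // ler_pM2l.
apply: (slices_positive M1 d0 k1 p0 (ltW p1) r1 rq s00 gE flows m0 hm frB) => t nT.
(* For an orthonormal frame, [y *m B^T] gives the coordinates of the projection in the basis [B]. *)
have fE : @mandelbrot R d M (X w) `&` [set y | projV B y = t *m B] =
    @mandelbrot R d M (X w) `&` [set y | y *m B^T = t].
  apply/seteqP; split => y [Ky] /=; rewrite /projV => e; split => //=.
    by have := congr1 (mulmx^~ B^T) e; rewrite -!mulmxA frB !mulmx1.
  by rewrite e.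
have [ne|em] := pselect (@mandelbrot R d M (X w) `&` [set y | y *m B^T = t] !=set0); last first.
  by exists 0; rewrite lexx ltW.
have : (dimH (@mandelbrot R d M (X w) `&` [set y | y *m B^T = t]) < s0%:E)%E.
  have lt1 : (dimH (@mandelbrot R d M (X w) `&` [set y | y *m B^T = t]) <
      dimH (@mandelbrot R d M (X w)) - (k%:R + eps)%:E)%E.
    rewrite ltNge; apply/negP => h; apply: nT; split; first by exists t.
    by rewrite fE.
  by apply: lt_le_trans lt1 _; rewrite leeBlDr // -EFinD.
by move=> /(dimH_lt ne)[s [hs Hs]]; exists s; split.
Qed.
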